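(* Let $k\ge 1$, and let $\mathfrak{a}_k$ be the two-sort species of $k$-trees with $X$-labels on hedra and $Y$-labels on fronts. Let $Z_Y(\sigma)$ ($\sigma\in\mathfrak S_k$) and $Z_{XY}(\sigma)$ ($\sigma\in\mathfrak S_{k+1}$) be the power series defined recursively in the context. Then the cycle index of $\mathfrak{a}_k$ is $$Z_{\mathfrak{a}_k} = \frac{1}{(k+1)!}\sum_{\sigma\in\mathfrak S_{k+1}} Z_{XY}(\sigma) + \frac{1}{k!}\sum_{\sigma\in\mathfrak S_k} Z_Y(\sigma) - \frac{1}{k!}\sum_{\sigma\in\mathfrak S_k} Z_{XY}(\Delta\sigma).$$
   Context: $k$-trees: the complete graph $K_k$ is a $k$-tree, and any graph obtained from a $k$-tree by adding a new vertex joined exactly to the vertices of some existing $k$-clique is a $k$-tree. A hedron of a $k$-tree is a $(k+1)$-clique, a front is a $k$-clique. For finite sets $U,V$, $\mathfrak a_k[U,V]$ is the set of $k$-trees with hedra bijectively labeled by $U$ and fronts bijectively labeled by $V$, up to graph isomorphism respecting the labels (vertices carry no labels); bijections act by relabeling. The cycle index of a two-sort species $F$ is $$Z_F=\sum_{m,n\ge0}\frac{1}{m!\,n!}\sum_{(\pi,\tau)\in\mathfrak S_m\times\mathfrak S_n}\operatorname{fix}(F[\pi,\tau])\prod_j p_j[x]^{\pi_j}p_j[y]^{\tau_j},$$ where $\pi_j$ is the number of $j$-cycles of $\pi$ (same for $\tau$), $\operatorname{fix}$ is the number of fixed points, and $p_j[x],p_j[y]$ are indeterminates. $\Delta:\mathfrak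 S_k\to\mathfrak S_{k+1}$ is the embedding onto permutations fixing $k+1$. For $\sigma\in\mathfrak S_{k+1}$ and $i\in\{1,\dots,k+1\}$, $\rho_i(\sigma)\in\mathfrak S_{k+1}$ is $a\mapsto\sigma(i+a)-\sigma(i)$, all sums and differences reduced modulo $k+1$ to representatives in $\{1,\dots,k+1\}$; it fixes $k+1$. For a cycle $c=(c_1,\dots,c_m)$ of $\sigma$ (so $\sigma(c_j)=c_{j+1}$, indices mod $m$), $|c|=m$ and $\prod_{i\in c}\rho_i(\sigma)=\rho_{c_m}(\sigma)\circ\cdots\circ\rho_{c_1}(\sigma)$ for any choice of starting point. $C(\sigma)$ is the set of cycles of $\sigma$ (fixed points included). For a series $f$ in the variables $p_j[x],p_j[y]$, $f\langle m\rangle$ denotes the result of replacing each $p_j[x]$ by $p_{mj}[x]$ and each $p_j[y]$ by $p_{mj}[y]$. The family $(Z_Y(\sigma))_{\sigma\in\mathfrak S_k}$ is the (unique) family of power series satisfying $$Z_Y(\sigma)=p_1[y]\cdot\exp\Bigl(\sum_{n\ge1}\tfrac1n\,f(\sigma^n)\langle n\rangle\Bigr),\qquad f(\sigma)=p_1[x]\prod_{c\in C(\sigma)}Z_Y\Bigl(\Delta^{-1}\prod_{i\in c}\rho_i(\Delta\sigma)\Bigr)\langle|c|\rangle ,$$ where $C(\sigma)$ is taken for $\sigma$ as a permutation of $\{1,\dots,k\}$, and for $\sigma\in\mathfrak S_{k+1}$ $$Z_{XY}(\sigma)=p_1[x]\prod_{c\in C(\sigma)}Z_Y\Bigl(\Delta^{-1}\prod_{i\in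 c}\rho_i(\sigma)\Bigr)\langle|c|\rangle .$$ *)

(* Defs.v *)
From HB Require Import structures.
From mathcomp Require Import all_boot all_order all_algebra all_fingroup.
From mathcomp Require Import finmap multiset.
From mathcomp Require Import mathcomp_extra boolp classical_sets functions.
From mathcomp Require Import cardinality fsbigop.

Set Implicit Arguments.
Unset Strict Implicit.
Unset Printing Implicit Defensive.

Import GRing.Theory Num.Theory.

Local Open Scope classical_set_scope.
Local Open Scope ring_scope.

(* [inl i] stands for p_(i+1)[x] and [inr i] for p_(i+1)[y]. *)
Notation pvar := (nat + nat)%type.

Notation monomial := {mset pvar}%mset.

Definition mon_mul (u v : monomial) : monomial := msetD u v.

(* A series is given by its coefficients. *)
Definition series : Type := monomial -> rat^o.
HB.instance Definition _ := GRing.Lmodule.copy series (monomial -> rat^o).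

Definition splits (u : monomial) : seq (monomial * monomial) :=
  undup [seq (seq_mset (mask b (enum_mset u)),
              seq_mset (mask (map negb b) (enum_mset u)))
        | b : (size (enum_mset u)).-tuple bool].

Lemma perm_mask_negb (T : eqType) (b : bitseq) (s : seq T) :
  size b = size s -> perm_eq (mask b s ++ mask (map negb b) s) s.
Proof.
elim: s b => [|x s IH] [|c b] //= [sb].
case: c => /=; first by rewrite perm_cons IH.
by rewrite -cat1s perm_catCA /= perm_cons IH.
Qed.

Lemma mem_splits (u : monomial) (p : monomial * monomial) :
  (p \in splits u) = (mon_mul p.1 p.2 == u).
Proof.
have cnt (w : monomial) (a : pvar) : count_mem a (enum_mset w) = w a.
  exact: count_mem_mset.
rewrite mem_undup; apply/idP/eqP => [/mapP[b _ ->] /=|].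
  apply/msetP => a; rewrite msetE2 !mset_seqE -count_cat.
  have /seq.permP -> : perm_eq (mask b (enum_mset u) ++
      mask (map negb b) (enum_mset u)) (enum_mset u).
    by apply: perm_mask_negb; rewrite size_tuple.
  exact: cnt.
case: p => v w /= uE.
have /count_subseqP[s /subseqP[b sb sE] vs] :
    forall a, (count_mem a (enum_mset v) <= count_mem a (enum_mset u))%N.
  by move=> a; rewrite !cnt -uE /mon_mul msetE2 leq_addr.
have sb' : size b == size (enum_mset u) by apply/eqP.
apply/mapP; exists (Tuple sb'); first by rewrite mem_enum.
have va a : v a = count_mem a s by rewrite -cnt; apply/seq.permP.
congr pair; apply/msetP => a; rewrite mset_seqE /=; first by rewrite va sE.
have ua : u a = (v a + w a)%N by rewrite -uE /mon_mul msetE2.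
have /seq.permP/(_ (pred1 a)) := perm_mask_negb sb.
by rewrite count_cat cnt ua va sE => /addnI.
Qed.

Definition series_one : series := fun u => (u == mset0)%:R.
Definition series_mul (f g : series) : series :=
  fun u => \sum_(p <- splits u) f p.1 * g p.2.

Fact series_mulC : commutative series_mul.
Proof.
move=> f g; apply/funext => u; rewrite /series_mul.
pose sw (p : monomial * monomial) := (p.2, p.1).
have swK : involutive sw by case.
have swP : perm_eq (splits u) (map sw (splits u)).
  apply: uniq_perm; rewrite ?map_inj_uniq ?undup_uniq //; first exact: inv_inj.
  move=> p; rewrite -(swK p) (mem_map (inv_inj swK)) !mem_splits /=.
  by rewrite /mon_mul msetDC.
rewrite [RHS](perm_big _ swP) big_map.
by apply: eq_bigr => p _; rewrite mulrC.
Qed.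

Fact series_mulA : associative series_mul.
Proof.
move=> f g h; apply/funext => u; rewrite /series_mul.
pose L := [seq (p.1, q.1, q.2) | p <- splits u, q <- splits p.2].
pose M := [seq (q.1, q.2, p.2) | p <- splits u, q <- splits p.1].
pose F (t : monomial * monomial * monomial) := f t.1.1 * (g t.1.2 * h t.2).
have LE : \sum_(t <- L) F t =
    \sum_(p <- splits u) f p.1 * \sum_(q <- splits p.2) g q.1 * h q.2.
  rewrite big_allpairs_dep; apply: eq_bigr => p _.
  by rewrite mulr_sumr; apply: eq_bigr.
have ME : \sum_(t <- M) F t =
    \sum_(p <- splits u) (\sum_(q <- splits p.1) f q.1 * g q.2) * h p.2.
  rewrite big_allpairs_dep; apply: eq_bigr => p _.
  by rewrite mulr_suml; apply: eq_bigr => q _; rewrite /F mulrA.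
rewrite -LE -ME; apply: perm_big; apply: uniq_perm.
- apply: allpairs_uniq_dep => [|p _|]; rewrite ?undup_uniq //.
  move=> t t' /allpairsPdep[[a b] [[c d] [ab cd ->]]].
  move=> /allpairsPdep[[a' b'] [[c' d'] [ab' cd' ->]]] /= [? ? ?]; subst.
  by move: cd cd'; rewrite !mem_splits /= => /eqP <- /eqP <-.
- apply: allpairs_uniq_dep => [|p _|]; rewrite ?undup_uniq //.
  move=> t t' /allpairsPdep[[a b] [[c d] [ab cd ->]]].
  move=> /allpairsPdep[[a' b'] [[c' d'] [ab' cd' ->]]] /= [? ? ?]; subst.
  by move: cd cd'; rewrite !mem_splits /= => /eqP <- /eqP <-.
move=> [[a b] c]; apply/allpairsPdep/allpairsPdep.
  move=> [[x y] [[z w] [xy zw [-> -> ->]]]].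
  move: xy zw; rewrite !mem_splits /= => /eqP <- /eqP <-.
  exists (mon_mul x z, w), (x, z); rewrite !mem_splits /= eqxx; split => //.
  by rewrite /mon_mul msetDA.
move=> [[x y] [[z w] [xy zw [-> -> ->]]]].
move: xy zw; rewrite !mem_splits /= => /eqP <- /eqP <-.
exists (z, mon_mul w y), (w, y); rewrite !mem_splits /= eqxx; split => //.
by rewrite /mon_mul msetDA.
Qed.

Fact series_mul1 : left_id series_one series_mul.
Proof.
move=> f; apply/funext => u; rewrite /series_mul.
have u0 : (mset0, u) \in splits u by rewrite mem_splits /mon_mul mset0D.
rewrite (bigD1_seq (mset0, u)) ?undup_uniq //= /series_one eqxx mul1r.
rewrite big_seq_cond big1 ?addr0 // => -[a b] /andP[].
rewrite mem_splits /= /mon_mul => /eqP abu nab.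
case: eqP => [a0|_]; last by rewrite mul0r.
by move: nab; rewrite -abu a0 mset0D eqxx.
Qed.

Fact series_mulDl : left_distributive series_mul +%R.
Proof.
move=> f g h; apply/funext => u.
rewrite /series_mul; transitivity (\sum_(p <- splits u)
   (f p.1 * h p.2 + g p.1 * h p.2)); last by rewrite big_split.
by apply: eq_bigr => p _; rewrite -mulrDl.
Qed.

Fact series_one_neq0 : series_one != 0.
Proof.
apply/eqP => /(congr1 (@^~ mset0)); rewrite /series_one eqxx => /eqP.
by rewrite oner_eq0.
Qed.

HB.instance Definition _ := GRing.Zmodule_isComNzRing.Build series
  series_mulA series_mulC series_mul1 series_mulDl series_one_neq0.

Fact series_scalerAl (a : rat) (f g : series) : a *: (f * g) = a *: f * g.
Proof.
apply/funext => u; rewrite [LHS]mulr_sumr.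
by apply: eq_bigr => p _; rewrite mulrA.
Qed.

HB.instance Definition _ :=
  GRing.Lmodule_isLalgebra.Build rat series series_scalerAl.

Definition smon (u : monomial) : series := fun v => (v == u)%:R.

(* p_j[x] and p_j[y]; the index shift makes them meaningful for j >= 1 only. *)
Definition px (j : nat) : series := smon (msetn 1 (inl j.-1)).
Definition py (j : nat) : series := smon (msetn 1 (inr j.-1)).

(* Formal sum of a family of series in which every monomial occurs finitely
   many times: the coefficient at [u] is a sum with finite support. *)
Definition ssum (I : choiceType) (A : set I) (F : I -> series) : series :=
  fun u => \sum_(i \in A) F i u.

(* Meaningful for [g] without constant term. *)
Definition sexp (g : series) : series :=
  ssum [set: nat] (fun n => (n`!%:R : rat)^-1 *: g ^+ n).

(* [dil m f] is f<m>: every p_j is replaced by p_(m j), for m >= 1. *)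
Definition dil_var (m : nat) (v : pvar) : pvar :=
  match v with
  | inl i => inl (m * i.+1).-1
  | inr i => inr (m * i.+1).-1
  end.

Definition dil_mon (m : nat) (u : monomial) : monomial :=
  seq_mset [seq dil_var m v | v <- enum_mset u].

Definition dil (m : nat) (f : series) : series :=
  fun u => \sum_(v \in [set v | dil_mon m v = u]) f v.

(* Structures on [(U, V)] are the members of the set [@sp_str U V] of a fixed
   ambient type; transport is constrained along bijections only. *)
Record species2 := Species2 {
  sp_univ : finType -> finType -> choiceType;
  sp_str : forall U V : finType, set (sp_univ U V);
  sp_tr : forall U V U' V' : finType,
    (U -> U') -> (V -> V') -> sp_univ U V -> sp_univ U' V';
  sp_finite : forall U V : finType, finite_set (@sp_str U V);
  sp_tr_str : forall (U V U' V' : finType) (f : U -> U') (g : V -> V') s,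
    bijective f -> bijective g -> sp_str s -> sp_str (sp_tr f g s);
  sp_tr_id : forall (U V : finType) (s : sp_univ U V),
    sp_str s -> sp_tr id id s = s;
  sp_tr_comp : forall (U V U' V' U'' V'' : finType)
      (f : U -> U') (g : V -> V') (f' : U' -> U'') (g' : V' -> V'') s,
    bijective f -> bijective g -> bijective f' -> bijective g' -> sp_str s ->
    sp_tr (f' \o f) (g' \o g) s = sp_tr f' g' (sp_tr f g s)
}.

Definition sp_fix (F : species2) (U V : finType)
    (pi : {perm U}) (tau : {perm V}) : nat :=
  #|` fset_set [set s : sp_univ F U V | sp_str s /\ sp_tr pi tau s = s]|%fset.

Definition ncycles (T : finType) (s : {perm T}) (j : nat) : nat :=
  #|[set c in porbits s | #|c| == j]%SET|.

Definition cycle_index (F : species2) : series :=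
  ssum [set: nat * nat] (fun mn : nat * nat =>
    ((mn.1)`!%:R * (mn.2)`!%:R : rat)^-1 *:
    \sum_(pt : 'S_(mn.1) * 'S_(mn.2))
      ((sp_fix F pt.1 pt.2)%:R : rat) *:
      \prod_(1 <= j < (mn.1 + mn.2).+1)
        (px j ^+ ncycles pt.1 j * py j ^+ ncycles pt.2 j)).

Section Graphs.
Variables (T : finType) (e : rel T).

Definition clique (j : nat) (A : {set T}) : bool :=
  (#|A| == j) && [forall x in A, forall y in A, (x != y) ==> e x y].

(* [ktree_on k S]: the subgraph induced on [S] is a k-tree. *)
Inductive ktree_on (k : nat) : {set T} -> Prop :=
| KtreeBase S : clique k S -> ktree_on k S
| KtreeStep S v (A : {set T}) : ktree_on k S -> v \notin S ->
    A \subset S -> clique k A -> (forall x, x \in S -> e v x = (x \in A)) ->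
    ktree_on k (v |: S)%SET.

Definition ktree (k : nat) : Prop :=
  [/\ symmetric e, irreflexive e & ktree_on k [set: T]%SET].

Lemma ktree_on_hedra k (S : {set T}) : symmetric e -> ktree_on k S ->
  (#|[set A : {set T} | clique k.+1 A && (A \subset S)]%SET| + k = #|S|)%N.
Proof.
move=> esym; elim=> {S} [S /andP[/eqP Sk _]|S v A _ IH vS AS Ak eA].
  rewrite Sk [X in (X + _)%N](_ : _ = 0%N) //; apply/eqP; rewrite cards_eq0.
  rewrite -finset.subset0; apply/fintype.subsetP => B; rewrite !inE => /andP[/andP[/eqP Bk _]].
  by move=> /subset_leq_card; rewrite Bk Sk ltnn.
have vA : v \notin A by apply: contra vS => /(fintype.subsetP AS).
set H := [set B : {set T} | _]%SET.
have -> : H = (v |: A |: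
    [set B : {set T} | clique k.+1 B && (B \subset S)])%SET.
  apply/setP => B; rewrite !inE; apply/idP/idP; last first.
    move=> /orP[/eqP ->|/andP[-> BS]]; last first.
      by rewrite (fintype.subset_trans BS) ?finset.subsetUr.
    rewrite finset.setUS // andbT /clique cardsU1 vA add1n eqSS.
    case/andP: Ak => -> /forall_inP eAA /=.
    apply/forall_inP => x /finset.setU1P xA; apply/forall_inP => y /finset.setU1P yA.
    apply/implyP => xy; case: xA yA xy => [->|xA] [->|yA]; rewrite ?eqxx //.
    - by move=> _; rewrite eA // (fintype.subsetP AS).
    - by move=> _; rewrite esym eA // (fintype.subsetP AS).
    - by move: (eAA _ xA) => /forall_inP/(_ _ yA)/implyP.
  move=> /andP[Bcl BvS]; case vB: (v \in B); last first.
    apply/orP; right; rewrite Bcl; apply/fintype.subsetP => x xB.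
    move: (fintype.subsetP BvS _ xB) => /finset.setU1P[xv|//].
    by rewrite -xv xB in vB.
  apply/orP; left; rewrite -(finset.setD1K vB); apply/eqP; congr (v |: _)%SET.
  case/andP: Bcl => /eqP Bk /forall_inP eBB.
  apply/eqP; rewrite eqEcard; apply/andP; split.
    apply/fintype.subsetP => x /finset.setD1P[xv xB].
    move: (fintype.subsetP BvS _ xB) => /finset.setU1P[/eqP|xS]; first by rewrite (negbTE xv).
    rewrite -eA //; move: (eBB _ vB) => /forall_inP/(_ _ xB)/implyP; apply.
    by rewrite eq_sym.
  case/andP: Ak => /eqP -> _.
  by move: Bk; rewrite (cardsD1 v) vB add1n => -[->].
rewrite !cardsU1 vS -IH addnA inE negb_and.
by rewrite [X in _ || X](_ : _ = true) ?orbT //; apply: contra vS => /fintype.subsetP->;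
  rewrite ?finset.setU11.
Qed.

End Graphs.

(* A finite graph on some ['I_n] (every finite graph is isomorphic to one of
   this form) with vertex sets indexed by [U] and [V]. *)
Record lgraph (U V : finType) := LGraph {
  gorder : nat;
  gedge : rel 'I_gorder;
  hed : U -> {set 'I_gorder};
  fro : V -> {set 'I_gorder}
}.

Definition labeled_ktree (k : nat) (U V : finType) (t : lgraph U V) : Prop :=
  [/\ ktree (@gedge _ _ t) k,
      set_bij [set: U] [set A | clique (@gedge _ _ t) k.+1 A] (@hed _ _ t)
    & set_bij [set: V] [set A | clique (@gedge _ _ t) k A] (@fro _ _ t)].

Definition lgraph_iso (U V : finType) (t t' : lgraph U V) : Prop :=
  exists phi : 'I_(gorder t) -> 'I_(gorder t'),
    [/\ bijective phi,
        forall x y, gedge (phi x) (phi y) = gedge x y,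
        forall u, hed t' u = (phi @: hed t u)%SET
      & forall v, fro t' v = (phi @: fro t v)%SET].

Definition iso_class (U V : finType) (t : lgraph U V) : set (lgraph U V) :=
  [set t' | lgraph_iso t t'].

Definition ktree_str (k : nat) (U V : finType) : set (set (lgraph U V)) :=
  [set C | exists2 t, labeled_ktree k t & C = iso_class t].

Definition relabel (U V U' V' : finType) (f : U -> U') (g : V -> V')
  (t : lgraph U' V') : lgraph U V :=
  LGraph (@gedge _ _ t) (@hed _ _ t \o f) (@fro _ _ t \o g).

(* A graph belongs to the class transported along the bijections [f], [g] when
   giving the label [u] to its hedron labeled [f u], and [v] to its front
   labeled [g v], yields a member of the original class. *)
Definition ktree_tr (U V U' V' : finType) (f : U -> U') (g : V -> V')
  (C : set (lgraph U V)) : set (lgraph U' V') := relabel f g @^-1` C.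

Lemma labeled_ktree_order k (U V : finType) (t : lgraph U V) :
  labeled_ktree k t -> gorder t = (#|U| + k)%N.
Proof.
move=> [[esym _ tk] [hsub hinj hsurj] _].
have := ktree_on_hedra esym tk; rewrite cardsT card_ord => <-; congr (_ + k)%N.
rewrite -(card_imset predT (f := hed t)); last first.
  by move=> x y xy; apply: hinj; rewrite ?inE.
apply: eq_card => A; rewrite !inE finset.subsetT andbT; apply/idP/imsetP.
  by move=> /hsurj[u _ <-]; exists u.
by move=> [u _ ->]; apply: hsub.
Qed.

Fact ktree_str_finite k (U V : finType) : finite_set (@ktree_str k U V).
Proof.
pose n := (#|U| + k)%N.
pose D : finType :=
  ({set 'I_n * 'I_n} * {ffun U -> {set 'I_n}} * {ffun V -> {set 'I_n}})%type.
pose G (d : D) : set (lgraph U V) :=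
  iso_class (LGraph (fun x y => (x, y) \in d.1.1) d.1.2 d.2).
apply: (@sub_finite_set _ _ (G @` [set: D])); last first.
  by apply: finite_image; exact: finite_finset.
move=> C [[m e h f] /labeled_ktree_order /= mE ->]; subst m.
exists ([set p | e p.1 p.2]%SET, [ffun u => h u], [ffun v => f v]) => //.
congr (iso_class (LGraph _ _ _)) => /=.
- by apply/funext => x; apply/funext => y; rewrite inE.
- by apply/funext => x; rewrite ffunE.
- by apply/funext => x; rewrite ffunE.
Qed.

Fact ktree_tr_str k (U V U' V' : finType) (f : U -> U') (g : V -> V') C :
  bijective f -> bijective g -> ktree_str k C -> ktree_str k (ktree_tr f g C).
Proof.
move=> [f' fK f'K] [g' gK g'K] [t tk ->].
exists (relabel f' g' t).
  case: tk => tk [h1 h2 h3] [f1 f2 f3]; split => //; split => /=.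
  - by move=> u _; apply: h1.
  - by move=> x y _ _ /h2 xy; apply: (can_inj f'K); apply: xy; rewrite in_setT.
  - by move=> A /h3[u _ <-]; exists (f u) => //=; rewrite fK.
  - by move=> v _; apply: f1.
  - by move=> x y _ _ /f2 xy; apply: (can_inj g'K); apply: xy; rewrite in_setT.
  - by move=> A /f3[u _ <-]; exists (g u) => //=; rewrite gK.
apply/seteqP; split => t' [phi [/= b1 b2 b3 b4]]; exists phi; split => //=.
- by move=> u; rewrite -b3 /= f'K.
- by move=> u; rewrite -b4 /= g'K.
- by move=> u; rewrite b3 /= fK.
- by move=> u; rewrite b4 /= gK.
Qed.

Definition ktree_species (k : nat) : species2.
Proof.
refine (@Species2 (fun U V => set (lgraph U V)) (@ktree_str k) ktree_tr
  (@ktree_str_finite k) (@ktree_tr_str k) _ _).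
- by move=> U V s _; apply/seteqP; split => -[].
- by [].
Defined.

Section Recursion.
Variable k : nat.

(* {1, ..., k+1} is identified with ['I_k.+1] modulo k+1, so that k+1 is
   [ord0], and {1, ..., k} with ['I_k] through [lift ord0 : a |-> a.+1]. *)

Definition Delta (s : 'S_k) : 'S_k.+1 := lift_perm ord0 ord0 s.

(* Meaningful for [t] fixing [ord0]. *)
Definition Delta_inv (t : 'S_k.+1) : 'S_k :=
  odflt 1%g [pick s | Delta s == t].

Lemma DeltaK : cancel Delta Delta_inv.
Proof.
move=> s; rewrite /Delta_inv; case: pickP => [s' /eqP|/(_ s)/eqP] //=.
move/permP => E; apply/permP => i; apply: (@lift_inj _ ord0).
by move: (E (lift ord0 i)); rewrite !lift_perm_lift.
Qed.

(* Sums and differences are those of the additive group ['I_k.+1]. *)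
Definition rho_fun (s : 'S_k.+1) (i a : 'I_k.+1) : 'I_k.+1 :=
  s (i + a) - s i.

Fact rho_inj s i : injective (rho_fun s i).
Proof. by move=> a b /addIr /perm_inj /addrI. Qed.

Definition rho (s : 'S_k.+1) (i : 'I_k.+1) : 'S_k.+1 := perm (@rho_inj s i).

Lemma Delta_inv_rhoK (s : 'S_k.+1) (r : seq 'I_k.+1) :
  Delta (Delta_inv (\prod_(i <- r) rho s i)) = (\prod_(i <- r) rho s i)%g.
Proof.
set t := (\prod_(i <- r) _)%g.
have t0 : t ord0 = ord0.
  rewrite /t; elim: r {t} => [|i r IH]; first by rewrite big_nil perm1.
  rewrite big_cons permM permE /rho_fun.
  by rewrite [i + _]addr0 [s i - s i]subrr; exact: IH.
have [u uE] : exists u, Delta u = t.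
  have tl a : unlift ord0 (t (lift ord0 a)).
    case: unliftP => // /eqP; rewrite -{2}t0 (inj_eq perm_inj).
    by rewrite eq_sym (negbTE (neq_lift _ _)).
  pose h a := odflt a (unlift ord0 (t (lift ord0 a))).
  have hE a : lift ord0 (h a) = t (lift ord0 a).
    by rewrite /h; have := tl a; case: unliftP => [j ->|].
  have hI : injective h.
    by move=> a b /(congr1 (lift ord0)); rewrite !hE => /perm_inj /lift_inj.
  exists (perm hI); apply/permP => a; case: (unliftP ord0 a) => [j|] ->.
    by rewrite lift_perm_lift permE hE.
  by rewrite lift_perm_id t0.
by rewrite -uE DeltaK.
Qed.

End Recursion.

Section System.
Variable k : nat.

(* A choice, for each permutation, of a starting point in each cycle. *)
Definition cycle_start (n : nat) (st : 'S_n -> {set 'I_n} -> 'I_n) : Prop :=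
  forall (s : 'S_n) (c : {set 'I_n}), c \in porbits s -> st s c \in c.

(* The cycle of [s] through [i], written from [i] on. *)
Definition cycle_seq (n : nat) (s : 'S_n) (i : 'I_n) : seq 'I_n :=
  traject s i #|porbit s i|.

Variable start : 'S_k -> {set 'I_k} -> 'I_k.
Variable start1 : 'S_k.+1 -> {set 'I_k.+1} -> 'I_k.+1.
Variable ZY : 'S_k -> series.

(* Products of permutations apply the leftmost factor first, so those below
   are the compositions rho_(c_m) o ... o rho_(c_1). *)

Definition fY (s : 'S_k) : series :=
  px 1 * \prod_(c in porbits s)
    dil #|c| (ZY (Delta_inv
      (\prod_(i <- cycle_seq s (start s c)) rho (Delta s) (lift ord0 i))%g)).

Definition ZY_rhs (s : 'S_k) : series :=
  py 1 * sexp (ssum [set n | (0 < n)%N]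
    (fun n => (n%:R : rat)^-1 *: dil n (fY (s ^+ n)%g))).

Definition ZY_system : Prop := forall s : 'S_k, ZY s = ZY_rhs s.

Definition ZXY (s : 'S_k.+1) : series :=
  px 1 * \prod_(c in porbits s)
    dil #|c| (ZY (Delta_inv
      (\prod_(i <- cycle_seq s (start1 s c)) rho s i)%g)).

End System.

Section WellPosed.

Definition eqd (d : nat) (f g : series) : Prop :=
  forall u : monomial, (size (enum_mset u) < d)%N -> f u = g u.

Lemma size_mon_mul (u v : monomial) :
  size (enum_mset (mon_mul u v)) = (size (enum_mset u) + size (enum_mset v))%N.
Proof.
rewrite -size_cat; apply: perm_size; apply/allP => a _ /=.
by rewrite count_cat !count_mem_mset /mon_mul msetE2.
Qed.

Lemma eqd_mul d f g f' g' : eqd d f f' -> eqd d g g' -> eqd d (f * g) (f' * g').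
Proof.
move=> ff' gg' u ud; apply: eq_big_seq => -[v w].
rewrite mem_splits /= => /eqP uE; move: ud; rewrite -uE size_mon_mul => ud.
by rewrite ff' ?gg' // (leq_ltn_trans _ ud) ?leq_addl ?leq_addr.
Qed.

Lemma eqd_smon d a f g : eqd d f g ->
  eqd d.+1 (smon (msetn 1 a) * f) (smon (msetn 1 a) * g).
Proof.
move=> fg u ud; apply: eq_big_seq => -[v w].
rewrite mem_splits /= /smon => /eqP uE.
case: eqP => [va|_]; last by rewrite !mul0r.
rewrite fg //; move: ud; rewrite -uE size_mon_mul va.
by rewrite enum_msetn /= ltnS.
Qed.

Lemma eqd_prod d (I : Type) (r : seq I) (P : pred I) (F G : I -> series) :
  (forall i, eqd d (F i) (G i)) ->
  eqd d (\prod_(i <- r | P i) F i) (\prod_(i <- r | P i) G i).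
Proof. by move=> FG; elim/big_ind2: _ => // *; exact: eqd_mul. Qed.

Lemma eqd_scale d (a : rat) f g : eqd d f g -> eqd d (a *: f) (a *: g).
Proof. by move=> fg u /fg E; congr (_ * _). Qed.

Lemma eqd_ssum d (I : choiceType) (A : set I) (F G : I -> series) :
  (forall i, eqd d (F i) (G i)) -> eqd d (ssum A F) (ssum A G).
Proof. by move=> FG u ud; apply: eq_fsbigr => i _; exact: FG. Qed.

Lemma eqd_sexp d f g : eqd d f g -> eqd d (sexp f) (sexp g).
Proof.
move=> fg; apply: eqd_ssum => n; apply: eqd_scale.
by elim: n => [|n IH] //; rewrite !exprS; exact: eqd_mul.
Qed.

Lemma size_dil_mon m u : size (enum_mset (dil_mon m u)) = size (enum_mset u).
Proof. by rewrite (perm_size (perm_eq_seq_mset _)) size_map. Qed.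

Lemma eqd_dil d m f g : eqd d f g -> eqd d (dil m f) (dil m g).
Proof.
move=> fg u ud; apply: eq_fsbigr => v; rewrite inE /= => vu.
by apply: fg; rewrite -(size_dil_mon m) vu.
Qed.

Variables (k : nat) (start : 'S_k -> {set 'I_k} -> 'I_k).

Lemma eqd_ZY_rhs d (Z Z' : 'S_k -> series) : (forall s, eqd d (Z s) (Z' s)) ->
  forall s, eqd d.+1 (ZY_rhs start Z s) (ZY_rhs start Z' s).
Proof.
move=> ZZ' s; apply: eqd_smon; apply: eqd_sexp; apply: eqd_ssum => n.
apply: eqd_scale; apply: eqd_dil; apply: eqd_mul => //.
by apply: eqd_prod => c; apply: eqd_dil.
Qed.

Lemma ZY_system_unique : exists! Z : 'S_k -> series, ZY_system start Z.
Proof.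
have eqdP (Z Z' : 'S_k -> series) :
    (forall d s, eqd d (Z s) (Z' s)) -> Z = Z'.
  by move=> ZZ'; apply/funext => s; apply/funext => u; exact: (ZZ' _ s u (leqnn _)).
pose it n := iter n (ZY_rhs start) (fun=> 0).
have itS n : forall s, eqd n (it n s) (it n.+1 s).
  by elim: n => [|n IH] s; [case | exact: eqd_ZY_rhs].
have itD n m : forall s, eqd n (it n s) (it (m + n)%N s).
  elim: m => [|m IH] s u un //.
  by rewrite IH // itS // (leq_trans un) // leq_addl.
pose Z s : series := fun u => it (size (enum_mset u)).+1 s u.
have ZE n s : eqd n (Z s) (it n s).
  move=> u un; have := itD _ (n - (size (enum_mset u)).+1)%N s u (leqnn _).
  by rewrite subnK.
exists Z; split=> [s|Z' Z'E].
  apply/funext => u; apply/esym.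
  exact: (eqd_ZY_rhs (ZE (size (enum_mset u))) s (leqnn _)).
apply: eqdP; elim=> [|d IH] s; first by case.
by move=> u ud; rewrite Z'E -(eqd_ZY_rhs IH s ud) (eqd_ZY_rhs (ZE d) s ud) (ZE d.+1).
Qed.

End WellPosed.

(* Main.v *)
(** By Burnside's lemma, the coefficient of the cycle index at a monomial of x-degree m
    is 1/N!, with N = m + k, times the weighted number of pairs (g, phi), g being a k-tree
    on N vertices and phi an automorphism of g, where the weight records the cycles of phi
    on hedra and on fronts. For every such pair

      sum over fixed hedra A of (1 - #(fixed vertices of A)) + #(fixed fronts) = 1,

    because phi fixes some hedron or front, from which g is grown vertex by vertex. Pairs are
    thus replaced, with signs, by pairs rooted at a fixed hedron or front.

    A rooted k-tree has a unique proper colouring by k+1 colours extending a colouring of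
    its root, and amounts to a forest on the other vertices: a vertex v hangs below the
    vertex creating the hedron to which v is attached, and its colour is that of the vertex
    of this hedron which v replaces; it differs from the colour of the parent. The
    automorphism phi permutes the colours by some sigma and acts on the forest. Marking a
    vertex of the forest shows that the generating series of these forests are exponentials.
    Since the product of the rho_i over a cycle c is sigma^|c| conjugated by a translation
    of the colours, p_1[y] times the series of the forests rooted at a front solves the
    system defining Z_Y, and the forests rooted at a hedron give Z_XY. Finally, Z_XY is a
    class function, so the sum of #Fix(sigma) Z_XY(sigma) over S_(k+1) is k+1 times the sum
    of Z_XY over the permutations Delta s. *)

Require Import Defs.
From mathcomp Require Import all_boot all_order all_algebra all_fingroup.
From mathcomp Require Import finmap multiset.
From mathcomp Require Import boolp.
From mathcomp Require classical_sets functions cardinality fsbigop.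
From mathcomp Require Import zify.

Set Implicit Arguments.
Unset Strict Implicit.
Unset Printing Implicit Defensive.

Import GRing.Theory Num.Theory.

Local Open Scope ring_scope.

(** * Series *)

(** The signed identity says that a finite tree has one more node than edges. The tree has the hedra
    and the fronts as nodes and their inclusions as edges; [phi] fixes a subtree of it, and the
    fixed edges at a fixed hedron correspond to its fixed vertices, each opposite to a fixed front.
    The identity is verified on the forest: every fixed vertex of the forest contributes two
    opposite amounts, and only the root is left.

    The labels sit on hedra and fronts, whereas isomorphisms move vertices. As a k-tree with [m]
    hedra has exactly [m + k] vertices, the structures of a given size are the orbits of a single
    symmetric group, and all later sums range over graphs on a fixed vertex set.

    The colours let an automorphism act on all hedra through one permutation [sigma]. Without them
    the fronts of neighbouring hedra would have to be matched coherently, which is the role of the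
    maps [rho] in the recursion. *)

Definition wsum (w : pvar -> nat) (u : monomial) : nat :=
  (\sum_(v <- enum_mset u) w v)%N.

(* [p_j[x]] has [x]-degree [j]. *)
Definition xvar (v : pvar) : nat := if v is inl i then i.+1 else 0%N.
Definition yvar (v : pvar) : nat := if v is inr i then i.+1 else 0%N.
Notation xw := (wsum xvar).
Notation yw := (wsum yvar).

Section SeriesTheory.
Import classical_sets functions cardinality fsbigop.

Lemma perm_mon_mul (a b : monomial) :
  perm_eq (enum_mset (mon_mul a b)) (enum_mset a ++ enum_mset b).
Proof.
by apply/allP => x _ /=; rewrite count_cat !count_mem_mset /mon_mul msetE2.
Qed.

Lemma perm_dil_mon n u : perm_eq (enum_mset (dil_mon n u)) (map (dil_var n) (enum_mset u)).
Proof. exact: perm_eq_seq_mset. Qed.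

Lemma mset_perm (a b : monomial) : perm_eq (enum_mset a) (enum_mset b) -> a = b.
Proof.
move=> /seq.permP ab; apply/msetP => x.
by have := ab (pred1 x); rewrite !count_mem_mset.
Qed.

Lemma wsum_mul w a b : wsum w (mon_mul a b) = (wsum w a + wsum w b)%N.
Proof. by rewrite /wsum (perm_big _ (perm_mon_mul a b)) big_cat. Qed.

Lemma wsum0 w : wsum w mset0 = 0%N.
Proof. by rewrite /wsum enum_mset0 big_nil. Qed.

Lemma wsum1 w a : wsum w (msetn 1 a) = w a.
Proof. by rewrite /wsum enum_msetn big_seq1. Qed.

Lemma wsum_splits w u p : p \in splits u -> (wsum w p.1 + wsum w p.2 = wsum w u)%N.
Proof. by rewrite mem_splits => /eqP <-; rewrite wsum_mul. Qed.

Lemma xw_dil n u : (0 < n)%N -> xw (dil_mon n u) = (n * xw u)%N.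
Proof.
move=> n0; rewrite /wsum (perm_big _ (perm_dil_mon n u)) big_map big_distrr /=.
by apply: eq_bigr => -[i|i] _ /=; rewrite ?muln0 // prednK // muln_gt0 n0.
Qed.

Definition homog (w : pvar -> nat) (s : nat) (f : series) : Prop :=
  forall u, wsum w u != s -> f u = 0.

Lemma mulE (f g : series) u :
  (f * g) u = \sum_(p <- splits u) (f p.1 : rat) * (g p.2 : rat) :> rat.
Proof. by []. Qed.

Lemma sumE (I : Type) (r : seq I) (P : pred I) (F : I -> series) u :
  (\sum_(i <- r | P i) F i) u = \sum_(i <- r | P i) (F i u : rat) :> rat.
Proof. exact: (big_morph (fun f : series => f u : rat)). Qed.

Lemma scaleE (a : rat) (f : series) u : (a *: f) u = a * (f u : rat) :> rat.
Proof. by []. Qed.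

Lemma addE (f g : series) u : (f + g) u = (f u : rat) + (g u : rat) :> rat.
Proof. by []. Qed.

Lemma oppE (f : series) u : (- f) u = - (f u : rat) :> rat.
Proof. by []. Qed.

Lemma scale_mulr (a : rat) (f g : series) : f * (a *: g) = a *: (f * g).
Proof. by rewrite mulrC -scalerAl mulrC. Qed.

Lemma oneE u : (1 : series) u = (u == mset0)%:R :> rat.
Proof. by []. Qed.

Lemma homog_mul w s t f g : homog w s f -> homog w t g -> homog w (s + t)%N (f * g).
Proof.
move=> hf hg u us; rewrite mulE big_seq_cond big1 // => p /andP[pu _].
have [ps|/hf ->] := eqVneq (wsum w p.1) s; last by rewrite mul0r.
rewrite hg ?mulr0 //; apply: contra us => /eqP pt.
by rewrite -(wsum_splits w pu) ps pt.
Qed.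

Lemma homog1 w : homog w 0 1.
Proof. by move=> u; rewrite oneE; case: (u =P mset0) => // ->; rewrite wsum0. Qed.

Lemma homog_prod w (I : Type) (r : seq I) (P : pred I) (d : I -> nat) (F : I -> series) :
  (forall i, P i -> homog w (d i) (F i)) ->
  homog w (\sum_(i <- r | P i) d i)%N (\prod_(i <- r | P i) F i).
Proof.
move=> hF; elim/big_ind2 : _ => //; first exact: homog1.
by move=> *; apply: homog_mul.
Qed.

Lemma homog_sum w s (I : Type) (r : seq I) (P : pred I) (F : I -> series) :
  (forall i, P i -> homog w s (F i)) -> homog w s (\sum_(i <- r | P i) F i).
Proof. by move=> hF u us; rewrite sumE big1 // => i Pi; rewrite hF. Qed.

Lemma homog_scale w s a f : homog w s f -> homog w s (a *: f).
Proof. by move=> hf u us; rewrite scaleE hf ?mulr0. Qed.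

Lemma homog_var w a : homog w (w a) (smon (msetn 1 a)).
Proof. by move=> u; rewrite /smon; case: (u =P _) => // ->; rewrite wsum1 eqxx. Qed.

Lemma homog_px j : (0 < j)%N -> homog xvar j (px j).
Proof. by case: j => // j _; exact: (@homog_var xvar (inl j)). Qed.

Lemma homog_py j : homog xvar 0 (py j).
Proof. exact: (@homog_var xvar (inr j.-1)). Qed.

Lemma homogy_px j : homog yvar 0 (px j).
Proof. exact: (@homog_var yvar (inl j.-1)). Qed.

Lemma homogy_py j : (0 < j)%N -> homog yvar j (py j).
Proof. by case: j => // j _; exact: (@homog_var yvar (inr j)). Qed.

(* The sum of the [W s], when each [W s] is homogeneous of [x]-degree [s]. *)
Definition gsum (W : nat -> series) : series := fun u => W (xw u) u.

(** In a splitting of [u] that contributes, the first part has degree [s], hence the second has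
    degree [xw u - s]: a single homogeneous part of [gsum W] is seen. *)
Lemma gsum_homogM s f W u : homog xvar s f -> (forall s, homog xvar s (W s)) ->
  (f * gsum W) u = if (s <= xw u)%N then (f * W (xw u - s)%N) u else 0.
Proof.
move=> hf hW; rewrite !mulE; case: ifP => su.
  apply: eq_big_seq => p pu.
  have [ps|/hf ->] := eqVneq (wsum xvar p.1) s; last by rewrite !mul0r.
  by rewrite /gsum -(wsum_splits xvar pu) ps addKn.
rewrite big_seq_cond big1 // => p /andP[pu _].
rewrite hf ?mul0r //; apply: contraFneq su => <-.
by rewrite -(wsum_splits xvar pu) leq_addr.
Qed.

Lemma dil_var_inj n : (0 < n)%N -> injective (dil_var n).
Proof.
by move=> n0 [i|i] [j|j] //= [] ij; congr (_ _); nia.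
Qed.

Lemma dil_mon_inj n : (0 < n)%N -> injective (dil_mon n).
Proof.
move=> n0 u v uv; apply: mset_perm.
apply: (@perm_map_inj _ _ (dil_var n)); first exact: dil_var_inj.
by rewrite -(permPl (perm_dil_mon n u)) uv perm_dil_mon.
Qed.

Lemma dil_mon_mul n a b : dil_mon n (mon_mul a b) = mon_mul (dil_mon n a) (dil_mon n b).
Proof.
apply: mset_perm; rewrite (permPl (perm_dil_mon _ _)) (permPr (perm_mon_mul _ _)).
rewrite (permPl (perm_map (dil_var n) (perm_mon_mul a b))) map_cat.
by apply: perm_cat; rewrite perm_sym; exact: perm_dil_mon.
Qed.

Lemma dilE n f v : (0 < n)%N -> dil n f (dil_mon n v) = f v.
Proof.
move=> n0; rewrite /dil.
have -> : [set w | dil_mon n w = dil_mon n v]%classic = [set v]%classic.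
  by apply/seteqP; split=> w /= => [/(dil_mon_inj n0)//|->].
by rewrite fsbig_set1.
Qed.

Lemma dil_out n f u : (forall v, dil_mon n v <> u) -> dil n f u = 0.
Proof.
move=> nu; rewrite /dil.
have -> : [set w | dil_mon n w = u]%classic = set0.
  by apply/seteqP; split=> w //= /nu.
by rewrite fsbig_set0.
Qed.

Lemma dil_case n u : (exists v, u = dil_mon n v) \/ (forall v, dil_mon n v <> u).
Proof.
have [[v vu]|nv] := pselect (exists v, u = dil_mon n v); first by left; exists v.
by right=> v vu; apply: nv; exists v.
Qed.

(** Identities between dilations are proved in two cases: on the image of [dil_mon n], where [dilE]
    computes, and off it, where dilated series vanish. *)
Lemma dil_ext n (f g : series) : (forall v, f (dil_mon n v) = g (dil_mon n v)) ->
  (forall u, (forall v, dil_mon n v <> u) -> f u = g u) -> f = g.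
Proof.
by move=> h1 h2; apply/funext => u; have [[v ->]|/h2] := dil_case n u.
Qed.

Definition dil_pair n (p : monomial * monomial) : bool :=
  `[< (exists a, p.1 = dil_mon n a) /\ (exists b, p.2 = dil_mon n b) >].

(** [dil_mon n] is injective and multiplicative, so the splittings into two dilated parts come from
    the splittings of [v]. The other splittings do not matter for a product of dilated series, one
    factor being zero. *)
Lemma splits_dil n v : (0 < n)%N ->
  perm_eq [seq p <- splits (dil_mon n v) | dil_pair n p]
    [seq (dil_mon n p.1, dil_mon n p.2) | p <- splits v].
Proof.
move=> n0; apply: uniq_perm.
- by rewrite filter_uniq // undup_uniq.
- rewrite map_inj_in_uniq ?undup_uniq // => -[a b] [a' b'] _ _ [].
  by move=> /(dil_mon_inj n0) -> /(dil_mon_inj n0) ->.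
move=> [a b]; rewrite mem_filter mem_splits /=; apply/andP/mapP.
  case=> /asboolP /= [[a' ->] [b' ->]]; rewrite -dil_mon_mul => /eqP/(dil_mon_inj n0) <-.
  by exists (a', b') => //; rewrite mem_splits.
move=> [[a' b']]; rewrite mem_splits /= => /eqP <- [-> ->]; split.
  by apply/asboolP; split; eexists.
by rewrite dil_mon_mul.
Qed.

Lemma dil_mul n f g : (0 < n)%N -> dil n (f * g) = dil n f * dil n g.
Proof.
move=> n0; apply: (@dil_ext n) => [v|u nu]; rewrite mulE.
  rewrite dilE // mulE [RHS](bigID (dil_pair n)) /= [X in _ = _ + X]big1 ?addr0.
    rewrite -[RHS]big_filter (perm_big _ (splits_dil v n0)) big_map.
    by apply: eq_bigr => p _; rewrite !dilE.
  move=> p /asboolPn np.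
  have [[a pa]|na] := dil_case n p.1; last by rewrite dil_out ?mul0r.
  have [[b pb]|nb] := dil_case n p.2; last by rewrite mulrC dil_out ?mul0r.
  by case: np; split; eexists; eassumption.
rewrite dil_out // big_seq_cond big1 // => p /andP[pu _].
have [[a pa]|na] := dil_case n p.1; last by rewrite dil_out ?mul0r.
have [[b pb]|nb] := dil_case n p.2; last by rewrite mulrC dil_out ?mul0r.
case: (nu (mon_mul a b)); rewrite dil_mon_mul -pa -pb.
by apply/eqP; rewrite -mem_splits.
Qed.

Lemma dil_smon n u : (0 < n)%N -> dil n (smon u) = smon (dil_mon n u).
Proof.
move=> n0; apply: (@dil_ext n) => [v|w nw].
  by rewrite dilE // /smon (inj_eq (dil_mon_inj n0)).
by rewrite dil_out // /smon; case: eqP => // wu; case: (nw u).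
Qed.

Lemma dil_mon0 n : dil_mon n mset0 = mset0.
Proof.
by apply: mset_perm; rewrite (permPl (perm_dil_mon n _)) enum_mset0.
Qed.

Lemma dil_mon1 n a : dil_mon n (msetn 1 a) = msetn 1 (dil_var n a).
Proof.
by apply: mset_perm; rewrite (permPl (perm_dil_mon n _)) !enum_msetn.
Qed.

Lemma one_smon : (1 : series) = smon mset0.
Proof. by apply/funext => u; rewrite oneE. Qed.

Lemma dil1 n : (0 < n)%N -> dil n 1 = 1.
Proof. by move=> n0; rewrite one_smon dil_smon ?dil_mon0. Qed.

Lemma dil_px n j : (0 < n)%N -> (0 < j)%N -> dil n (px j) = px (n * j).
Proof. by move=> n0 j0; rewrite /px (dil_smon _ n0) dil_mon1 /= (prednK j0). Qed.

Lemma dil_py n j : (0 < n)%N -> (0 < j)%N -> dil n (py j) = py (n * j).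
Proof. by move=> n0 j0; rewrite /py (dil_smon _ n0) dil_mon1 /= (prednK j0). Qed.

Lemma dil_prod n (I : Type) (r : seq I) (P : pred I) (F : I -> series) : (0 < n)%N ->
  dil n (\prod_(i <- r | P i) F i) = \prod_(i <- r | P i) dil n (F i).
Proof. by move=> n0; exact: (big_morph (dil n) (fun f g => dil_mul f g n0) (dil1 n0)). Qed.

Lemma dil_add n f g : (0 < n)%N -> dil n (f + g) = dil n f + dil n g.
Proof.
move=> n0; apply: (@dil_ext n) => [v|w nw]; first by rewrite addE !dilE.
by rewrite addE !dil_out ?addr0.
Qed.

Lemma dil_scale n a f : (0 < n)%N -> dil n (a *: f) = a *: dil n f.
Proof.
move=> n0; apply: (@dil_ext n) => [v|w nw]; first by rewrite scaleE !dilE.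
by rewrite scaleE !dil_out ?mulr0.
Qed.

Lemma dil0 n : (0 < n)%N -> dil n 0 = 0.
Proof. by move=> n0; rewrite -[0 in LHS](scale0r (0 : series)) dil_scale // scale0r. Qed.

Lemma dil_sum n (I : Type) (r : seq I) (P : pred I) (F : I -> series) : (0 < n)%N ->
  dil n (\sum_(i <- r | P i) F i) = \sum_(i <- r | P i) dil n (F i).
Proof. by move=> n0; exact: (big_morph (dil n) (fun f g => dil_add f g n0) (dil0 n0)). Qed.

Lemma dil_var_mul m n v : (0 < m)%N -> (0 < n)%N ->
  dil_var m (dil_var n v) = dil_var (m * n) v.
Proof. by move=> m0 n0; case: v => i /=; congr (_ _); nia. Qed.

Lemma dil_mon_dil m n u : (0 < m)%N -> (0 < n)%N ->
  dil_mon m (dil_mon n u) = dil_mon (m * n) u.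
Proof.
move=> m0 n0; apply: mset_perm; rewrite (permPl (perm_dil_mon _ _)).
rewrite (permPl (perm_map _ (perm_dil_mon _ _))) (permPr (perm_dil_mon _ _)).
by rewrite -map_comp (eq_map (fun v => dil_var_mul v m0 n0)).
Qed.

Lemma dil_dil m n f : (0 < m)%N -> (0 < n)%N -> dil m (dil n f) = dil (m * n) f.
Proof.
move=> m0 n0; apply: (@dil_ext m) => [v|u nu].
  rewrite dilE //; have [[w ->]|nv] := dil_case n v.
    by rewrite dilE // dil_mon_dil // dilE // muln_gt0 m0.
  rewrite !dil_out // => w; rewrite -dil_mon_dil // => /(dil_mon_inj m0); exact: nv.
rewrite !dil_out // => w; rewrite -dil_mon_dil //; exact: nu.
Qed.

Lemma homog_dil n s f : (0 < n)%N -> homog xvar s f -> homog xvar (n * s) (dil n f).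
Proof.
move=> n0 hf u; have [[v ->]|nu] := dil_case n u; last by rewrite dil_out.
by rewrite dilE // xw_dil // eqn_pmul2l // => /hf.
Qed.

(* The Euler derivation: a series is determined by its part of [x]-degree [0] and by
   its logarithmic Euler derivative, which is how exponentials are recognised. *)
Definition xD (f : series) : series := fun u => (xw u)%:R * (f u : rat).

Lemma xD_mul f g : xD (f * g) = xD f * g + f * xD g.
Proof.
apply/funext => u; rewrite addE /xD !mulE mulr_sumr -big_split /=.
apply: eq_big_seq => p pu; rewrite -(wsum_splits xvar pu) natrD.
by rewrite mulrDl !mulrA [f _ * _]mulrC -!mulrA.
Qed.

Lemma xD_add f g : xD (f + g) = xD f + xD g.
Proof. by apply/funext => u; rewrite addE /xD addE mulrDr. Qed.

Lemma xD_scale a f : xD (a *: f) = a *: xD f.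
Proof. by apply/funext => u; rewrite scaleE /xD scaleE mulrCA. Qed.

Lemma xD1 : xD 1 = 0.
Proof.
apply/funext => u; rewrite /xD oneE; case: eqP => [->|]; last by rewrite mulr0.
by rewrite wsum0 mul0r.
Qed.

Lemma xD0 : xD 0 = 0.
Proof. by apply/funext => u; rewrite /xD mulr0. Qed.

Lemma xD_sum (I : Type) (r : seq I) (P : pred I) (F : I -> series) :
  xD (\sum_(i <- r | P i) F i) = \sum_(i <- r | P i) xD (F i).
Proof. exact: (big_morph xD xD_add xD0). Qed.

Lemma xD_exp g n : xD (g ^+ n) = n%:R *: (g ^+ n.-1 * xD g).
Proof.
elim: n => [|n IH]; first by rewrite expr0 xD1 scale0r.
rewrite exprS xD_mul IH /= scale_mulr mulrA -exprS mulrC.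
case: n {IH} => [|n]; first by rewrite scale0r addr0 scale1r.
by rewrite /= -[n.+2]add1n natrD scalerDl scale1r.
Qed.

Lemma xD_dil n f : (0 < n)%N -> xD (dil n f) = n%:R *: dil n (xD f).
Proof.
move=> n0; apply: (@dil_ext n) => [v|u nu]; rewrite /xD scaleE.
  by rewrite !dilE // xw_dil // natrM mulrA.
by rewrite !dil_out ?mulr0.
Qed.

(** The order in the [x]-variables. The exponents below carry a factor [p_1[x]], so this filtration
    alone makes the exponentials and infinite sums locally finite, with no condition on the
    [y]-variables. *)
Definition xlow (d : nat) (f : series) : Prop := forall u, (xw u < d)%N -> f u = 0.

Lemma xlow_mul d e f g : xlow d f -> xlow e g -> xlow (d + e) (f * g).
Proof.
move=> hf hg u ud; rewrite mulE big_seq_cond big1 // => p /andP[pu _].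
move: ud; rewrite -(wsum_splits xvar pu) => ud.
have [pd|/hf ->] := leqP d (xw p.1); last by rewrite mul0r.
by rewrite hg ?mulr0 //; rewrite -(ltn_add2l d) (leq_ltn_trans _ ud) // leq_add2r.
Qed.

Lemma xlow_exp g n : xlow 1 g -> xlow n (g ^+ n).
Proof.
move=> hg; elim: n => [//|n IH]; rewrite exprS -add1n; exact: xlow_mul.
Qed.

Lemma xlow_homog s f : homog xvar s f -> xlow s f.
Proof. by move=> hf u us; apply: hf; rewrite neq_ltn us. Qed.

Lemma xlowW d e f : (d <= e)%N -> xlow e f -> xlow d f.
Proof. by move=> de hf u ud; apply: hf; exact: leq_trans de. Qed.

Lemma xlow_dil n f : (0 < n)%N -> xlow 1 f -> xlow n (dil n f).
Proof.
move=> n0 hf u; have [[v ->]|nu] := dil_case n u; last by rewrite dil_out.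
rewrite xw_dil // dilE //; case: (posnP (xw v)) => [v0 _|v0].
  by apply: hf; rewrite v0.
by rewrite ltnNge leq_pmulr.
Qed.

Lemma xlow_scale d a f : xlow d f -> xlow d (a *: f).
Proof. by move=> hf u ud; rewrite scaleE hf ?mulr0. Qed.

Lemma xlow_sum d (I : Type) (r : seq I) (P : pred I) (F : I -> series) :
  (forall i, P i -> xlow d (F i)) -> xlow d (\sum_(i <- r | P i) F i).
Proof. by move=> hF u us; rewrite sumE big1 // => i Pi; rewrite hF. Qed.

(** The term of index [n] has [x]-order at least [n], so at [u] the formal sum may be cut at any [N]
    above the [x]-degree. *)
Lemma ssumE (P : pred nat) (F : nat -> series) N u : (xw u < N)%N ->
  (forall n, P n -> xlow n (F n)) ->
  ssum [set n | P n]%classic F u = \sum_(n < N | P n) F n u.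
Proof.
move=> uN hF; rewrite /ssum -(big_mkord P (fun n => F n u)) -big_filter.
rewrite -(fsbig_widen [set n | P n && (n < N)%N]%classic).
- apply: fsbig_fwiden => /=.
  + by move=> n /= /andP[Pn nN]; rewrite mem_filter Pn mem_index_iota.
  + by rewrite filter_uniq // iota_uniq.
  + by move=> n /= []; rewrite mem_filter mem_index_iota => ->.
- by move=> n /= /andP[].
move=> n /= [Pn /negP]; rewrite Pn /= -leqNgt => Nn.
by apply: hF => //; exact: leq_trans Nn.
Qed.

Lemma sexpE g N u : xlow 1 g -> (xw u < N)%N ->
  sexp g u = (\sum_(n < N) (n`!%:R : rat)^-1 *: g ^+ n) u.
Proof.
move=> hg uN; have hF n : predT n -> xlow n ((n`!%:R : rat)^-1 *: g ^+ n).
  by move=> _; apply: xlow_scale; exact: xlow_exp.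
rewrite sumE -(ssumE uN hF) /sexp; congr (ssum _ _ u).
by apply/seteqP; split.
Qed.

Lemma sexp_xw0 g u : xlow 1 g -> xw u = 0%N -> sexp g u = (1 : series) u.
Proof.
move=> hg u0; rewrite (@sexpE _ 1) ?u0 // big_ord1.
by rewrite fact0 invr1 scale1r expr0.
Qed.

Lemma mul_cong (f f' g g' : series) u :
  (forall v, (xw v <= xw u)%N -> f v = f' v) ->
  (forall v, (xw v <= xw u)%N -> g v = g' v) -> (f * g) u = (f' * g') u.
Proof.
move=> ff' gg'; rewrite !mulE; apply: eq_big_seq => p pu.
by rewrite ff' ?gg' // -(wsum_splits xvar pu) ?leq_addl ?leq_addr.
Qed.

Lemma xD_sexp g : xlow 1 g -> xD (sexp g) = sexp g * xD g.
Proof.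
move=> hg; apply/funext => u; set N := (xw u).+1.
pose S n := \sum_(i < n) (i`!%:R : rat)^-1 *: g ^+ i.
have SE n v : (xw v < n)%N -> sexp g v = S n v by exact: sexpE.
(* One more term is kept on the left, because the derivation turns the term of index [n.+1] into the
   term of index [n] times [xD g]. *)
rewrite {1}/xD (SE N.+1) ?(leqW (leqnn N)) //.
rewrite (@mul_cong _ (S N) _ (xD g)) // => [|v]; last by rewrite -ltnS; exact: SE.
rewrite -[LHS]/(xD (S N.+1) u) /S xD_sum big_ord_recl expr0 xD_scale xD1 scaler0 add0r.
rewrite mulr_suml; congr ((_ : series) u); apply: eq_bigr => i _.
rewrite xD_scale xD_exp scalerA -scalerAl /= /bump add1n; congr (_ *: _).
rewrite factS natrM invfM mulrAC mulVf ?mul1r //.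
by rewrite pnatr_eq0.
Qed.

(** At [u] the equation expresses [xw u] times the coefficient through coefficients of smaller
    [x]-degree, since [h] has no part of [x]-degree [0]; the part of degree [0] thus determines the
    rest. *)
Lemma xD_uniq (f f' h : series) : xlow 1 h ->
  (forall u, xw u = 0%N -> f u = f' u) ->
  xD f = f * h -> xD f' = f' * h -> f = f'.
Proof.
move=> hh f0 fD fD'; apply/funext => u; have [n un] := ubnP (xw u).
elim: n u un => // n IH u un.
have [/f0 //|u0] := posnP (xw u).
have xu : (xw u)%:R != 0 :> rat by rewrite pnatr_eq0 -lt0n.
apply: (mulfI xu); rewrite -[LHS]/(xD f u) -[RHS]/(xD f' u) fD fD' !mulE.
apply: eq_big_seq => p pu; have [p2|p2] := posnP (xw p.2).
  by rewrite hh ?p2 // !mulr0.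
rewrite IH //; apply: leq_trans (_ : (xw p.1).+1 <= xw u)%N _; last by rewrite -ltnS.
by rewrite -(wsum_splits xvar pu) -addn1 leq_add2l.
Qed.

Lemma xlow_xD d f : xlow d f -> xlow d (xD f).
Proof. by move=> hf u ud; rewrite /xD hf ?mulr0. Qed.

Lemma sexp_uniq (f g : series) : xlow 1 g -> (forall u, xw u = 0%N -> f u = (1 : series) u) ->
  xD f = f * xD g -> f = sexp g.
Proof.
move=> hg f0 fD; apply: (xD_uniq (xlow_xD hg) _ fD (xD_sexp hg)).
by move=> u u0; rewrite f0 // sexp_xw0.
Qed.

Lemma sexp_add f g : xlow 1 f -> xlow 1 g -> sexp (f + g) = sexp f * sexp g.
Proof.
move=> hf hg; apply/esym/sexp_uniq.
- by move=> u u1; rewrite addE hf // hg // addr0.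
- move=> u u0; rewrite -[in RHS](mulr1 1); apply: mul_cong => v; rewrite u0 leqn0 => /eqP v0;
  exact: sexp_xw0.
by rewrite xD_mul xD_add !xD_sexp // mulrDr mulrAC mulrA.
Qed.

Lemma sexp0 : sexp 0 = 1.
Proof.
apply/esym/sexp_uniq => //.
by rewrite xD1 xD0 mulr0.
Qed.

Lemma sexp_sum (I : Type) (r : seq I) (P : pred I) (F : I -> series) :
  (forall i, P i -> xlow 1 (F i)) ->
  sexp (\sum_(i <- r | P i) F i) = \prod_(i <- r | P i) sexp (F i).
Proof.
move=> hF; elim: r => [|i r IH]; first by rewrite !big_nil sexp0.
rewrite !big_cons; case: ifP => // Pi; rewrite sexp_add ?IH //; first exact: hF.
exact: xlow_sum.
Qed.

Lemma dil_sexp n g : (0 < n)%N -> xlow 1 g -> dil n (sexp g) = sexp (dil n g).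
Proof.
move=> n0 hg; apply: sexp_uniq.
- by apply: (xlowW n0); exact: xlow_dil.
- move=> u; have [[v ->]|nu] := dil_case n u.
    rewrite xw_dil // => /eqP; rewrite muln_eq0 eqn0Ngt n0 => /eqP v0.
    by rewrite -(dil1 n0) !dilE // sexp_xw0.
  by move=> _; rewrite -(dil1 n0) !dil_out.
by rewrite !xD_dil // xD_sexp // dil_mul // scale_mulr.
Qed.

End SeriesTheory.

(** * Cycle monomials *)

Section Cycles.

(** Orbits of plain functions on stable subsets, rather than of permutations: the maps met below are
    iterates, products and direct images, restricted to sets of hedra or fronts. *)
Definition forb (X : finType) (f : X -> X) (x : X) : {set X} :=
  [set y | fconnect f x y]%SET.

Definition forbs (X : finType) (f : X -> X) (A : {set X}) : {set {set X}} :=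
  [set forb f x | x in A]%SET.

(** The cycle monomial of [f] on [A]. The family [p] is left free, so that a dilation only replaces
    [p j] by [p (n * j)]. *)
Definition cyc (p : nat -> series) (X : finType) (f : X -> X) (A : {set X}) : series :=
  \prod_(B in forbs f A) p #|B|.

Lemma cycE p (X : finType) (f : X -> X) (A : {set X}) :
  cyc p f A = \prod_(B in forbs f A) p #|B|.
Proof. by []. Qed.

Lemma forbP (X : finType) (f : X -> X) x y :
  reflect (exists n, y = iter n f x) (y \in forb f x).
Proof.
rewrite inE; apply: (iffP idP) => [/iter_findex <-|[n ->]]; last exact: fconnect_iter.
by exists (findex f x y).
Qed.

Lemma forb_refl (X : finType) (f : X -> X) x : x \in forb f x.
Proof. by rewrite inE connect0. Qed.

Lemma iter_stable (X : finType) (f : X -> X) (A : {set X}) n x :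
  {in A, forall x, f x \in A} -> x \in A -> iter n f x \in A.
Proof. by move=> fA xA; elim: n => //= n; exact: fA. Qed.

Lemma forb_sub (X : finType) (f : X -> X) (A : {set X}) x :
  {in A, forall x, f x \in A} -> x \in A -> forb f x \subset A.
Proof.
by move=> fA xA; apply/fintype.subsetP => _ /forbP[n ->]; exact: iter_stable.
Qed.

Lemma forb_eq (X : finType) (f : X -> X) x y : injective f ->
  (forb f x == forb f y) = (y \in forb f x).
Proof.
move=> fI; apply/eqP/idP => [->|]; first exact: forb_refl.
rewrite inE => xy; apply/setP => z; rewrite !inE.
exact: same_connect (fconnect_sym fI) _ _ xy z.
Qed.

Lemma iter_morph_in (X Y : finType) (f : X -> X) (g : Y -> Y) (h : X -> Y) (A : {set X}) n x :
  {in A, forall x, f x \in A} -> {in A, forall x, h (f x) = g (h x)} -> x \in A ->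
  h (iter n f x) = iter n g (h x).
Proof.
move=> fA hfg xA; elim: n => //= n <-; apply: hfg; exact: iter_stable.
Qed.

Lemma forb_imset (X Y : finType) (f : X -> X) (g : Y -> Y) (h : X -> Y) (A : {set X}) x :
  {in A, forall x, f x \in A} -> {in A, forall x, h (f x) = g (h x)} -> x \in A ->
  forb g (h x) = (h @: forb f x)%SET.
Proof.
move=> fA hfg xA; apply/setP => y; apply/forbP/imsetP => [[n ->]|[_ /forbP[n ->] ->]].
  by exists (iter n f x); [apply/forbP; exists n | rewrite (iter_morph_in _ fA hfg)].
by exists n; rewrite (iter_morph_in _ fA hfg).
Qed.

Lemma cyc_bij p (X Y : finType) (f : X -> X) (g : Y -> Y) (h : X -> Y) (A : {set X}) :
  {in A &, injective h} -> {in A, forall x, f x \in A} ->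
  {in A, forall x, h (f x) = g (h x)} -> cyc p f A = cyc p g (h @: A)%SET.
Proof.
move=> hI fA hfg; rewrite /cyc.
have fsub C : C \in forbs f A -> C \subset A.
  by case/imsetP => x xA ->; exact: forb_sub.
have -> : forbs g (h @: A)%SET = [set (h @: (C : {set X}))%SET | C in forbs f A]%SET.
  rewrite /forbs -!imset_comp; apply: eq_in_imset => x xA /=.
  exact: forb_imset fA hfg xA.
rewrite [RHS]big_imset /=.
  apply: eq_bigr => C /fsub CA; rewrite card_in_imset // => x y xC yC.
  by apply: hI; exact: (fintype.subsetP CA).
move=> C D /fsub CA /fsub DA CD.
have aux (C' D' : {set X}) : C' \subset A -> D' \subset A ->
    (h @: C' = h @: D')%SET -> C' \subset D'.
  move=> CA' DA' /setP CD'; apply/fintype.subsetP => x xC.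
  have : h x \in (h @: D')%SET by rewrite -CD' imset_f.
  case/imsetP => y yD /hI -> //; [exact: (fintype.subsetP CA')|exact: (fintype.subsetP DA')].
by apply/eqP; rewrite finset.eqEsubset (aux C D CA DA CD) (aux D C DA CA (esym CD)).
Qed.

Lemma cycU p (X : finType) (f : X -> X) (A B : {set X}) : [disjoint A & B] ->
  {in A, forall x, f x \in A} -> {in B, forall x, f x \in B} ->
  cyc p f (A :|: B)%SET = cyc p f A * cyc p f B.
Proof.
move=> dAB fA fB; rewrite /cyc /forbs imsetU -bigU /=; first by apply: eq_bigl => C; rewrite !inE.
rewrite disjoint_subset; apply/fintype.subsetP => _ /imsetP[x xA ->].
apply/negP => /imsetP[y yB xy].
have xB : x \in B by apply: (fintype.subsetP (forb_sub fB yB)); rewrite -xy forb_refl.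
by move: dAB; rewrite disjoint_subset => /fintype.subsetP/(_ x xA); rewrite !inE xB.
Qed.

Lemma cyc0 p (X : finType) (f : X -> X) : cyc p f set0%SET = 1.
Proof. by rewrite /cyc /forbs imset0 big_set0. Qed.

Lemma cyc1 p (X : finType) (f : X -> X) x : f x = x -> cyc p f [set x]%SET = p 1%N.
Proof.
move=> fx; rewrite /cyc /forbs imset_set1 big_set1; congr p.
rewrite (_ : forb f x = [set x]%SET) ?cards1 //; apply/setP => y.
apply/forbP/set1P => [[n ->]|->]; last by exists 0%N.
by elim: n => //= n ->.
Qed.

Lemma forb_perm (X : finType) (s : {perm X}) x : forb s x = porbit s x.
Proof.
apply/setP => y; apply/forbP/porbitP => -[n ->]; exists n; by rewrite permX.
Qed.

Lemma forbs_perm (X : finType) (s : {perm X}) : forbs s [set: X]%SET = porbits s.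
Proof.
apply/setP => B; apply/imsetP/imsetP => -[x _ ->]; exists x => //; by rewrite forb_perm.
Qed.

Lemma cyc_perm p (X : finType) (s : {perm X}) :
  cyc p s [set: X]%SET = \prod_(c in porbits s) p #|c|.
Proof. by rewrite /cyc forbs_perm. Qed.

Lemma card_forb_gt0 (X : finType) (f : X -> X) A B : B \in forbs f A -> (0 < #|B|)%N.
Proof. by case/imsetP => x _ ->; rewrite card_gt0; apply/set0Pn; exists x; exact: forb_refl. Qed.

Lemma cyc_ncycles (p : nat -> series) (X : finType) (s : {perm X}) N : (#|X| <= N)%N ->
  \prod_(1 <= j < N.+1) p j ^+ ncycles s j = cyc p s [set: X]%SET.
Proof.
move=> XN; rewrite cyc_perm big_add1 /= big_mkord.
(* Cycles are grouped by their length minus one. The last class of ['I_N.+1] is empty, lengths being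
   at most [N]; it is there because [inord] needs a nonempty type even for [N = 0]. *)
rewrite (partition_big (fun c : {set X} => inord #|c|.-1 : 'I_N.+1) predT) //=.
have c0 c : c \in porbits s -> (0 < #|c| <= N)%N.
  rewrite -forbs_perm => /card_forb_gt0 ->.
  by rewrite (leq_trans (max_card _)).
rewrite big_ord_recr /= [X in _ = _ * X]big1 ?mulr1; last first.
  move=> c /andP[/c0 /andP[c1 cN]] /eqP/(congr1 val) /=; rewrite inordK; lia.
apply: eq_bigr => j _; rewrite /ncycles.
rewrite (eq_bigr (fun _ => p j.+1)); last first.
  move=> c /andP[/c0 /andP[c1 cN]] /eqP/(congr1 val) /=; rewrite inordK; last by lia.
  by move=> <-; rewrite prednK.
rewrite prodr_const; congr (_ ^+ _); apply: eq_card => c; rewrite [LHS]inE [RHS]unfold_in /=.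
case cs: (c \in porbits s); last by [].
have /andP[c1 cN] := c0 _ cs.
rewrite -val_eqE /= inordK; last by lia.
by rewrite -[RHS](eqn_add2r 1) !addn1 prednK.
Qed.

Lemma sum_card_forbs (X : finType) (f : X -> X) (A : {set X}) : injective f ->
  {in A, forall x, f x \in A} -> (\sum_(B in forbs f A) #|B|)%N = #|A|.
Proof.
move=> fI fA; apply/esym/card_partition; apply/and3P; split.
- rewrite /cover; apply/eqP/setP => x; apply/bigcupP/idP.
    by case=> _ /imsetP[y yA ->]; apply: (fintype.subsetP (forb_sub fA yA)).
  by move=> xA; exists (forb f x); [exact: imset_f|exact: forb_refl].
- apply/trivIsetP => _ _ /imsetP[x xA ->] /imsetP[y yA ->] /negP xy.
  rewrite disjoint_subset; apply/fintype.subsetP => z zx; apply/negP => zy.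
  apply: xy; move: zx zy; rewrite -!forb_eq // => /eqP -> ; by rewrite eq_sym.
by apply/negP => /card_forb_gt0; rewrite cards0.
Qed.

Lemma homog_cycx (X : finType) (f : X -> X) (A : {set X}) : injective f ->
  {in A, forall x, f x \in A} -> homog xvar #|A| (cyc px f A).
Proof.
move=> fI fA; rewrite -(sum_card_forbs fI fA); apply: homog_prod => B /card_forb_gt0.
exact: homog_px.
Qed.

Lemma homog_cycy (X : finType) (f : X -> X) (A : {set X}) : homog xvar 0 (cyc py f A).
Proof.
have -> : 0%N = (\sum_(B in forbs f A) 0)%N by rewrite big1.
by apply: homog_prod => B _; exact: homog_py.
Qed.

Lemma homogy_cycy (X : finType) (f : X -> X) (A : {set X}) : injective f ->
  {in A, forall x, f x \in A} -> homog yvar #|A| (cyc py f A).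
Proof.
move=> fI fA; rewrite -(sum_card_forbs fI fA); apply: homog_prod => B /card_forb_gt0.
exact: homogy_py.
Qed.

Lemma homogy_cycx (X : finType) (f : X -> X) (A : {set X}) : homog yvar 0 (cyc px f A).
Proof.
have -> : 0%N = (\sum_(B in forbs f A) 0)%N by rewrite big1.
by apply: homog_prod => B _; exact: homogy_px.
Qed.

Lemma dil_cycx n (X : finType) (f : X -> X) (A : {set X}) : (0 < n)%N ->
  dil n (cyc px f A) = cyc (fun j => px (n * j)) f A.
Proof.
move=> n0; rewrite /cyc dil_prod //; apply: eq_bigr => B /card_forb_gt0; exact: dil_px.
Qed.

Lemma dil_cycy n (X : finType) (f : X -> X) (A : {set X}) : (0 < n)%N ->
  dil n (cyc py f A) = cyc (fun j => py (n * j)) f A.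
Proof.
move=> n0; rewrite /cyc dil_prod //; apply: eq_bigr => B /card_forb_gt0; exact: dil_py.
Qed.

Lemma iter_inj (X : Type) (f : X -> X) n : injective f -> injective (iter n f).
Proof. by move=> fI; elim: n => //= n IH x y /fI /IH. Qed.

(* An orbit of [f] of length [n * l] meets the cross-section [A0] in an orbit of [iter n f] of length [l]. *)
Lemma cyc_iter p n (X : finType) (f : X -> X) (A A0 : {set X}) : injective f ->
  (0 < n)%N -> {in A0, forall x, iter n f x \in A0} ->
  (forall x j, x \in A0 -> (0 < j < n)%N -> iter j f x \notin A0) ->
  (forall x, x \in A -> exists j y, y \in A0 /\ x = iter j f y) -> A0 \subset A ->
  cyc p f A = cyc (fun j => p (n * j)%N) (iter n f) A0.
Proof.
move=> fI n0 fA0 nA0 AA0 A0A.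
(* Returns to [A0] occur only at multiples of [n], so an orbit of [f] meets [A0] in a single orbit
   of [iter n f]. *)
have modA0 m x : x \in A0 -> iter m f x \in A0 -> (n %| m)%N.
  move=> xA0; rewrite (divn_eq m n) addnC iterD iterM dvdn_addl; last exact: dvdn_mull.
  move=> mA0; have [->|m0] := posnP (m %% n)%N; first exact: dvdn0.
  have /nA0 : iter (m %/ n) (iter n f) x \in A0 by apply: iter_stable.
  by move=> /(_ (m %% n)%N); rewrite m0 ltn_pmod // mA0 => /(_ isT).
have meet x : x \in A0 -> (forb f x :&: A0)%SET = forb (iter n f) x.
  move=> xA0; apply/setP => y; rewrite inE; apply/andP/forbP.
    case=> /forbP[m ->] /(modA0 _ _ xA0)/dvdnP[q ->].
    by exists q; rewrite iterM.
  move=> [q ->]; split; last exact: iter_stable.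
  by apply/forbP; exists (q * n)%N; rewrite iterM.
have orbA0 : forbs f A = forbs f A0.
  apply/setP => B; apply/imsetP/imsetP => -[x xA ->].
    have [j [y [yA0 ->]]] := AA0 x xA; exists y => //; apply/eqP.
    by rewrite eq_sym forb_eq //; apply/forbP; exists j.
  by exists x => //; exact: (fintype.subsetP A0A).
rewrite /cyc orbA0.
have -> : forbs (iter n f) A0 = [set (B :&: A0)%SET | B in forbs f A0]%SET.
  by rewrite /forbs -imset_comp; apply: eq_in_imset => x xA0 /=; rewrite meet.
rewrite [RHS]big_imset /=; last first.
  move=> _ _ /imsetP[x xA0 ->] /imsetP[y yA0 ->] xy; apply/eqP.
  rewrite forb_eq //; have : y \in (forb f y :&: A0)%SET by rewrite inE forb_refl.
  by rewrite -xy inE => /andP[].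
apply: eq_bigr => _ /imsetP[x xA0 ->]; congr p; rewrite meet //.
pose F (t : 'I_n * X) := iter t.1 f t.2.
have sA0 y : y \in forb (iter n f) x -> y \in A0.
  by move=> yx; apply: (fintype.subsetP (forb_sub fA0 xA0)).
have -> : forb f x = (F @: setX [set: 'I_n] (forb (iter n f) x))%SET.
  apply/setP => z; apply/forbP/imsetP.
    move=> [m ->]; exists (Ordinal (ltn_pmod m n0), iter (m %/ n) (iter n f) x).
      by rewrite inE /= in_setT; apply/forbP; eexists.
    by rewrite /F /= {1}(divn_eq m n) addnC iterD iterM.
  move=> [[j y] /setXP[_ /forbP[q ->]] ->].
  by exists (j + q * n)%N; rewrite iterD iterM.
rewrite card_in_imset; first by rewrite cardsX cardsT card_ord.
have aux (i j : 'I_n) y z : (i <= j)%N -> y \in A0 -> z \in A0 ->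
    iter i f y = iter j f z -> (i, y) = (j, z).
  move=> ij yA0 zA0; rewrite -{1}(subnKC ij) iterD => /(iter_inj fI) yz.
  have ji : (j - i = 0)%N.
    apply/eqP; apply: contraTT yA0 => ji; rewrite yz; apply: nA0 => //.
    by rewrite lt0n ji (leq_ltn_trans (leq_subr _ _)).
  rewrite ji in yz; congr pair => //; apply/val_inj/eqP => /=.
  by rewrite eqn_leq ij -subn_eq0 ji.
move=> [i y] [j z] /setXP[_ /sA0 yA0] /setXP[_ /sA0 zA0] yz.
case: (leqP i j) => [|/ltnW] ij; first exact: aux.
by apply/esym; apply: aux.
Qed.

End Cycles.

(** * Coloured forests with an automorphism *)

Section Acyclic.
Variable S : finType.
Implicit Type par : S -> option S.

Definition acyclic par : Prop :=
  exists rk : S -> nat, forall v w, par v = Some w -> (rk w < rk v)%N.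

Definition up par (v : S) : S := odflt v (par v).

(** [up] fixes the roots, and a path to a root never has more than [#|S|] edges, so [#|S|] steps
    always arrive. *)
Definition rt par (v : S) : S := iter #|S| (up par) v.

Lemma acyclic_ind par (P : S -> Prop) : acyclic par ->
  (forall v, (forall w, par v = Some w -> P w) -> P v) -> forall v, P v.
Proof.
move=> [rk rkP] IH v; have [n vn] := ubnP (rk v).
elim: n v vn => // n IHn v vn; apply: IH => w /rkP wv; apply: IHn.
by rewrite -ltnS (leq_trans _ vn).
Qed.

Lemma rt_is_root par v : acyclic par -> par (rt par v) = None.
Proof.
(* The rank is replaced by the number of vertices of smaller rank, which is at most [#|S|] and still
   decreases towards the parent. *)
move=> [rk rkP]; pose rk' v := #|[set w | (rk w < rk v)%N]%SET|.
have rk'P v' w : par v' = Some w -> (rk' w < rk' v')%N.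
  move=> /rkP wv; apply: proper_card; apply/properP; split.
    by apply/fintype.subsetP => t; rewrite !inE => /ltn_trans; exact.
  by exists w; rewrite !inE // ltnn.
have lt v' : (rk' v' <= #|S|)%N by exact: max_card.
rewrite /rt; elim: #|S| v (lt v) => [|n IH] v' vn.
  by case E: (par v') => [w|//]; have := leq_trans (rk'P _ _ E) vn.
rewrite iterSr /up; case E: (par v') => [w|] /=.
  by apply: IH; rewrite -ltnS; exact: leq_trans (rk'P _ _ E) vn.
by rewrite -/(up par) (_ : iter n (up par) v' = v') //; elim: (n) => //= k ->; rewrite /up E.
Qed.

Lemma rt_root par v : par v = None -> rt par v = v.
Proof. by move=> pv; rewrite /rt; elim: #|S| => //= n ->; rewrite /up pv. Qed.

Lemma rt_up par v w : acyclic par -> par v = Some w -> rt par v = rt par w.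
Proof.
move=> ac pv; have -> : w = up par v by rewrite /up pv.
rewrite {2}/rt -iterSr iterS -/(rt par v).
by rewrite /up rt_is_root.
Qed.

End Acyclic.

Section Codes.
Variable K : finType.

(* A coloured rooted forest with an automorphism [cphi]. It encodes a k-tree grown from a root
   hedron or front, with vertices coloured by [K]: the vertex [v] creates a hedron, by
   replacing the vertex of colour [ccol v] of the hedron created by [cpar v] (of the root
   when [cpar v = None]); [I] is the set of colours of the fronts of the root. *)
Definition code (S : finType) : finType :=
  ({ffun S -> S} * ({ffun S -> option S} * {ffun S -> K}))%type.

Definition cphi (S : finType) (x : code S) : {ffun S -> S} := x.1.
Definition cpar (S : finType) (x : code S) : {ffun S -> option S} := x.2.1.
Definition ccol (S : finType) (x : code S) : {ffun S -> K} := x.2.2.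

(** [ok_proper] makes the encoding unique: the front opposite to the colour of [w] in the hedron
    created by [w] is the one to which [w] itself is attached, and a vertex attached there is
    recorded below [cpar x w] instead. *)
Record code_ok (S : finType) (sg : K -> K) (I : {set K}) (x : code S) : Prop := CodeOk {
  ok_inj : injective (cphi x);
  ok_acyclic : acyclic (cpar x);
  ok_root : forall v, cpar x v = None -> ccol x v \in I;
  ok_proper : forall v w, cpar x v = Some w -> ccol x v != ccol x w;
  ok_par : forall v, cpar x (cphi x v) = omap (cphi x) (cpar x v);
  ok_col : forall v, ccol x (cphi x v) = sg (ccol x v)
}.

Definition colmap (S : finType) (f : S -> S) (sg : K -> K) (p : S * K) : S * K :=
  (f p.1, sg p.2).

(** The pair [(v, l)] names the front opposite to the colour [l] in the hedron created by [v]. The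
    colour of [v] is excluded because that front existed before [v]. *)
Definition code_fronts (S : finType) (x : code S) : {set S * K} :=
  [set p | p.2 != ccol x p.1]%SET.

(** The hedron and the fronts of the root are left out, so that one weight serves both kinds of
    roots. *)
Definition code_wt (S : finType) (sg : K -> K) (x : code S) : series :=
  cyc px (cphi x) [set: S]%SET * cyc py (colmap (cphi x) sg) (code_fronts x).

Definition code_iso (Q S : finType) (h : Q -> S) (y : code Q) (x : code S) : Prop :=
  [/\ forall q, cphi x (h q) = h (cphi y q),
      forall q, cpar x (h q) = omap h (cpar y q)
    & forall q, ccol x (h q) = ccol y q].

Section OneCode.
Variables (S : finType) (sg : K -> K) (I : {set K}) (x : code S).
Hypothesis xok : code_ok sg I x.

Lemma ok_col_iter n v : ccol x (iter n (cphi x) v) = iter n sg (ccol x v).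
Proof. by elim: n => //= n <-; rewrite (ok_col xok). Qed.

Lemma ok_par_iter n v : cpar x (iter n (cphi x) v) = omap (iter n (cphi x)) (cpar x v).
Proof.
elim: n => [|n IH] /=; first by case: (cpar x v).
by rewrite (ok_par xok) IH; case: (cpar x v).
Qed.

Lemma ok_rt_iter n v : rt (cpar x) (iter n (cphi x) v) = iter n (cphi x) (rt (cpar x) v).
Proof.
have ac := ok_acyclic xok; move: v; apply: (acyclic_ind ac) => v IH.
case pv: (cpar x v) => [w|].
  rewrite (rt_up ac pv) -IH // (rt_up (w := iter n (cphi x) w) ac) //.
  by rewrite ok_par_iter pv.
by rewrite !rt_root // ok_par_iter pv.
Qed.

Lemma ok_rt v : rt (cpar x) (cphi x v) = cphi x (rt (cpar x) v).
Proof. exact: (ok_rt_iter 1). Qed.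

Lemma code_fronts_stable :
  injective sg -> {in code_fronts x, forall p, colmap (cphi x) sg p \in code_fronts x}.
Proof. by move=> sgI [v l]; rewrite !inE /= (ok_col xok) (inj_eq sgI). Qed.

Lemma homog_code_wt : homog xvar #|S| (code_wt sg x).
Proof.
rewrite -[#|S|]addn0 -cardsT; apply: homog_mul; last exact: homog_cycy.
by apply: homog_cycx => //; exact: ok_inj xok.
Qed.

End OneCode.

Lemma colmap_inj (S : finType) (f : S -> S) (sg : K -> K) :
  injective f -> injective sg -> injective (colmap f sg).
Proof. by move=> fI sI [a b] [c d] [/fI -> /sI ->]. Qed.

Section Iso.
Variables (Q S : finType) (h : Q -> S).

Lemma iso_uniq_r y x x' : bijective h -> code_iso h y x -> code_iso h y x' -> x = x'.
Proof.
move=> [g gK hK] [a1 a2 a3] [b1 b2 b3]; case: x x' a1 a2 a3 b1 b2 b3 => [f [p c]] [f' [p' c']].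
rewrite /cphi /cpar /ccol /= => a1 a2 a3 b1 b2 b3.
by congr (_, (_, _)); apply/ffunP => s; rewrite -[s]hK ?a1 ?b1 ?a2 ?b2 ?a3 ?b3.
Qed.

Lemma iso_uniq_l y y' x : injective h -> code_iso h y x -> code_iso h y' x -> y = y'.
Proof.
move=> hI [a1 a2 a3] [b1 b2 b3]; case: y y' a1 a2 a3 b1 b2 b3 => [f [p c]] [f' [p' c']].
rewrite /cphi /cpar /ccol /= => a1 a2 a3 b1 b2 b3.
congr (_, (_, _)); apply/ffunP => q.
- by apply: hI; rewrite -a1 b1.
- have := a2 q; rewrite b2; case: (p q) (p' q) => [s|] [t|] //= [] /hI -> //.
- by rewrite -a3 b3.
Qed.

Lemma iso_tr y : bijective h -> exists x, code_iso h y x.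
Proof.
move=> [g gK hK]; exists ([ffun s => h (cphi y (g s))],
  ([ffun s => omap h (cpar y (g s))], [ffun s => ccol y (g s)])).
by split => q; rewrite /cphi /cpar /ccol /= ffunE gK.
Qed.

Lemma iso_ok sg I y x : bijective h -> code_iso h y x -> code_ok sg I y -> code_ok sg I x.
Proof.
move=> [g gK hK] [a1 a2 a3] [y1 [rk y2] y3 y4 y5 y6]; split.
- by move=> s t; rewrite -[s]hK -[t]hK !a1 => /(can_inj gK)/y1 ->.
- exists (rk \o g) => s t; rewrite -[s]hK a2; case E: (cpar y (g s)) => [q|] //= [<-].
  by rewrite !gK; exact: y2.
- by move=> s; rewrite -[s]hK a2 a3; case E: (cpar y (g s)) => [q|] //= _; exact: y3.
- move=> s t; rewrite -[s]hK a2; case E: (cpar y (g s)) => [q|] //= [<-].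
  by rewrite !a3; exact: y4.
- by move=> s; rewrite -[s]hK a1 !a2 y5; case: (cpar y (g s)) => [q|] //=; rewrite a1.
- by move=> s; rewrite -[s]hK a1 !a3 y6.
Qed.

Lemma iso_wt sg I y x : injective sg -> bijective h -> code_iso h y x -> code_ok sg I y ->
  code_wt sg x = code_wt sg y.
Proof.
move=> sI hB [a1 a2 a3] yok; have hI := bij_inj hB; rewrite /code_wt.
have -> : [set: S]%SET = (h @: [set: Q])%SET.
  case: hB => g gK hK; apply/setP => s; rewrite in_setT; apply/esym/imsetP.
  by exists (g s) => //; rewrite ?hK ?in_setT.
have -> : code_fronts x = ((fun p : Q * K => (h p.1, p.2)) @: code_fronts y)%SET.
  case: hB => g gK hK; apply/setP => -[s l]; apply/idP/imsetP; rewrite ?inE /=.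
    by move=> ls; exists (g s, l); rewrite ?inE /= ?hK // -a3 hK.
  by move=> [[q l']]; rewrite inE /= => lq [-> ->]; rewrite a3.
congr (_ * _); apply/esym.
  by apply: cyc_bij => [p q _ _ /hI|p _|q _] //=; rewrite ?in_setT // a1.
apply: cyc_bij.
- by move=> [p l] [q l'] _ _ /= [/hI -> ->].
- exact: code_fronts_stable yok sI.
- by move=> [p l] _; rewrite /colmap /= a1.
Qed.

Lemma iso_rt sg I y x q : code_iso h y x -> code_ok sg I y -> code_ok sg I x ->
  rt (cpar x) (h q) = h (rt (cpar y) q).
Proof.
move=> [a1 a2 a3] yok xok.
have ay := ok_acyclic yok; have ax := ok_acyclic xok.
move: q; apply: (acyclic_ind ay) => q IH.
case pq: (cpar y q) => [w|]; last by rewrite !rt_root // a2 pq.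
by rewrite (rt_up ay pq) -IH // (rt_up (w := h w) ax) // a2 pq.
Qed.

End Iso.

End Codes.

(** * Adding a cycle of trees to a forest *)

Local Opaque px py dil series_mul cyc.

Section Model.
Variables (K A B : finType) (m : nat) (sg : K -> K) (I : {set K}) (i : K).

(* The forest obtained from a forest on [A] by adding a cycle of [m.+1] trees,
   each of them a root together with a copy of a forest on [B]. *)
Definition mcarrier : finType := (A + 'I_m.+1 * option B)%type.

Variables (y1 : code K A) (y2 : code K B).

(** The map [cphi y2] is applied only on leaving the last copy, which makes it the return map to
    copy [0] after [m.+1] steps ([rot_iter_full]). Between consecutive copies nothing moves inside
    [option B], so copy [j] has to carry the colours of copy [0] moved by [iter j sg]. *)
Definition mrot (q : 'I_m.+1 * option B) : 'I_m.+1 * option B :=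
  if q.1 == ord_max then (ord0, omap (cphi y2) q.2) else (inord q.1.+1, q.2).

Definition mphi : {ffun mcarrier -> mcarrier} :=
  [ffun q => match q with inl a => inl (cphi y1 a) | inr p => inr (mrot p) end].

Definition mpar : {ffun mcarrier -> option mcarrier} :=
  [ffun q : mcarrier => match q with
    | inl a => omap inl (cpar y1 a)
    | inr (j, None) => None
    | inr (j, Some b) => Some (inr (j, cpar y2 b))
    end].

Definition mcol : {ffun mcarrier -> K} :=
  [ffun q : mcarrier => match q with
    | inl a => ccol y1 a
    | inr (j, None) => iter j sg i
    | inr (j, Some b) => iter j sg (ccol y2 b)
    end].

Definition model : code K mcarrier := (mphi, (mpar, mcol)).

Lemma mphi_l a : mphi (inl a) = inl (cphi y1 a). Proof. by rewrite ffunE. Qed.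
Lemma mphi_r p : mphi (inr p) = inr (mrot p). Proof. by rewrite ffunE. Qed.
Lemma mpar_l a : mpar (inl a) = omap inl (cpar y1 a). Proof. by rewrite ffunE. Qed.
Lemma mpar_N j : mpar (inr (j, None)) = None. Proof. by rewrite ffunE. Qed.
Lemma mpar_S j b : mpar (inr (j, Some b)) = Some (inr (j, cpar y2 b)).
Proof. by rewrite ffunE. Qed.
Lemma mcol_l a : mcol (inl a) = ccol y1 a. Proof. by rewrite ffunE. Qed.
Lemma mcol_N j : mcol (inr (j, None)) = iter j sg i. Proof. by rewrite ffunE. Qed.
Lemma mcol_S j b : mcol (inr (j, Some b)) = iter j sg (ccol y2 b).
Proof. by rewrite ffunE. Qed.

Lemma inord_S (j : 'I_m.+1) : j != ord_max -> (inord j.+1 : 'I_m.+1) = j.+1 :> nat.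
Proof.
move=> jm; rewrite inordK // ltnS ltn_neqAle -ltnS ltn_ord andbT.
by apply: contra jm => /eqP jm; apply/eqP/val_inj.
Qed.

Lemma rot_iter j o : (j <= m)%N -> iter j mphi (inr (ord0, o)) = inr (inord j, o).
Proof.
elim: j => [|j IH] jm /=.
  by congr (inr (_, _)); apply: val_inj; rewrite /= inordK.
rewrite IH 1?ltnW // mphi_r /mrot /= -val_eqE /= inordK ?(ltnW jm) // ?ltnS ?(ltnW jm) //.
by rewrite ltn_eqF.
Qed.

Lemma rot_iter_ord (j : 'I_m.+1) o : iter j mphi (inr (ord0, o)) = inr (j, o).
Proof. by rewrite rot_iter ?inord_val // -ltnS. Qed.

Lemma rot_iter_full o : iter m.+1 mphi (inr (ord0, o)) = inr (ord0, omap (cphi y2) o).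
Proof.
rewrite iterS rot_iter // mphi_r /mrot /=; case: eqP => // -[].
by apply: val_inj; rewrite /= inordK.
Qed.

Hypotheses (y1ok : code_ok sg I y1) (y2ok : code_ok (iter m.+1 sg) (~: [set i])%SET y2).
Hypotheses (sgI : injective sg) (Ist : {in I, forall l, sg l \in I}).
Hypotheses (iI : i \in I) (sgi : iter m.+1 sg i = i).

Lemma rot_inj : injective mrot.
Proof.
move=> [j o] [j' o']; rewrite /mrot /=.
have [->|jm] := eqVneq j ord_max; have [->|jm'] := eqVneq j' ord_max => -[].
- case: o o' => [b|] [b'|] //= [] /(ok_inj y2ok) -> //.
- by move=> /(congr1 val); rewrite /= inord_S.
- by move=> /(congr1 val); rewrite /= inord_S.
by move=> /(congr1 val); rewrite /= !inord_S // => -[] /val_inj -> ->.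
Qed.

(** A root of [y2] becomes a child of an added root, whose colour in copy [0] is [i]; its own colour
    must avoid [i], hence the set [~: [set i]] in [y2ok]. The equation [sgi] makes the colours match
    when the last copy is sent to the first. *)
Lemma model_ok : code_ok sg I model.
Proof.
have [rk1 rk1P] := ok_acyclic y1ok; have [rk2 rk2P] := ok_acyclic y2ok.
split; rewrite /cphi /cpar /ccol /=.
- move=> [a|p] [b|q]; rewrite ?mphi_l ?mphi_r // => -[].
    by move=> /(ok_inj y1ok) ->.
  by move=> /rot_inj ->.
- exists (fun q : mcarrier => match q with inl a => rk1 a | inr (j, Some b) => (rk2 b).+1
    | inr (j, None) => 0%N end) => -[a|[j [b|]]] w.
  + by rewrite mpar_l; case E: (cpar y1 a) => [a'|] //= [<-]; exact: rk1P.
  + by rewrite mpar_S => -[<-]; case E: (cpar y2 b) => [b'|] //; rewrite ltnS; exact: rk2P.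
  + by rewrite mpar_N.
- move=> [a|[j [b|]]].
  + by rewrite mpar_l mcol_l; case E: (cpar y1 a) => [a'|] //= _; exact: (ok_root y1ok).
  + by rewrite mpar_S.
  + by rewrite mcol_N => _; elim: (nat_of_ord j) => //= n; exact: Ist.
- move=> [a|[j [b|]]] w.
  + rewrite mpar_l; case E: (cpar y1 a) => [a'|] //= [<-]; rewrite !mcol_l.
    exact: (ok_proper y1ok).
  + rewrite mpar_S => -[<-]; rewrite mcol_S; case E: (cpar y2 b) => [b'|].
      by rewrite mcol_S (inj_eq (iter_inj sgI)); exact: (ok_proper y2ok).
    rewrite mcol_N (inj_eq (iter_inj sgI)).
    by have := ok_root y2ok E; rewrite !inE.
  + by rewrite mpar_N.
- move=> [a|[j [b|]]].
  + by rewrite mphi_l !mpar_l (ok_par y1ok); case: (cpar y1 a) => //= a'; rewrite mphi_l.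
  + rewrite mphi_r mpar_S /= mphi_r /mrot /=; case: eqP => _; rewrite mpar_S //.
    by rewrite (ok_par y2ok).
  + by rewrite mphi_r mpar_N /mrot /=; case: eqP => _; rewrite mpar_N.
move=> [a|[j [b|]]].
- by rewrite mphi_l !mcol_l (ok_col y1ok).
- rewrite mphi_r /mrot /=; case: (eqVneq j ord_max) => [->|jm]; rewrite !mcol_S.
    by rewrite (ok_col y2ok).
  by rewrite inord_S.
rewrite mphi_r /mrot /=; case: (eqVneq j ord_max) => [->|jm]; rewrite !mcol_N.
  by rewrite -[in LHS]sgi.
by rewrite inord_S.
Qed.

Let mphiI : injective mphi := ok_inj model_ok.

(** Copy [0] is a cross-section of the cycle of trees, so by [cyc_iter] the orbits there are those
    of the return map with lengths multiplied by [m.+1]. The added roots give [px 1], the rest of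
    the copy gives the vertices of [y2]. *)
Lemma model_wtx : cyc px mphi [set: mcarrier]%SET =
  cyc px (cphi y1) [set: A]%SET * dil m.+1 (px 1 * cyc px (cphi y2) [set: B]%SET).
Proof.
pose R := [set q : mcarrier | if q is inr _ then true else false]%SET.
pose R0 := [set q : mcarrier | if q is inr (j, _) then j == ord0 else false]%SET.
have -> : [set: mcarrier]%SET = ((@inl A ('I_m.+1 * option B)) @: [set: A] :|: R)%SET.
  apply/setP => -[a|p]; rewrite !inE ?orbT // orbF; apply/esym/imsetP.
  by exists a.
rewrite [LHS]cycU; first last.
- by move=> [a|p]; rewrite !inE ?mphi_r.
- by move=> _ /imsetP[a _ ->]; rewrite mphi_l imset_f.
- by rewrite disjoint_subset; apply/fintype.subsetP => _ /imsetP[a _ ->]; rewrite !inE.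
rewrite -(@cyc_bij px A _ (cphi y1)) => [|a b _ _ []|a|a _] //; last by rewrite mphi_l.
congr (_ * _); rewrite (@cyc_iter px m.+1 _ _ _ R0) //; first last.
- by apply/fintype.subsetP => -[a|[j o]]; rewrite !inE.
- move=> [a|[j o]]; rewrite inE // => _; exists j, (inr (ord0, o)).
  by rewrite inE eqxx rot_iter_ord.
- move=> [a|[j o]] l; rewrite inE // => /eqP -> /andP[l0 lm].
  by rewrite rot_iter // inE -val_eqE /= inordK // -lt0n.
- by move=> [a|[j o]]; rewrite inE // => /eqP ->; rewrite rot_iter_full inE.
pose h (o : option B) : mcarrier := inr (ord0, o).
have -> : R0 = (h @: [set: option B])%SET.
  apply/setP => -[a|[j o]]; apply/idP/imsetP; rewrite inE //; try by case.
  - by move=> /eqP ->; exists o.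
  - by move=> [o' _ [-> _]].
have hh : {in [set: option B]%SET, forall o, h (omap (cphi y2) o) = iter m.+1 mphi (h o)}.
  by move=> o _; rewrite rot_iter_full.
have hI : {in [set: option B]%SET &, injective h} by move=> o o' _ _ [].
have hs : {in [set: option B]%SET, forall o, omap (cphi y2) o \in [set: option B]%SET}.
  by move=> o _; rewrite in_setT.
have e := cyc_bij (fun j => px (m.+1 * j)) hI hs hh.
apply: etrans (esym e) _.
have -> : [set: option B]%SET = ([set None] :|: Some @: [set: B])%SET.
  by apply/setP => -[b|]; rewrite !inE //=; apply/esym/imsetP; exists b.
rewrite [LHS]cycU; first last.
- by move=> _ /imsetP[b _ ->]; exact: imset_f.
- by move=> o /set1P ->; rewrite /= inE.
- rewrite disjoint_subset; apply/fintype.subsetP => o /set1P ->; rewrite inE.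
  by apply/imsetP => -[].
have m0 := ltn0Sn m.
rewrite (dil_mul _ _ m0) (dil_px m0 (ltn0Sn 0)) (dil_cycx _ _ m0).
congr (_ * _); first by rewrite cyc1.
by apply/esym/cyc_bij => [b c _ _ []|b _|b _]; rewrite ?in_setT.
Qed.

(** The fronts in copy [0] are those of the added root, one for each colour other than [i], and
    those of [y2]. The return map acts on the colours of both by [iter m.+1 sg]. *)
Lemma model_wty : cyc py (colmap mphi sg) (code_fronts model) =
  cyc py (colmap (cphi y1) sg) (code_fronts y1) *
  dil m.+1 (cyc py (iter m.+1 sg) (~: [set i])%SET *
            cyc py (colmap (cphi y2) (iter m.+1 sg)) (code_fronts y2)).
Proof.
have pI : injective (colmap mphi sg) by exact: colmap_inj.
have pit n q l : iter n (colmap mphi sg) (q, l) = (iter n mphi q, iter n sg l).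
  by elim: n => //= n ->.
pose h1 (p : A * K) : mcarrier * K := (inl p.1, p.2).
pose F := code_fronts model.
pose R := [set q : mcarrier * K | if q.1 is inr _ then q \in F else false]%SET.
pose R0 := [set q : mcarrier * K | if q.1 is inr (j, _) then (j == ord0) && (q \in F) else false]%SET.
have st : {in F, forall p, colmap mphi sg p \in F}.
  exact: (code_fronts_stable model_ok).
have -> : code_fronts model = (h1 @: code_fronts y1 :|: R)%SET.
  apply/setP => -[[a|p] l]; rewrite !inE /=.
    rewrite orbF /ccol mcol_l; apply/idP/imsetP => [al|[[a' l']]].
      by exists (a, l); rewrite ?inE.
    by rewrite inE /= => ? [-> ->].
  rewrite [X in _ = X || _](_ : _ = false) ?inE //.
  by apply/imsetP => -[].
rewrite [LHS]cycU; first last.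
- move=> [[a|p] l]; rewrite inE //= => pF; rewrite inE.
  by rewrite [X in X.1]/colmap /= mphi_r; exact: st.
- move=> _ /imsetP[[a l] al ->]; rewrite /colmap /= mphi_l.
  apply/imsetP; exists (cphi y1 a, sg l) => //.
  exact: (code_fronts_stable y1ok sgI al).
- rewrite disjoint_subset; apply/fintype.subsetP => _ /imsetP[[a l] _ ->]; by rewrite !inE.
rewrite -(@cyc_bij py _ _ (colmap (cphi y1) sg)); first last.
- by move=> [a l] _; rewrite /colmap /= mphi_l.
- exact: code_fronts_stable y1ok sgI.
- by move=> [a l] [a' l'] _ _ [-> ->].
congr (_ * _); rewrite (@cyc_iter py m.+1 _ _ _ R0) //; first last.
- by apply/fintype.subsetP => -[[a|[j o]] l]; rewrite !inE //= => /andP[].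
- move=> [[a|[j o]] l]; rewrite inE //= => jol; exists j.
  exists (inr (ord0, o), iter j (finv sg) l).
  have lE : iter j sg (iter j (finv sg) l) = l.
    elim: (nat_of_ord j) => //= n IH; rewrite -[LHS]/(iter n.+1 sg _) iterSr (f_finv sgI).
    exact: IH.
  rewrite pit rot_iter_ord lE; split=> //; rewrite inE /=.
  move: jol; rewrite !inE /= /ccol /=.
  by case: o => [b|]; rewrite ?mcol_S ?mcol_N -{1}lE /= (inj_eq (iter_inj sgI)).
- move=> [[a|[j o]] r] l; rewrite inE //= => /andP[/eqP -> _] /andP[l0 lm].
  by rewrite pit inE /= rot_iter // -val_eqE /= inordK // eqn0Ngt l0.
- move=> [[a|[j o]] r]; rewrite inE //= => /andP[/eqP -> oF].
  have := iter_stable m.+1 st oF.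
  by rewrite -iterS pit rot_iter_full !inE /=.
pose g1 (l : K) : mcarrier * K := (inr (ord0, None), l).
pose g2 (p : B * K) : mcarrier * K := (inr (ord0, Some p.1), p.2).
have -> : R0 = ((g1 @: (~: [set i])) :|: (g2 @: code_fronts y2))%SET.
  apply/setP => -[q l]; rewrite inE /= in_setU; apply/idP/orP.
    case: q => [a|[j o]] // /andP[/eqP -> ]; rewrite inE /= /ccol /=.
    case: o => [b|]; rewrite ?mcol_S ?mcol_N /= => lb.
      by right; apply/imsetP; exists (b, l); rewrite ?inE.
    by left; apply/imsetP; exists l; rewrite ?inE.
  case=> /imsetP => [[l' l'i]|[[b l'] bl']] [-> ->]; rewrite eqxx inE /= /ccol /=.
    by rewrite mcol_N; move: l'i; rewrite !inE.
  by rewrite mcol_S; move: bl'; rewrite inE.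
have stg1 : {in (~: [set i])%SET, forall l, iter m.+1 sg l \in (~: [set i])%SET}.
  by move=> l; rewrite !inE -{2}sgi (inj_eq (iter_inj (n := m.+1) sgI)).
have stg2 := code_fronts_stable y2ok (iter_inj (n := m.+1) sgI).
have e1 l : g1 (iter m.+1 sg l) = iter m.+1 (colmap mphi sg) (g1 l).
  by rewrite pit rot_iter_full.
have e2 p : g2 (colmap (cphi y2) (iter m.+1 sg) p) = iter m.+1 (colmap mphi sg) (g2 p).
  by rewrite pit rot_iter_full.
rewrite [LHS]cycU; first last.
- by move=> _ /imsetP[p py2 ->]; rewrite -e2; apply: imset_f; exact: stg2.
- by move=> _ /imsetP[p py2 ->]; rewrite -e1; apply: imset_f; exact: stg1.
- rewrite disjoint_subset; apply/fintype.subsetP => _ /imsetP[l _ ->]; rewrite inE.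
  by apply/imsetP => -[].
have m0 := ltn0Sn m.
rewrite (dil_mul _ _ m0) !(dil_cycy _ _ m0); congr (_ * _); apply/esym.
  by apply: cyc_bij => // ? ? _ _ [].
by apply: cyc_bij => // [[? ?] [? ?]] _ _ [-> ->].
Qed.

Lemma dil_mulACA n (a b c d p e : series) :
  (a * dil n.+1 (p * b)) * (c * dil n.+1 (d * e)) = (a * c) * dil n.+1 (p * d * (b * e)).
Proof.
rewrite mulrACA; congr (_ * _); rewrite -(dil_mul _ _ (ltn0Sn n)).
by congr (dil _ _); rewrite mulrACA.
Qed.

Lemma model_wt : code_wt sg model =
  code_wt sg y1 * dil m.+1 (px 1 * cyc py (iter m.+1 sg) (~: [set i])%SET *
                            code_wt (iter m.+1 sg) y2).
Proof.
have e : code_wt sg model =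
  cyc px mphi [set: mcarrier]%SET * cyc py (colmap mphi sg) (code_fronts model) by [].
apply: etrans (etrans e (congr2 *%R model_wtx model_wty)) _.
exact: dil_mulACA.
Qed.

Lemma model_rt q : rt mpar q =
  match q with inl a => inl (rt (cpar y1) a) | inr p => inr (p.1, None) end.
Proof.
have ac := ok_acyclic model_ok; move: q; apply: (acyclic_ind ac) => -[a|[j [b|]]] IH.
- rewrite /cpar /= in ac IH; case E: (cpar y1 a) => [a'|].
    rewrite (rt_up (w := inl a') ac) ?mpar_l ?E // IH ?mpar_l ?E //.
    by rewrite (rt_up (ok_acyclic y1ok) E).
  by rewrite !rt_root ?mpar_l ?E.
- rewrite /cpar /= in ac IH.
  by rewrite (rt_up ac (mpar_S j b)) IH ?mpar_S.
by rewrite rt_root ?mpar_N.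
Qed.

Lemma model_forb : forb mphi (inr (ord0, None)) =
  [set (inr (j, None) : mcarrier) | j in [set: 'I_m.+1]]%SET.
Proof.
apply/setP => q; apply/forbP/imsetP => [[n ->]|[j _ ->]]; last first.
  by exists j; rewrite rot_iter_ord.
elim: n => [|n [j _ jE]]; first by exists ord0.
rewrite iterS jE mphi_r /mrot /=; case: eqP => _.
  by exists ord0; rewrite ?in_setT.
by exists (inord j.+1); rewrite ?in_setT.
Qed.

End Model.

(** * Cycles of trees in a forest and the labellings of the model *)

Section MarkedOrbits.
Local Open Scope nat_scope.

Lemma iter_mod (T : Type) (f : T -> T) j t r :
  iter j f r = r -> iter t f r = iter (t %% j) f r.
Proof.
move=> jr; rewrite {1}(divn_eq t j) addnC iterD; congr (iter _ _ _).
by elim: (t %/ j) => //= q IH; rewrite mulSn iterD IH.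
Qed.

Lemma card_forb_min (T : finType) (f : T -> T) j r :
  0 < j -> iter j f r = r -> #|forb f r| <= j.
Proof.
move=> j0 jr.
have -> : j = #|[set: 'I_j]%SET| by rewrite cardsT card_ord.
apply: leq_trans (leq_imset_card (fun t : 'I_j => iter t f r) _).
apply: subset_leq_card; apply/fintype.subsetP => _ /forbP[t ->].
apply/imsetP; exists (Ordinal (ltn_pmod t j0)); rewrite ?in_setT //=.
exact: iter_mod.
Qed.

Section MarkedOrbit.
Variables (K S : finType) (sg : K -> K) (I : {set K}) (x : code K S).
Hypothesis xok : code_ok sg I x.
Variables (m b : nat) (r : S).

Local Notation phi := (cphi x).
Local Notation root_of := (rt (cpar x)).

(** The shift by one matches the model: there are [m.+1] copies, each made of a root and [b] other
    vertices. *)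
Definition marked : bool :=
  [&& cpar x r == None, #|forb phi r| == m.+1 & #|[set v | root_of v == r]%SET| == b.+1].

Hypothesis mk : marked.

Let phiI : injective phi := ok_inj xok.
Let tree : {set S} := [set v | root_of v == r]%SET.

Lemma marked_par : cpar x r = None. Proof. by case/and3P: mk => /eqP. Qed.
Lemma marked_card : #|tree| = b.+1. Proof. by case/and3P: mk => _ _ /eqP. Qed.

Lemma marked_iter : iter m.+1 phi r = r.
Proof.
case/and3P: mk => _ /eqP <- _.
have -> : #|forb phi r| = fingraph.order phi r by rewrite /fingraph.order cardsE.
exact: iter_order.
Qed.

Lemma marked_min j : 0 < j -> iter j phi r = r -> m.+1 <= j.
Proof. by case/and3P: mk => _ /eqP <- _; exact: card_forb_min. Qed.

Lemma marked_iter_inj i j : i < m.+1 -> j < m.+1 -> iter i phi r = iter j phi r -> i = j.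
Proof.
have aux i' j' : i' <= j' -> j' < m.+1 -> iter i' phi r = iter j' phi r -> i' = j'.
  move=> ij jm; rewrite -{1}(subnKC ij) iterD => /(iter_inj phiI)/esym/marked_min ji.
  apply/eqP; rewrite eqn_leq ij -subn_eq0 /= -leqn0 leqNgt.
  by apply/negP => /ji; rewrite leqNgt ltnS (leq_trans (leq_subr _ _)).
move=> im jm ij; case: (leqP i j) => [|/ltnW] le; first exact: aux.
by apply/esym; apply: aux.
Qed.

Definition outside : {set S} := [set v | root_of v \notin forb phi r]%SET.

Lemma tree_iter_inj i j v w : i < m.+1 -> j < m.+1 -> root_of v = r -> root_of w = r ->
  iter i phi v = iter j phi w -> i = j /\ v = w.
Proof.
move=> im jm rv rw vw; have ij : i = j.
  apply: marked_iter_inj => //; rewrite -{1}rv -rw.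
  by rewrite -!(ok_rt_iter xok) vw.
by split=> //; move: vw; rewrite ij => /(iter_inj phiI).
Qed.

(** The complement of [outside] is the disjoint union of the images of the tree of [r] under the
    iterates of [phi] below [m.+1]. *)
Lemma card_outside : #|outside| + m.+1 * b.+1 = #|S|.
Proof.
pose F (t : 'I_m.+1 * S) := iter t.1 phi t.2.
have E : (~: outside = F @: setX [set: 'I_m.+1] tree)%SET.
  apply/setP => v; rewrite !inE negbK; apply/idP/imsetP.
    move=> vr.
    have /forbP[t rvt] : root_of v \in forb phi r by rewrite inE.
    have [j jm jt] : exists2 j, j < m.+1 & root_of v = iter j phi r.
      exists (t %% m.+1); first exact: ltn_pmod.
      by rewrite rvt; apply: iter_mod; exact: marked_iter.
    have vE : iter j phi (iter j (finv phi) v) = v.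
      elim: (j) => //= n IH; rewrite -[LHS]/(iter n.+1 phi _) iterSr (f_finv phiI).
      exact: IH.
    exists (Ordinal jm, iter j (finv phi) v) => //.
    rewrite in_setX in_setT inE /=; apply/eqP/(iter_inj (n := j) phiI).
    by rewrite -(ok_rt_iter xok) vE.
  move=> [[j w] /setXP[_]]; rewrite inE => /eqP wr ->.
  rewrite (ok_rt_iter xok) /= wr; exact: fconnect_iter.
rewrite -(cardsC outside) E card_in_imset ?cardsX ?cardsT ?card_ord ?marked_card //.
move=> [i v] [j w] /setXP[_]; rewrite inE => /eqP rv /setXP[_]; rewrite inE => /eqP rw.
rewrite /F /= => /tree_iter_inj[] // ij ->; congr (_, _); exact: val_inj.
Qed.

End MarkedOrbit.

Section Count.
Variables (K A B S : finType) (m : nat) (sg : K -> K) (I : {set K}) (i : K).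
Hypotheses (sgI : injective sg) (Ist : {in I, forall l, sg l \in I}).
Hypotheses (iI : i \in I) (sgi : iter m.+1 sg i = i).
Hypothesis cardS : #|S| = #|A| + m.+1 * #|B|.+1.

Local Notation Q := (mcarrier A B m).
Local Notation sgn := (iter m.+1 sg).

Definition model_rel (h : {ffun Q -> S}) (x : code K S) : Prop :=
  exists y1 y2, [/\ code_ok sg I y1, code_ok sgn (~: [set i])%SET y2 &
    code_iso h (model m sg i y1 y2) x].

Lemma card_mcarrier : #|{: Q}| = #|S|.
Proof. by rewrite card_sum card_prod card_ord card_option cardS. Qed.

Lemma inj_bij (h : {ffun Q -> S}) : injective h -> bijective h.
Proof. by move=> hI; apply: inj_card_bij => //; rewrite card_mcarrier. Qed.

Definition r0 : Q := inr (ord0, None).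

Lemma model_rel_ok (h : {ffun Q -> S}) x : injective h -> model_rel h x -> code_ok sg I x.
Proof.
move=> /inj_bij hB [y1 [y2 [y1ok y2ok]]] hi; apply: iso_ok hB hi _.
exact: model_ok.
Qed.

Lemma model_rel_marked (h : {ffun Q -> S}) x : injective h -> model_rel h x ->
  marked x m #|B| (h r0) && (ccol x (h r0) == i).
Proof.
move=> hI hx; have xok := model_rel_ok hI hx; have hB := inj_bij hI.
case: hx => y1 [y2 [y1ok y2ok hi]].
have mok := model_ok y1ok y2ok sgI Ist iI sgi.
case: (hi) => i1 i2 i3; rewrite i3 [ccol _ _]mcol_N /= eqxx andbT.
apply/and3P; split.
- by rewrite i2 [cpar _ _]mpar_N.
- have -> : forb (cphi x) (h r0) = (h @: forb (mphi m y1 y2) r0)%SET.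
    apply: (@forb_imset _ _ (mphi m y1 y2) (cphi x) h [set: Q]%SET) => [q _|q _|]; rewrite ?in_setT //.
  rewrite card_imset // model_forb card_imset ?cardsT ?card_ord //.
  by move=> j j' [].
apply/eqP; pose g (o : option B) : S := h (inr (ord0, o)).
have gI : injective g by move=> o o' /hI [].
transitivity #|(g @: [set: option B])%SET|; last first.
  by rewrite card_imset // cardsT card_option.
apply: eq_card => v; rewrite inE; case: hB => h' hK h'K.
rewrite -[v]h'K (iso_rt _ hi mok xok) (inj_eq hI) [rt _ _](model_rt y1ok y2ok sgI Ist iI sgi).
apply/eqP/imsetP => [|[o _]].
  case: (h' v) => [a|[j o]] // [->].
  by exists o; rewrite ?in_setT.
by move/hI => ->.
Qed.

Section Fiber.
Variables (x : code K S) (r : S).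
Hypotheses (xok : code_ok sg I x) (mk : marked x m #|B| r) (ci : ccol x r = i).

Local Notation phi := (cphi x).
Local Notation root_of := (rt (cpar x)).
Let phiI : injective phi := ok_inj xok.
Let ac := ok_acyclic xok.
Let Out := outside x r.
Let Tr : {set S} := ([set v | root_of v == r] :\ r)%SET.

Lemma card_Out : #|Out| = #|A|.
Proof. by have := card_outside xok mk; rewrite cardS => /addIn. Qed.

Lemma card_Tr : #|Tr| = #|B|.
Proof.
have := marked_card mk.
by rewrite (cardsD1 r) inE (rt_root (marked_par mk)) eqxx add1n => -[].
Qed.

Lemma TrP v : reflect (root_of v = r /\ v != r) (v \in Tr).
Proof.
by rewrite !inE andbC; apply: (iffP andP) => -[/eqP].
Qed.

Definition fiber : {set {ffun Q -> S}} :=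
  [set h : {ffun Q -> S} | [&& injectiveb h, `[< model_rel h x >] & h r0 == r]]%SET.

Definition fiber_split (h : {ffun Q -> S}) : {ffun A -> S} * {ffun B -> S} :=
  ([ffun a => h (inl a)], [ffun o => h (inr (ord0, Some o))]).

Lemma model_rel_iter (h : {ffun Q -> S}) (j : 'I_m.+1) o : model_rel h x ->
  h (inr (j, o)) = iter j phi (h (inr (ord0, o))).
Proof.
case=> y1 [y2 [y1ok y2ok [i1 i2 i3]]]; rewrite -(rot_iter_ord y1 y2 j o).
by elim: (nat_of_ord j) => //= n <-; rewrite i1.
Qed.

Lemma fiber_split_inj : {in fiber &, injective fiber_split}.
Proof.
move=> h h'; rewrite !inE => /and3P[_ /asboolP hx /eqP hr] /and3P[_ /asboolP hx' /eqP hr'].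
move=> [/ffunP e1 /ffunP e2]; apply/ffunP => -[a|[j o]].
  by have := e1 a; rewrite !ffunE.
rewrite (model_rel_iter j o hx) (model_rel_iter j o hx'); congr (iter _ _ _).
case: o => [o|]; last by rewrite -/r0 hr hr'.
by have := e2 o; rewrite !ffunE.
Qed.

Definition inj_into (T : finType) (R : {set S}) : {set {ffun T -> S}} :=
  [set f : {ffun T -> S} in ffun_on R | injectiveb f]%SET.

Lemma fiber_split_sub h : h \in fiber ->
  fiber_split h \in setX (inj_into A Out) (inj_into B Tr).
Proof.
rewrite inE => /and3P[/injectiveP hI /asboolP hx /eqP hr].
case: (hx) => y1 [y2 [y1ok y2ok hi]].
have mok := model_ok y1ok y2ok sgI Ist iI sgi.
have rtE q := iso_rt q hi mok xok.
rewrite in_setX !inE /= -andbA; apply/and4P; split.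
- apply/ffun_onP => a; rewrite ffunE inE rtE [rt _ _](model_rt y1ok y2ok sgI Ist iI sgi).
  apply/negP => /forbP[n].
  have -> : iter n phi r = h (iter n (mphi m y1 y2) r0).
    by elim: n => //= n ->; case: hi => ->.
  move=> /hI; have /forbP: exists n', iter n (mphi m y1 y2) r0 = iter n' (mphi m y1 y2) r0.
    by exists n.
  by rewrite model_forb => /imsetP[j _ ->].
- by apply/injectiveP => a a'; rewrite !ffunE => /hI [].
- apply/ffun_onP => o; rewrite ffunE; apply/TrP.
  by rewrite rtE [rt _ _](model_rt y1ok y2ok sgI Ist iI sgi) -hr (inj_eq hI).
- by apply/injectiveP => a a'; rewrite !ffunE => /hI [].
Qed.

Lemma inj_into_surj (T : finType) (R : {set S}) f v : #|R| = #|T| ->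
  f \in inj_into T R -> v \in R -> exists t, f t = v.
Proof.
move=> RT; rewrite inE => /andP[/ffun_onP fR /injectiveP fI] vR.
have : (f @: [set: T] == R)%SET.
  rewrite eqEcard card_imset // cardsT RT leqnn andbT.
  by apply/fintype.subsetP => _ /imsetP[t _ ->].
by move/eqP/setP/(_ v); rewrite vR => /imsetP[t _ ->]; exists t.
Qed.

Lemma fiber_split_onto p : p \in setX (inj_into A Out) (inj_into B Tr) ->
  exists2 h, h \in fiber & p = fiber_split h.
Proof.
case: p => al be /setXP[/= alP beP].
have alS v : v \in Out -> exists a, al a = v by apply: inj_into_surj alP; exact: card_Out.
have beS v : v \in Tr -> exists a, be a = v by apply: inj_into_surj beP; exact: card_Tr.
have [/ffun_onP alO /injectiveP alI] : al \in ffun_on Out /\ injectiveb al.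
  by move: alP; rewrite inE => /andP.
have [/ffun_onP beO /injectiveP beI] : be \in ffun_on Tr /\ injectiveb be.
  by move: beP; rewrite inE => /andP.
have beT o : root_of (be o) = r /\ be o != r by apply/TrP.
pose beh (o : option B) := odflt r (omap be o).
have behT o : root_of (beh o) = r.
  by case: o => [o|] /=; [case: (beT o)|rewrite rt_root ?(marked_par mk)].
have behI : injective beh.
  move=> [o|] [o'|] //=; first by move/beI ->.
    by rewrite /beh /= => e; case: (beT o); rewrite e eqxx.
  by rewrite /beh /= => e; case: (beT o'); rewrite -e eqxx.
have behS v : root_of v = r -> exists o, beh o = v.
  move=> vr; have [->|nr] := eqVneq v r; first by exists None.
  have /beS[o <-] : v \in Tr by apply/TrP.
  by exists (Some o).
pose h : {ffun Q -> S} := [ffun q : Q => match q with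
  | inl a => al a | inr (j, o) => iter j phi (beh o) end].
have hl a : h (inl a) = al a by rewrite ffunE.
have hr (j : 'I_m.+1) o : h (inr (j, o)) = iter j phi (beh o) by rewrite ffunE.
have outP v : v \in Out -> root_of v \notin forb phi r by rewrite inE.
have hI : injective h.
  have lr a (j : 'I_m.+1) o : al a <> iter j phi (beh o).
    move=> e; have /outP := alO a; rewrite e (ok_rt_iter xok) behT => /negP; apply.
    by apply/forbP; exists j.
  move=> [a|[j o]] [a'|[j' o']]; rewrite ?hl ?hr.
  - by move/alI ->.
  - by move/lr.
  - by move/esym/lr.
  move=> /(tree_iter_inj xok mk (ltn_ord j) (ltn_ord j') (behT o) (behT o')).
  by case=> /val_inj -> /behI ->.
exists h; last by rewrite /fiber_split; congr (_, _); apply/ffunP => t; rewrite !ffunE.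
have frt a : exists a', al a' = phi (al a).
  apply: alS; rewrite inE (ok_rt xok); apply/negP => /forbP[n nE].
  have /negP := outP _ (alO a); apply.
  have : phi (root_of (al a)) \in forb phi r by apply/forbP; exists n.
  rewrite !inE => rc; rewrite (connect_trans rc) // fconnect_sym //.
  exact: fconnect1.
have prt a : exists o, cpar x (al a) = omap al o.
  case E: (cpar x (al a)) => [w|]; last by exists None.
  have /alS[a' <-] : w \in Out.
    by have := alO a; rewrite !inE (rt_up ac E).
  by exists (Some a').
have fbe o : exists o', be o' = iter m.+1 phi (be o).
  apply: beS; apply/TrP; rewrite (ok_rt_iter xok); case: (beT o) => -> br.
  rewrite (marked_iter xok mk); split=> //.
  by rewrite -(marked_iter xok mk) (inj_eq (iter_inj (n := m.+1) phiI)).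
have pbe o : exists o', cpar x (be o) = Some (beh o').
  case: (beT o) => rb nb; case E: (cpar x (be o)) => [w|]; last first.
    by move: nb; rewrite -rb rt_root // eqxx.
  have [o' <-] : exists o', beh o' = w by apply: behS; rewrite -(rt_up ac E).
  by exists o'.
(* The code [x] restricts to the outside and, with [iter m.+1 phi] in place of [phi], to the marked
   tree without its root. Pulled back along [al] and [be], these restrictions are the two codes of
   the model; the parent [None] in [y2] stands for the marked root. *)
have [f1 f1P] := choice frt; have [p1 p1P] := choice prt.
have [f2 f2P] := choice fbe; have [p2 p2P] := choice pbe.
pose y1 : code K A := (finfun f1, (finfun p1, [ffun a => ccol x (al a)])).
pose y2 : code K B := (finfun f2, (finfun p2, [ffun a => ccol x (be a)])).
have [rk rkP] := ok_acyclic xok.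
rewrite inE; apply/and3P; split; first by apply/injectiveP.
  apply/asboolP; exists y1, y2; split.
  - split; rewrite /y1 /cphi /cpar /ccol /=.
    + by move=> a a'; rewrite !ffunE => /(congr1 al); rewrite !f1P => /phiI/alI.
    + exists (rk \o al) => a a'; rewrite ffunE => e; apply: rkP.
      by rewrite p1P e.
    + by move=> a; rewrite !ffunE => e; apply: (ok_root xok); rewrite p1P e.
    + by move=> a a'; rewrite !ffunE => e; apply: (ok_proper xok); rewrite p1P e.
    + move=> a; rewrite !ffunE; have := ok_par xok (al a).
      rewrite -f1P !p1P; case: (p1 (f1 a)) (p1 a) => [a1|] [a2|] //= [].
      by rewrite ffunE -f1P => /alI ->.
    + by move=> a; rewrite !ffunE f1P (ok_col xok).
  - split; rewrite /y2 /cphi /cpar /ccol /=.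
    + by move=> a a'; rewrite !ffunE => /(congr1 be); rewrite !f2P => /(iter_inj (n := m.+1) phiI)/beI.
    + exists (rk \o be) => a a'; rewrite ffunE => e; apply: rkP.
      by rewrite p2P e.
    + move=> a; rewrite !ffunE => e; rewrite !inE -ci; apply: (ok_proper xok).
      by rewrite p2P e.
    + by move=> a a'; rewrite !ffunE => e; apply: (ok_proper xok); rewrite p2P e.
    + move=> a; rewrite !ffunE; have := ok_par_iter xok m.+1 (be a).
      rewrite -f2P !p2P /= => -[].
      case: (p2 (f2 a)) (p2 a) => [a1|] [a2|] //=.
      * by rewrite -[phi _]/(iter m.+1 phi _) -f2P ffunE => /beI ->.
      * rewrite -[phi _]/(iter m.+1 phi _) (marked_iter xok mk) /beh /= => e.
        by case: (beT a1); rewrite e eqxx.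
      * rewrite -[phi _]/(iter m.+1 phi _) -f2P /beh /= => e.
        by case: (beT (f2 a2)); rewrite -e eqxx.
    + by move=> a; rewrite !ffunE f2P (ok_col_iter xok).
  split; rewrite /cphi /cpar /ccol /=.
  - move=> [a|[j o]]; rewrite ?mphi_l ?mphi_r.
      by rewrite !hl -f1P /cphi /= ffunE.
    rewrite /mrot /=; case: (eqVneq j ord_max) => [->|jm] /=; last by rewrite !hr inord_S.
    rewrite !hr -[LHS]/(iter m.+1 phi _) /cphi /=; case: o => [o|] /=.
      by rewrite ffunE /beh /= f2P.
    by rewrite /beh /=; have := marked_iter xok mk.
  - move=> [a|[j [o|]]]; rewrite ?mpar_l ?mpar_S ?mpar_N.
    + by rewrite hl p1P /cpar /= ffunE; case: (p1 a) => //= a'; rewrite hl.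
    + rewrite hr (ok_par_iter xok) p2P /= hr; congr (Some (iter _ _ (beh _))).
      by rewrite /cpar /= ffunE.
    + by rewrite hr (ok_par_iter xok) /= (marked_par mk).
  - move=> [a|[j [o|]]]; rewrite ?mcol_l ?mcol_S ?mcol_N.
    + by rewrite hl /ccol /= ffunE.
    + by rewrite hr (ok_col_iter xok) /ccol /= ffunE.
    + by rewrite hr (ok_col_iter xok) /= ci.
by rewrite hr.
Qed.

(** A labelling is determined by its values on [A] and on copy [0] of [B], the other copies being
    reached by the iterates of [cphi x]. Any bijections onto the outside and onto the marked tree
    without its root are allowed. *)
Lemma card_fiber : #|fiber| = (#|A|)`! * (#|B|)`!.
Proof.
rewrite -(card_in_imset fiber_split_inj).
have -> : (fiber_split @: fiber)%SET = setX (inj_into A Out) (inj_into B Tr).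
  apply/setP => p; apply/imsetP/idP; first by move=> [h hf ->]; exact: fiber_split_sub.
  by move=> /fiber_split_onto[h hf ->]; exists h.
by rewrite cardsX !card_inj_ffuns_on card_Out card_Tr !ffactnn.
Qed.

End Fiber.
End Count.

End MarkedOrbits.

Section MarkedSum.
Variables (K A B S : finType) (m : nat) (sg : K -> K) (I : {set K}) (i : K).
Hypotheses (sgI : injective sg) (Ist : {in I, forall l, sg l \in I}).
Hypotheses (iI : i \in I) (sgi : iter m.+1 sg i = i).
Hypothesis cardS : (#|S| = #|A| + m.+1 * #|B|.+1)%N.

Local Notation Q := (mcarrier A B m).
Local Notation sgn := (iter m.+1 sg).

Let pair_ok (p : code K A * code K B) : bool :=
  `[< code_ok sg I p.1 >] && `[< code_ok sgn (~: [set i])%SET p.2 >].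

Lemma model_inj (p q : code K A * code K B) :
  model m sg i p.1 p.2 = model m sg i q.1 q.2 -> p = q.
Proof.
case: p q => [[f1 [p1 c1]] [f2 [p2 c2]]] [[f1' [p1' c1']] [f2' [p2' c2']]] [].
move=> /ffunP ef /ffunP ep /ffunP ec.
congr ((_, (_, _)), (_, (_, _))); apply/ffunP => a.
- by have := ef (inl a); rewrite !mphi_l => -[].
- by have := ep (inl a); rewrite !mpar_l /cpar /=; case: (p1 a) (p1' a) => [?|] [?|] //= [->].
- by have := ec (inl a); rewrite !mcol_l.
- have := ef (inr (ord_max, Some a)); rewrite !mphi_r /mrot /= eqxx.
  by move=> -[].
- by have := ep (inr (ord0, Some a)); rewrite !mpar_S => -[].
- by have := ec (inr (ord0, Some a)); rewrite !mcol_S.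
Qed.

Lemma sum_model_rel (h : {ffun Q -> S}) : injective h ->
  \sum_(x : code K S | `[< model_rel sg I i h x >]) code_wt sg x =
  \sum_(p | pair_ok p) code_wt sg (model m sg i p.1 p.2).
Proof.
move=> hI; have hB := inj_bij cardS hI.
have [tr trP] := choice (fun y => @iso_tr K _ _ h y hB).
pose T (p : code K A * code K B) := tr (model m sg i p.1 p.2).
have -> : \sum_(p | pair_ok p) code_wt sg (model m sg i p.1 p.2) =
    \sum_(p in [set p | pair_ok p]%SET) code_wt sg (T p).
  apply: eq_big => p; first by rewrite inE.
  move=> /andP[/asboolP p1 /asboolP p2]; apply/esym.
  exact: (iso_wt sgI hB (trP _) (model_ok p1 p2 sgI Ist iI sgi)).
have TI : {in [set p | pair_ok p]%SET &, injective T}.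
  move=> p q _ _ pq; apply: (@model_inj p q).
  by apply: (iso_uniq_l hI (trP _)); rewrite -/(T p) pq.
rewrite -[RHS](big_imset (code_wt sg) TI) /=.
apply: eq_bigl => x; apply/asboolP/imsetP.
  move=> [y1 [y2 [y1ok y2ok hi]]]; exists (y1, y2).
    by rewrite inE; apply/andP; split; apply/asboolP.
  exact: iso_uniq_r hB hi (trP _).
move=> [[y1 y2]]; rewrite inE => /andP[/asboolP p1 /asboolP p2] ->.
by exists y1, y2; split=> //; exact: trP.
Qed.

(** Double counting of the pairs made of a bijection [h] from the carrier of the model to [S] and a
    code obtained along [h]. For fixed [h] the codes correspond to the pairs [(y1, y2)]; for a fixed
    code and marked root, [card_fiber] counts the bijections. *)
Lemma marked_sum :
  (\sum_(x : code K S | `[< code_ok sg I x >])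
    \sum_(r | marked x m #|B| r && (ccol x r == i)) code_wt sg x) *+ ((#|A|)`! * (#|B|)`!) =
  (\sum_(p | pair_ok p) code_wt sg (model m sg i p.1 p.2)) *+ (#|S|)`!.
Proof.
have cE : #|[pred h : {ffun Q -> S} | injectiveb h]| = (#|S|)`!.
  have := card_inj_ffuns Q S; rewrite (card_mcarrier cardS) ffactnn => <-.
  by apply: eq_card => h; rewrite !inE.
rewrite -cE -sumr_const /=.
rewrite (eq_bigr (fun h : {ffun Q -> S} =>
  \sum_(x : code K S | `[< model_rel sg I i h x >]) code_wt sg x)); last first.
  by move=> h /injectiveP hI; rewrite sum_model_rel.
rewrite (exchange_big_dep (fun x : code K S => `[< code_ok sg I x >])) /=; last first.
  by move=> h x /injectiveP hI /asboolP hx; apply/asboolP; exact: model_rel_ok hx.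
rewrite -sumrMnl; apply: eq_bigr => x /asboolP xok.
rewrite -sumrMnl.
rewrite (partition_big (fun h : {ffun Q -> S} => h (r0 A B m))
   (fun r => marked x m #|B| r && (ccol x r == i))) /=; last first.
  by move=> h /andP[/injectiveP hI /asboolP]; exact: model_rel_marked.
apply: eq_bigr => r /andP[mk /eqP ci].
rewrite -(card_fiber sgI Ist iI sgi cardS xok mk ci) -sumr_const.
by apply: eq_bigl => h; rewrite inE -andbA.
Qed.

End MarkedSum.

(** * Exponential generating series of forests *)

Section ForestSeries.
Variable K : finType.
Implicit Types (sg : K -> K) (I : {set K}).

Definition forest_sum s sg I : series :=
  (s`!%:R : rat)^-1 *: \sum_(x : code K 'I_s | `[< code_ok sg I x >]) code_wt sg x.

Definition forestF sg I : series := gsum (fun s => forest_sum s sg I).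

(** The weight of the hedron created by a vertex of colour [i], with its new fronts. Here [sg]
    stands for the return map on the colours, which fixes [i]. *)
Definition branch_root sg (i : K) : series := px 1 * cyc py sg (~: [set i])%SET.

Lemma homog_forest_sum s sg I : homog xvar s (forest_sum s sg I).
Proof.
apply: homog_scale; apply: homog_sum => x /asboolP xok.
by have := homog_code_wt xok; rewrite card_ord.
Qed.

Lemma homog_branch_root sg i : homog xvar 1 (branch_root sg i).
Proof. exact: (homog_mul (homog_px (ltn0Sn 0)) (homog_cycy _ _)). Qed.

Lemma sum_pair_mul (A B : finType) (P : pred A) (R : pred B) (F : A -> series) (G : B -> series) :
  \sum_(p | P p.1 && R p.2) F p.1 * G p.2 = (\sum_(a | P a) F a) * (\sum_(b | R b) G b).
Proof.
rewrite big_distrlr /= [LHS](eq_bigl (fun p : A * B => P p.1 && R p.2)) //.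
by rewrite (pair_big_dep P (fun _ b => R b) (fun a b => F a * G b)).
Qed.

(* Mark a vertex: its tree has [b.+1] vertices and a root of colour [i], and lies in a cycle of
   [m.+1] isomorphic trees, whose removal leaves a smaller forest. *)
Lemma forest_sum_rec N sg I : injective sg -> {in I, forall l, sg l \in I} ->
  N%:R *: forest_sum N sg I =
  \sum_(m < N.+1) \sum_(i in I | iter m.+1 sg i == i) \sum_(b < N.+1 | (m.+1 * b.+1 <= N)%N)
    b.+1%:R *: (forest_sum (N - m.+1 * b.+1) sg I *
      dil m.+1 (branch_root (iter m.+1 sg) i * forest_sum b (iter m.+1 sg) (~: [set i])%SET)).
Proof.
move=> sgI Ist.
pose M m b i := \sum_(x : code K 'I_N | `[< code_ok sg I x >])
    \sum_(r | marked x m b r && (ccol x r == i)) code_wt sg x.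
(* Each code is counted once for every vertex [v]. The root of the tree of [v] determines [m], [i]
   and [b], and it is the root of exactly [b.+1] vertices. *)
have E1 : N%:R *: \sum_(x : code K 'I_N | `[< code_ok sg I x >]) code_wt sg x =
    \sum_(m < N.+1) \sum_i \sum_(b < N.+1) b.+1%:R *: M m b i.
  rewrite scaler_sumr.
  under [RHS]eq_bigr => m _ do (under eq_bigr => i _ do
    (under eq_bigr => b _ do rewrite /M scaler_sumr; rewrite exchange_big /=);
    rewrite exchange_big /=).
  rewrite exchange_big /=; apply: eq_bigr => x /asboolP xok.
  rewrite scaler_nat.
  have -> : code_wt sg x *+ N = \sum_(v : 'I_N) code_wt sg x by rewrite sumr_const card_ord.
  rewrite (partition_big (rt (cpar x)) (fun r => cpar x r == None)) /=; last first.
    by move=> v _; apply/eqP; exact: rt_is_root (ok_acyclic xok).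
  under [RHS]eq_bigr => m _ do (under eq_bigr => i _ do
    (under eq_bigr => b _ do (rewrite scaler_sumr big_mkcond /=); rewrite exchange_big /=);
    rewrite exchange_big /=).
  rewrite exchange_big /= big_mkcond /=; apply: eq_bigr => r _.
  case: ifP => rr; last first.
    by apply/esym; rewrite big1 // => m _; rewrite big1 // => i _; rewrite big1 // => b _;
      rewrite /marked rr.
  have f1 : (0 < #|forb (cphi x) r| <= N)%N.
    rewrite card_gt0 -[X in (_ <= X)%N](card_ord N) max_card andbT.
    by apply/set0Pn; exists r; exact: forb_refl.
  have t1 : (0 < #|[set v | rt (cpar x) v == r]%SET| <= N)%N.
    rewrite card_gt0 -[X in (_ <= X)%N](card_ord N) max_card andbT.
    by apply/set0Pn; exists r; rewrite inE rt_root //; apply/eqP.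
  have fm : (#|forb (cphi x) r|.-1 < N.+1)%N by lia.
  have tm : (#|[set v | rt (cpar x) v == r]%SET|.-1 < N.+1)%N by lia.
  rewrite (bigD1 (Ordinal fm)) //= [X in _ = _ + X]big1 ?addr0; last first.
    move=> m nm; rewrite big1 // => i _; rewrite big1 // => b _; case: ifP => //.
    move=> /andP[/and3P[_ /eqP fr _] _]; case/negP: nm; apply/eqP/val_inj => /=.
    by rewrite fr.
  rewrite (bigD1 (ccol x r)) //= [X in _ = _ + X]big1 ?addr0; last first.
    move=> i ni; rewrite big1 // => b _; case: ifP => // /andP[_ ci].
    by move: ni; rewrite eq_sym ci.
  rewrite (bigD1 (Ordinal tm)) //= [X in _ = _ + X]big1 ?addr0; last first.
    move=> b nb; case: ifP => //.
    move=> /andP[/and3P[_ _ /eqP fr] _]; case/negP: nb; apply/eqP/val_inj => /=.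
    by rewrite fr.
  have [/andP[f0 _] /andP[t0 _]] := (f1, t1).
  rewrite /marked rr eqxx andbT (prednK f0) (prednK t0) !eqxx /=.
  rewrite scaler_nat -sumr_const; apply: eq_bigl => v; by rewrite inE.
rewrite {1}/forest_sum scalerA mulrC -scalerA E1 scaler_sumr.
apply: eq_bigr => m _; rewrite scaler_sumr [RHS]big_mkcond /=; apply: eq_bigr => i _.
(* A marked root has a colour in [I] fixed by [iter m.+1 sg], and [m.+1] disjoint trees with [b.+1]
   vertices must fit into [N] vertices; all other terms vanish. *)
have M0 b : M m b i <> 0 -> [/\ i \in I, iter m.+1 sg i == i & (m.+1 * b.+1 <= N)%N].
  move=> nz; have [//|nP] := pselect [/\ i \in I, iter m.+1 sg i == i & (m.+1 * b.+1 <= N)%N].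
  case: nz; rewrite /M big1 // => x /asboolP xok; rewrite big1 // => r /andP[mk /eqP ci].
  case: nP; split.
  - by rewrite -ci; apply: (ok_root xok); exact: marked_par mk.
  - by rewrite -ci -(ok_col_iter xok) (marked_iter xok mk).
  - by have := card_outside xok mk; rewrite card_ord => cN; rewrite -[leqRHS]cN leq_addl.
case: ifP => [/andP[iI /eqP sgi]|ni]; last first.
  rewrite big1 ?scaler0 // => b _.
  have [->|/M0[iI sgi _]] := pselect (M m b i = 0); first by rewrite scaler0.
  by move: ni; rewrite iI sgi.
rewrite scaler_sumr [RHS]big_mkcond /=; apply: eq_bigr => b _.
case: ifP => [bN|nb]; last first.
  have [->|/M0[_ _]] := pselect (M m b i = 0); first by rewrite !scaler0.
  by rewrite nb.
have cS : (#|'I_N| = #|'I_(N - m.+1 * b.+1)| + m.+1 * #|'I_b|.+1)%N.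
  by rewrite !card_ord subnK.
have := marked_sum sgI Ist iI sgi cS; rewrite !card_ord -/(M m b i) => ME.
rewrite scalerA mulrC -scalerA; congr (_ *: _).
have fN n : (n`!%:R : rat) != 0 by rewrite pnatr_eq0 -lt0n fact_gt0.
apply: (@scalerI _ _ ((N - m.+1 * b.+1)`! * b`!)%:R); first by rewrite natrM mulf_neq0.
rewrite scalerA mulrC -scalerA scaler_nat ME -scaler_nat scalerA mulVf // scale1r.
pose D y2 := dil m.+1 (branch_root (iter m.+1 sg) i * code_wt (iter m.+1 sg) y2).
rewrite (eq_bigr (fun p : code K 'I_(N - m.+1 * b.+1) * code K 'I_b =>
   code_wt sg p.1 * D 'I_b p.2)); last first.
  move=> [y1 y2] /= /andP[/asboolP p1 /asboolP p2]; exact: (model_wt p1 p2 sgI Ist iI sgi).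
rewrite (sum_pair_mul (fun y1 => `[< code_ok sg I y1 >])
  (fun y2 => `[< code_ok (iter m.+1 sg) (~: [set i])%SET y2 >]) (code_wt sg) (D 'I_b)).
rewrite -scalerAl scalerA natrM mulrAC mulfV // mul1r -scale_mulr.
congr (_ * _); rewrite /D -(dil_sum _ _ _ (ltn0Sn m)) -mulr_sumr scale_mulr (dil_scale _ _ (ltn0Sn m)).
by rewrite scalerA mulfV // scale1r.
Qed.

End ForestSeries.

(** * The functional equation of forest series *)

Section ForestEquation.
Variable K : finType.
Implicit Types (sg : K -> K) (I : {set K}).

Definition branch sg (i : K) : series := branch_root sg i * forestF sg (~: [set i])%SET.

(** The contribution to the logarithm of the cycles of [n] trees: the colour of a root must be fixed
    by [iter n sg]. When [I] is one fixed colour, this is a term of the exponent in the definition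
    of Z_Y. *)
Definition expo_term n sg I : series :=
  (n%:R : rat)^-1 *: \sum_(i in I | iter n sg i == i) dil n (branch (iter n sg) i).

(** The sum over all positive [n], cut at the [x]-degree of [u] because [expo_term n] has [x]-order
    at least [n]. *)
Definition expo sg I : series := fun u => \sum_(n < (xw u).+1 | (0 < n)%N) (expo_term n sg I u : rat).

Lemma xlow_branch sg i : xlow 1 (branch sg i).
Proof.
rewrite -[1%N]addn0; apply: xlow_mul => //; apply: xlow_homog; exact: homog_branch_root.
Qed.

Lemma xlow_expo_term n sg I : (0 < n)%N -> xlow n (expo_term n sg I).
Proof.
move=> n0; apply: xlow_scale; apply: xlow_sum => i _; apply: xlow_dil => //.
exact: xlow_branch.
Qed.

Lemma expoE N sg I u : (xw u < N)%N ->
  expo sg I u = (\sum_(n < N | (0 < n)%N) expo_term n sg I) u.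
Proof.
move=> uN; rewrite sumE /expo.
rewrite -(big_mkord (fun n => 0 < n)%N (fun n => expo_term n sg I u : rat)).
rewrite -(big_mkord (fun n => 0 < n)%N (fun n => expo_term n sg I u : rat)).
rewrite [RHS](big_cat_nat (n := (xw u).+1)) //= [X in _ = _ + X]big_nat_cond.
rewrite [X in _ = _ + X]big1 ?addr0 // => n /andP[/andP[un _] n0].
by apply: xlow_expo_term.
Qed.

Lemma xlow_expo sg I : xlow 1 (expo sg I).
Proof.
move=> u u1; rewrite (@expoE 1) // sumE big_mkcond big_ord1 /=.
by [].
Qed.

Lemma branchE sg i N u : (xw u <= N)%N ->
  xD (branch sg i) u =
  (\sum_(b < N.+1) b.+1%:R *: (branch_root sg i * forest_sum b sg (~: [set i])%SET)) u.
Proof.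
move=> uN; rewrite sumE /xD /branch /forestF.
rewrite (gsum_homogM _ (homog_branch_root sg i) (fun s => @homog_forest_sum K s _ _)).
have hb b : homog xvar b.+1 (branch_root sg i * forest_sum b sg (~: [set i])%SET).
  rewrite -add1n; apply: homog_mul; [exact: homog_branch_root|exact: homog_forest_sum].
have [u0|u0] := posnP (xw u).
  rewrite /= mulr0 big1 // => b _; rewrite scaleE hb ?mulr0 //.
  by rewrite u0.
have ub : ((xw u).-1 < N.+1)%N by lia.
rewrite (bigD1 (Ordinal ub)) //= big1 ?addr0 => [|b nb]; last first.
  rewrite scaleE hb ?mulr0 //; apply: contra nb => /eqP ue; apply/eqP/val_inj => /=.
  by rewrite ue.
by rewrite scaleE prednK // subn1.
Qed.

(** This is [forest_sum_rec] for all [N] at once. The factor [b.+1] there is the [x]-degree of a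
    branch with [b] vertices below its root ([branchE]), and the factor that the derivation produces
    on a dilation by [m.+1] cancels the inverse of [m.+1] in [expo_term]. *)
Lemma xD_forestF sg I : injective sg -> {in I, forall l, sg l \in I} ->
  xD (forestF sg I) = forestF sg I * xD (expo sg I).
Proof.
move=> sgI Ist; apply/funext => u; set N := xw u.
pose G : series := \sum_(m < N.+1) \sum_(i in I | iter m.+1 sg i == i) \sum_(b < N.+1)
  b.+1%:R *: dil m.+1 (branch_root (iter m.+1 sg) i * forest_sum b (iter m.+1 sg) (~: [set i])%SET).
have GE v : (xw v <= N)%N -> xD (expo sg I) v = G v.
  move=> vN; rewrite /xD (@expoE N.+2) ?ltnS ?(leqW vN) //.
  rewrite -[LHS]/(xD (\sum_(n < N.+2 | (0 < n)%N) expo_term n sg I) v) xD_sum.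
  rewrite big_mkcond big_ord_recl /= add0r /G !sumE; apply: eq_bigr => m _.
  rewrite /bump leq0n add1n /expo_term xD_scale xD_sum scaler_sumr !sumE; apply: eq_bigr => i _.
  rewrite xD_dil // scalerA mulVf ?scale1r ?pnatr_eq0 //.
  under eq_bigr do rewrite -(dil_scale _ _ (ltn0Sn m)).
  rewrite -(dil_sum _ _ _ (ltn0Sn m)).
  have [[w vw]|nv] := dil_case m.+1 v; last by rewrite !dil_out.
  rewrite vw !dilE //; apply: branchE.
  by apply: leq_trans vN; rewrite vw xw_dil // leq_pmull.
rewrite (@mul_cong _ (forestF sg I) _ G) // /G.
have := congr1 (fun f : series => f u) (forest_sum_rec N sgI Ist).
rewrite /= => E; rewrite -[LHS]/((N%:R *: forest_sum N sg I) u) E.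
rewrite mulr_sumr !sumE; apply: eq_bigr => m _.
rewrite mulr_sumr !sumE; apply: eq_bigr => i _.
rewrite mulr_sumr !sumE big_mkcond /=; apply: eq_bigr => b _.
have hd := homog_dil (ltn0Sn m) (homog_mul (homog_branch_root (iter m.+1 sg) i)
  (@homog_forest_sum K b (iter m.+1 sg) (~: [set i])%SET)).
set X := dil m.+1 _ in hd *; rewrite scale_mulr scaleE (mulrC (forestF sg I) X) /forestF.
rewrite (gsum_homogM _ hd (fun s => @homog_forest_sum K s _ _)) add1n.
by case: ifP => _; rewrite ?mulr0 // scaleE (mulrC X).
Qed.

Lemma forestF_xw0 sg I u : xw u = 0%N -> forestF sg I u = (1 : series) u.
Proof.
move=> u0; rewrite /forestF /gsum u0 /forest_sum fact0 invr1 scale1r.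
pose z : code K 'I_0 := ([ffun v => v], ([ffun v => None], ffun0 (card_ord 0))).
have zu (x : code K 'I_0) : x = z.
  by case: x => [f [p c]]; congr (_, (_, _)); apply/ffunP => -[].
rewrite (bigD1 z) /=; last first.
  apply/asboolP; split; try by case.
  by exists (fun=> 0%N) => -[].
rewrite big1 ?addr0 => [|x /andP[_]]; last by rewrite (zu x) eqxx.
rewrite /code_wt (_ : [set: 'I_0]%SET = finset.set0); last by apply/setP => -[].
rewrite (_ : code_fronts z = finset.set0); last by apply/setP => -[[]].
have e := congr2 *%R (cyc0 px (cphi z)) (cyc0 py (colmap (cphi z) sg)).
have -> : cyc px (cphi z) finset.set0 * cyc py (colmap (cphi z) sg) finset.set0 = 1.
  by apply: etrans e (mulr1 _).
done.
Qed.

Lemma forestF_sexp sg I : injective sg -> {in I, forall l, sg l \in I} ->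
  forestF sg I = sexp (expo sg I).
Proof.
move=> sgI Ist; apply: sexp_uniq.
- exact: xlow_expo.
- by move=> u; exact: forestF_xw0.
- exact: xD_forestF.
Qed.

End ForestEquation.

(** * Renaming the colours along a bijection *)

Section Conjugation.
Variables (K K' : finType) (t : K -> K') (sg : K -> K) (sg' : K' -> K').
Hypotheses (tB : bijective t) (tsg : forall a, t (sg a) = sg' (t a)) (sgI : injective sg).

Let tI : injective t := bij_inj tB.

Let tcode (S : finType) (x : code K S) : code K' S := (cphi x, (cpar x, [ffun v => t (ccol x v)])).

Lemma tcode_inj (S : finType) : injective (@tcode S).
Proof.
move=> [f [p c]] [f' [p' c']] [/= ef ep /ffunP e]; rewrite /cphi /cpar /= in ef ep.
rewrite ef ep; congr (_, (_, _)); apply/ffunP => v.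
by have := e v; rewrite !ffunE => /tI.
Qed.

Lemma tcode_ok (S : finType) I (x : code K S) :
  code_ok sg I x <-> code_ok sg' (t @: I)%SET (tcode x).
Proof.
split=> -[h1 h2 h3 h4 h5 h6]; split; rewrite /tcode /cphi /cpar /ccol //=.
- by move=> v pv; rewrite ffunE; apply: imset_f; exact: h3.
- by move=> v w pv; rewrite !ffunE (inj_eq tI); exact: h4.
- by move=> v; rewrite !ffunE -tsg -h6.
- by move=> v /h3; rewrite ffunE mem_imset.
- by move=> v w /h4; rewrite !ffunE (inj_eq tI).
- by move=> v; apply: tI; have := h6 v; rewrite !ffunE tsg.
Qed.

Lemma tcode_wt (S : finType) I (x : code K S) : code_ok sg I x ->
  code_wt sg' (tcode x) = code_wt sg x.
Proof.
move=> xok; rewrite /code_wt; congr (_ * _).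
have -> : code_fronts (tcode x) = ((fun p : S * K => (p.1, t p.2)) @: code_fronts x)%SET.
  case: tB => t' tK t'K; apply/setP => -[v l]; apply/idP/imsetP; rewrite ?inE /=.
    rewrite /ccol /= ffunE => vl; exists (v, t' l); rewrite ?inE /= ?t'K //.
    by apply: contra vl => /eqP <-; rewrite t'K.
  by move=> [[w l']]; rewrite inE /= => wl [-> ->]; rewrite /ccol /= ffunE (inj_eq tI).
apply/esym/cyc_bij.
- by move=> [v l] [w l'] _ _ [-> /tI ->].
- exact: code_fronts_stable xok sgI.
- by move=> [v l] _; rewrite /colmap /= tsg.
Qed.

Lemma forest_sum_conj s (I : {set K}) : forest_sum s sg' (t @: I)%SET = forest_sum s sg I.
Proof.
rewrite /forest_sum; congr (_ *: _).
rewrite [RHS](eq_bigr (fun x => code_wt sg' (tcode x))); last first.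
  by move=> x /asboolP xok; rewrite (tcode_wt xok).
rewrite [RHS](eq_bigl (fun x => x \in [set x : code K 'I_s | `[< code_ok sg I x >]]%SET)); last first.
  by move=> x; rewrite inE.
rewrite -[RHS](big_imset (code_wt sg') (in2W (@tcode_inj 'I_s))) /=.
apply: eq_bigl => y; apply/asboolP/imsetP => [yok|[x]]; last first.
  by rewrite inE => /asboolP/tcode_ok xok ->.
case: tB => t' tK t'K.
have yE : y = tcode (cphi y, (cpar y, [ffun v => t' (ccol y v)])).
  case: y {yok} => [f [p c]]; rewrite /tcode /cphi /cpar /ccol /=.
  by congr (_, (_, _)); apply/ffunP => v; rewrite !ffunE t'K.
exists (cphi y, (cpar y, [ffun v => t' (ccol y v)])) => //.
by rewrite inE; apply/asboolP/tcode_ok; rewrite -yE.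
Qed.

Lemma forestF_conj (I : {set K}) : forestF sg' (t @: I)%SET = forestF sg I.
Proof. by apply/funext => u; rewrite /forestF /gsum forest_sum_conj. Qed.

Lemma branch_conj i : sg i = i -> branch sg' (t i) = branch sg i.
Proof.
move=> sgi; have E : (~: [set t i] = t @: (~: [set i]))%SET.
  case: tB => t' tK t'K; apply/setP => l; rewrite !inE; apply/idP/imsetP.
    by move=> li; exists (t' l); rewrite ?inE ?t'K //; apply: contra li => /eqP <-; rewrite t'K.
  by move=> [l']; rewrite !inE => li ->; rewrite (inj_eq tI).
rewrite /branch /branch_root E forestF_conj; congr (_ * _ * _); apply/esym/cyc_bij => //.
  exact: in2W tI.
by move=> l; rewrite !inE -{2}sgi (inj_eq sgI).
Qed.

End Conjugation.

(** * Factorization over the cycles of colours *)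

Section OrbitProduct.
Variable K : finType.
Implicit Types (sg : K -> K) (I : {set K}).

(** The series of the k-trees rooted at a front that misses the colour [i], when [sg] fixes [i]:
    [py 1] accounts for the root. *)
Definition Yser sg (i : K) : series := py 1 * forestF sg [set i]%SET.

Lemma iter_bij n sg : injective sg -> bijective (iter n sg).
Proof. by move=> sgI; apply: injF_bij; exact: iter_inj. Qed.

(** On an orbit of length [b], the map [iter n sg] fixes all colours if [b] divides [n], and none
    otherwise. In the first case the [b] branches have equal series, being conjugate under iterates
    of [sg], and [b / n] is the inverse of [n %/ b]. *)
Lemma expo_term_orbit n sg x : injective sg -> (0 < n)%N ->
  expo_term n sg (forb sg x) =
  if (#|forb sg x| %| n)%N
  then dil #|forb sg x| (expo_term (n %/ #|forb sg x|) (iter #|forb sg x| sg) [set x]%SET)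
  else 0.
Proof.
move=> sgI n0; set b := #|_|.
have b0 : (0 < b)%N by rewrite card_gt0; apply/set0Pn; exists x; exact: forb_refl.
have bE : b = fingraph.order sg x by rewrite /b cardsE.
have bx : iter b sg x = x by rewrite bE iter_order.
have itx i : i \in forb sg x -> iter b sg i = i.
  by move=> /forbP[j ->]; rewrite -iterD addnC iterD bx.
case: ifP => [bn|nb]; last first.
  rewrite /expo_term big1 ?scaler0 // => i /andP[/forbP[j ji] /eqP ni].
  have nx : iter n sg x = x.
    by apply: (iter_inj (n := j) sgI); rewrite -iterD addnC iterD -ji ni.
  suff : (b %| n)%N by rewrite nb.
  have mx : iter (n %% b) sg x = x by rewrite -(iter_mod n bx).
  have [m0|m0] := posnP (n %% b)%N; first by apply/eqP.
  have := card_forb_min m0 mx; by rewrite leqNgt ltn_pmod.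
have l0 : (0 < n %/ b)%N by rewrite divn_gt0 // dvdn_leq.
have fE : iter (n %/ b) (iter b sg) = iter n sg.
  by apply/funext => z; rewrite -iterM divnK.
have nx i : i \in forb sg x -> iter n sg i = i.
  by move=> /itx ib; rewrite (iter_mod n ib) (eqP bn).
have nxx : iter n sg x = x by apply: nx; exact: forb_refl.
have E1 : expo_term (n %/ b) (iter b sg) [set x]%SET =
    ((n %/ b)%:R : rat)^-1 *: dil (n %/ b) (branch (iter n sg) x).
  rewrite /expo_term fE; congr (_ *: _).
  rewrite (eq_bigl (pred1 x)) ?big_pred1_eq // => i /=; rewrite inE.
  by case: eqP => // ->; rewrite nxx eqxx.
rewrite E1 (dil_scale _ _ b0) (dil_dil _ b0 l0) mulnC divnK // /expo_term.
have E2 : \sum_(i in forb sg x | iter n sg i == i) dil n (branch (iter n sg) i) =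
    dil n (branch (iter n sg) x) *+ b.
  rewrite -sumr_const; apply: eq_big => [i|_ /andP[/forbP[j ->] _]].
    by case ix: (i \in forb sg x); rewrite //= nx ?eqxx.
  rewrite (@branch_conj _ _ (iter j sg) (iter n sg)) //.
  - exact: iter_bij.
  - by move=> a; rewrite -!iterD addnC.
  - exact: iter_inj.
rewrite E2 -scaler_nat scalerA; congr (_ *: _).
have bn0 : (b%:R : rat) != 0 by rewrite pnatr_eq0 -lt0n.
by rewrite -{1}(divnK bn) natrM invfM -mulrA mulVf ?mulr1.
Qed.

Lemma sum_multiples b M (F : nat -> series) : (0 < b)%N ->
  \sum_(n < b * M) (if (b %| n)%N then F (n %/ b)%N else 0) = \sum_(l < M) F l.
Proof.
case: b => // b _; elim: M => [|M IH]; first by rewrite muln0 !big_ord0.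
rewrite [RHS]big_ord_recr /= -IH mulnS addnC big_split_ord /=; congr (_ + _).
rewrite big_ord_recl /= addn0 dvdn_mulr // mulKn // big1 ?addr0 // => i _.
rewrite /bump leq0n add1n ifN // dvdn_addr ?dvdn_mulr //.
by rewrite gtnNdvd // ltnS.
Qed.

Lemma expo_orbit sg x : injective sg ->
  expo sg (forb sg x) = dil #|forb sg x| (expo (iter #|forb sg x| sg) [set x]%SET).
Proof.
move=> sgI; set b := #|_|.
have b0 : (0 < b)%N by rewrite card_gt0; apply/set0Pn; exists x; exact: forb_refl.
apply/funext => u; set M := (xw u).+1.
pose E l := if (0 < l)%N then expo_term l (iter b sg) [set x]%SET else 0.
have -> : dil b (expo (iter b sg) [set x]%SET) u = (\sum_(l < M) dil b (E l)) u.
  rewrite -dil_sum //; have [[v uv]|nu] := dil_case b u; last by rewrite !dil_out.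
  rewrite uv !dilE // (@expoE _ M); last by rewrite /M uv xw_dil // ltnS leq_pmull.
  by congr ((_ : series) v); rewrite big_mkcond.
rewrite (@expoE _ (b * M)); last by rewrite (leq_trans (leqnn M)) // leq_pmull.
congr ((_ : series) u); rewrite -(sum_multiples M (fun l => dil b (E l)) b0) big_mkcond; apply: eq_bigr => n _.
case: posnP => [->|n0]; first by rewrite dvdn0 div0n /E /= dil0.
rewrite expo_term_orbit // -/b; case: ifP => // bn.
by rewrite /E divn_gt0 // dvdn_leq.
Qed.

Lemma expo_orbits sg I : injective sg -> {in I, forall l, sg l \in I} ->
  expo sg I = \sum_(B in forbs sg I) expo sg B.
Proof.
move=> sgI Ist; apply/funext => u.
have -> : (\sum_(B in forbs sg I) expo sg B) u =
    (\sum_(B in forbs sg I) \sum_(n < (xw u).+1 | (0 < n)%N) expo_term n sg B) u.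
  by rewrite [LHS]sumE [RHS]sumE; apply: eq_bigr => B _; exact: expoE.
rewrite exchange_big /= (@expoE _ (xw u).+1) //; congr ((_ : series) u).
apply: eq_bigr => n _; rewrite /expo_term -scaler_sumr; congr (_ *: _).
rewrite (partition_big (forb sg) (mem (forbs sg I))) /=; last first.
  by move=> i /andP[iI _]; exact: imset_f.
apply: eq_bigr => _ /imsetP[x xI ->]; apply: eq_bigl => i.
rewrite [forb sg i == _]eq_sym forb_eq //.
case ix: (i \in forb sg x); rewrite /= ?andbF // andbT.
by rewrite (fintype.subsetP (forb_sub Ist xI) _ ix).
Qed.

(** The exponent is a sum over the orbits in [I], so the exponential is a product. An orbit of
    length [b] gives the exponent of a single colour for [iter b sg], dilated by [b]; the cycle
    monomial supplies the missing factor [py 1] of each [Yser]. This is the shape of the products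
    over [C(sigma)] in the recursion. *)
Lemma forest_orbit_prod sg I (st : {set K} -> K) : injective sg ->
  {in I, forall l, sg l \in I} -> (forall B, B \in forbs sg I -> st B \in B) ->
  cyc py sg I * forestF sg I = \prod_(B in forbs sg I) dil #|B| (Yser (iter #|B| sg) (st B)).
Proof.
move=> sgI Ist stB; rewrite forestF_sexp // expo_orbits // sexp_sum; last first.
  by move=> B _; exact: xlow_expo.
rewrite cycE -big_split /=; apply: eq_bigr => B BI.
have := stB B BI; case/imsetP: BI => x xI -> yx; set y := st _ in yx *.
have -> : forb sg x = forb sg y by apply/eqP; rewrite forb_eq.
rewrite expo_orbit //; set b := #|_|.
have b0 : (0 < b)%N by rewrite card_gt0; apply/set0Pn; exists y; exact: forb_refl.
have by_ : iter b sg y = y.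
  by rewrite (_ : b = fingraph.order sg y) ?iter_order // /b cardsE.
rewrite /Yser dil_mul // dil_py // muln1 forestF_sexp; first last.
- by move=> l /set1P ->; rewrite by_ inE.
- exact: iter_inj.
by rewrite dil_sexp //; exact: xlow_expo.
Qed.

End OrbitProduct.

(** * Identification of Z_Y and Z_XY *)

Section Identification.
Variable k : nat.

(** The composition telescopes: each factor subtracts the next point of the trajectory, and the
    following one adds it back before applying [s]. *)
Lemma prod_rho_traject (s : 'S_k.+1) n i a :
  (\prod_(j <- traject s i n) rho s j)%g a = iter n s (i + a) - iter n s i.
Proof.
elim: n i a => [|n IH] i a; first by rewrite big_nil perm1 /= [i + a]addrC addrK.
by rewrite /= big_cons permM IH permE /rho_fun [s i + _]addrC subrK -!iterSr.
Qed.

Lemma Yser_rho (s : 'S_k.+1) n i : iter n s i = i ->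
  Yser (\prod_(j <- traject s i n) rho s j)%g ord0 = Yser (iter n s) i.
Proof.
move=> si; set p := (\prod_(j <- _) _)%g.
pose t (a : 'I_k.+1) : 'I_k.+1 := i + a.
have tB : bijective t.
  by exists (fun a => a - i) => a; rewrite /t; [rewrite [i + a]addrC addrK | rewrite addrC subrK].
have tp a : t (p a) = iter n s (t a) by rewrite /t /p prod_rho_traject si addrC subrK.
have t0 : [set i]%SET = (t @: [set ord0])%SET by rewrite imset_set1 /t [i + _]addr0.
by rewrite /Yser t0 (forestF_conj tB tp (@perm_inj _ p)).
Qed.

Lemma Delta0 (s : 'S_k) : Delta s ord0 = ord0.
Proof. exact: lift_perm_id. Qed.

Lemma Delta_lift (s : 'S_k) i : Delta s (lift ord0 i) = lift ord0 (s i).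
Proof. exact: lift_perm_lift. Qed.

Lemma iter_Delta0 (s : 'S_k) n : iter n (Delta s) ord0 = ord0.
Proof. by elim: n => //= n ->; exact: Delta0. Qed.

Lemma iter_Delta (s : 'S_k) n : iter n (Delta s) = Delta (s ^+ n)%g.
Proof.
apply/funext => a; case: (unliftP ord0 a) => [b|] ->; last first.
  by rewrite Delta0; exact: iter_Delta0.
rewrite Delta_lift permX.
by elim: n => //= n ->; rewrite Delta_lift.
Qed.

Lemma map_traject_Delta (s : 'S_k) i n :
  map (lift ord0) (traject s i n) = traject (Delta s) (lift ord0 i) n.
Proof. by elim: n i => //= n IH i; rewrite IH Delta_lift. Qed.

Definition ZYc (s : 'S_k) : series := Yser (Delta s) ord0.

Lemma ZYc_Delta_inv (s : 'S_k.+1) n i : iter n s i = i ->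
  ZYc (Delta_inv (\prod_(j <- traject s i n) rho s j)%g) = Yser (iter n s) i.
Proof. by move=> si; rewrite /ZYc Delta_inv_rhoK Yser_rho. Qed.

Section CycleChoice.
Variables (n : nat) (s : 'S_n) (start : 'S_n -> {set 'I_n} -> 'I_n).
Hypothesis hstart : cycle_start start.

Lemma card_porbit_start c : c \in porbits s -> #|porbit s (start s c)| = #|c|.
Proof.
move=> cs; have := hstart cs; case/imsetP: cs => x _ ->.
by rewrite -eq_porbit_mem => /eqP ->.
Qed.

Lemma iter_card_start c : c \in porbits s -> iter #|c| s (start s c) = start s c.
Proof. by move=> cs; rewrite -(card_porbit_start cs) iter_porbit. Qed.

End CycleChoice.

(** The new fronts of a vertex of colour [ord0] have the lifted points of ['I_k] as colours, so the
    cycles of [s] are the orbits of [Delta s] there, and [forest_orbit_prod] gives the product in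
    [fY]. *)
Lemma fY_ZYc (start : 'S_k -> {set 'I_k} -> 'I_k) (hstart : cycle_start start) (s : 'S_k) :
  fY start ZYc s = branch (Delta s) ord0.
Proof.
have lI : injective (lift (@ord0 k)) by exact: lift_inj.
pose L (c : {set 'I_k}) : {set 'I_k.+1} := (lift ord0 @: c)%SET.
pose L' (B : {set 'I_k.+1}) : {set 'I_k} := (lift ord0 @^-1: B)%SET.
have LK c : L' (L c) = c by apply/setP => i; rewrite inE mem_imset.
have LE : (~: [set ord0] = L [set: 'I_k])%SET.
  apply/setP => a; rewrite !inE; case: (unliftP ord0 a) => [b|] ->.
    by rewrite mem_imset // in_setT eq_sym neq_lift.
  by rewrite eqxx; apply/esym/imsetP => -[b _ /eqP]; rewrite (negbTE (neq_lift _ _)).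
have fE : forbs (Delta s) (~: [set ord0])%SET = [set L c | c in porbits s]%SET.
  rewrite LE -(forbs_perm s) /forbs -!imset_comp; apply: eq_in_imset => i _ /=.
  apply: (@forb_imset _ _ s (Delta s) (lift ord0) [set: 'I_k]%SET) => [j _|j _|]; rewrite ?in_setT //.
  by rewrite Delta_lift.
have st0 : {in (~: [set ord0])%SET, forall l, Delta s l \in (~: [set ord0])%SET}.
  by move=> l; rewrite !inE -{2}(Delta0 s) (inj_eq perm_inj).
rewrite /branch /branch_root -mulrA.
rewrite (forest_orbit_prod (st := fun B => lift ord0 (start s (L' B))) (@perm_inj _ _) st0); last first.
  by move=> B; rewrite fE => /imsetP[c cs ->]; rewrite LK mem_imset //; exact: hstart.
rewrite /fY fE; congr (_ * _); rewrite [RHS]big_imset /=; last by move=> c c' _ _ /(congr1 L'); rewrite !LK.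
apply: eq_bigr => c cs; rewrite LK (card_imset _ lI) /cycle_seq (card_porbit_start hstart cs).
apply: (congr1 (dil #|c|)).
rewrite -(big_map (lift ord0) predT (fun j => rho (Delta s) j)) map_traject_Delta ZYc_Delta_inv //.
rewrite -[in RHS](iter_card_start hstart cs).
by rewrite iter_Delta Delta_lift permX.
Qed.

Lemma ZXY_ZYc (start : 'S_k.+1 -> {set 'I_k.+1} -> 'I_k.+1) (hstart : cycle_start start) (s : 'S_k.+1) :
  ZXY start ZYc s = px 1 * (cyc py s [set: 'I_k.+1]%SET * forestF s [set: 'I_k.+1]%SET).
Proof.
rewrite (forest_orbit_prod (st := start s) (@perm_inj _ _)); first last.
- by move=> B; rewrite forbs_perm; exact: hstart.
- by move=> l; rewrite !in_setT.
rewrite forbs_perm /ZXY; apply: (congr1 (fun z : series => px 1 * z)); apply: eq_bigr => c cs; apply: (congr1 (dil #|c|)).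
by rewrite /cycle_seq (card_porbit_start hstart cs) ZYc_Delta_inv // iter_card_start.
Qed.

Lemma expo_term1 (K : finType) n (sg : K -> K) i : iter n sg i = i ->
  expo_term n sg [set i]%SET = (n%:R : rat)^-1 *: dil n (branch (iter n sg) i).
Proof.
move=> sgi; rewrite /expo_term; congr (_ *: _).
rewrite (eq_bigl (pred1 i)) ?big_pred1_eq // => j /=; rewrite inE.
by case: eqP => // ->; rewrite sgi eqxx.
Qed.

(** The colour [ord0] is fixed by every iterate of [Delta s], so all positive [n] occur in the
    exponent, the term of index [n] involving the branch series of [s ^+ n]. *)
Lemma ZYc_system (start : 'S_k -> {set 'I_k} -> 'I_k) :
  cycle_start start -> ZY_system start ZYc.
Proof.
move=> hstart s; rewrite /ZY_rhs {1}/ZYc /Yser; apply: (congr1 (fun z : series => py 1 * z)).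
rewrite forestF_sexp; first last.
- by move=> l /set1P ->; rewrite Delta0 inE.
- exact: perm_inj.
apply: (congr1 sexp); apply/funext => u.
have E n : expo_term n (Delta s) [set ord0]%SET =
    (n%:R : rat)^-1 *: dil n (fY start ZYc (s ^+ n)%g).
  by rewrite expo_term1 ?iter_Delta0 // iter_Delta fY_ZYc.
rewrite (@ssumE (fun n => 0 < n)%N _ (xw u).+1) //; last first.
  by move=> n n0; rewrite -E; exact: xlow_expo_term.
rewrite (@expoE _ (xw u).+1) // sumE.
by apply: eq_bigr => n _; rewrite E.
Qed.

Lemma ZYc_unique (start : 'S_k -> {set 'I_k} -> 'I_k) ZY :
  cycle_start start -> ZY_system start ZY -> ZY = ZYc.
Proof.
move=> /ZYc_system sysc sys; have [Z [_ Zu]] := ZY_system_unique start.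
by rewrite -(Zu _ sys) -(Zu _ sysc).
Qed.

End Identification.

(** * k-trees *)

Section Ktrees.
Local Open Scope nat_scope.

Section KtreeFacts.
Variables (T : finType) (e : rel T) (k : nat).
Hypotheses (esm : symmetric e) (eirr : irreflexive e).

Definition nb (S : {set T}) (v : T) : {set T} := [set x in S | e v x]%SET.

Lemma cliqueP j (A : {set T}) :
  reflect (#|A| = j /\ {in A &, forall x y, x != y -> e x y}) (clique e j A).
Proof.
apply: (iffP andP) => [[/eqP Aj /forall_inP eA]|[-> eA]]; split=> //.
  by move=> x y xA yA; apply: (implyP (forall_inP (eA x xA) y yA)).
by apply/forall_inP => x xA; apply/forall_inP => y yA; apply/implyP; exact: eA.
Qed.

Lemma ktree_card S : ktree_on e k S -> k <= #|S|.
Proof.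
elim=> {S} [S /cliqueP[-> _] //|S v A _ IH vS AS Ak eA].
by rewrite cardsU1 vS (leq_trans IH) // leq_addl.
Qed.

Lemma ktree_small S : ktree_on e k S -> #|S| = k -> clique e k S.
Proof.
case=> {S} [//|S v A /ktree_card kS vS _ _ _].
by rewrite cardsU1 vS add1n => Sk; move: kS; rewrite -Sk ltnn.
Qed.

Lemma nb_sub1 (S : {set T}) v : v \in S -> nb S v \subset S :\ v.
Proof.
move=> vS; apply/fintype.subsetP => x; rewrite !inE => /andP[-> vx]; rewrite andbT.
by apply: contraTneq vx => ->; rewrite eirr.
Qed.

Lemma nb_new (S : {set T}) v (A : {set T}) : v \notin S -> A \subset S ->
  (forall x, x \in S -> e v x = (x \in A)) -> nb (v |: S)%SET v = A.
Proof.
move=> vS AS eA; apply/setP => x; rewrite !inE.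
case xS: (x \in S); first by rewrite orbT eA.
rewrite orbF; have [->|] := eqVneq x v.
  by rewrite eirr; apply/esym/negbTE; apply: contra vS; exact: (fintype.subsetP AS).
by move=> _; apply/esym/negbTE; apply: contraFN xS; exact: (fintype.subsetP AS).
Qed.

Lemma nbU1 S v w : nb (w |: S)%SET v = if e v w then (w |: nb S v)%SET else nb S v.
Proof.
apply/setP => x; case: ifP => vw; rewrite !inE; case: (x =P w) => [->|_] //=;
  by rewrite ?vw ?andbF.
Qed.

Lemma nb_clique j S v : clique e j S -> v \in S -> nb S v = (S :\ v)%SET.
Proof.
move=> /cliqueP[_ eS] vS; apply/setP => x; rewrite !inE andbC.
case xS: (x \in S); rewrite ?andbF ?andbT //; have [->|xv] := eqVneq x v; first by rewrite eirr.
by rewrite eS // eq_sym.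
Qed.

Lemma min_deg S : ktree_on e k S -> k < #|S| -> forall v, v \in S -> k <= #|nb S v|.
Proof.
elim=> {S} [S /cliqueP[-> _]|S w A St IH wS AS Ak eA]; first by rewrite ltnn.
move=> _ v /setU1P[->|vS]; first by rewrite (nb_new wS AS eA); case/cliqueP: Ak => ->.
have [kS|Sk] := ltnP k #|S|.
  apply: leq_trans (IH kS v vS) _; rewrite nbU1; case: ifP => // _.
  by rewrite subset_leq_card // subsetUr.
(* Here [S] is a single [k]-clique and [w] is joined to all of it, so every vertex gets degree
   [k]. *)
have {}Sk : #|S| = k by apply/eqP; rewrite eqn_leq Sk (ktree_card St).
have AE : A = S by apply/eqP; rewrite eqEcard AS Sk /=; case/cliqueP: Ak => -> _; exact: leqnn.
rewrite nbU1 esm eA // AE vS (nb_clique (ktree_small St Sk) vS) cardsU1.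
by rewrite !inE (negbTE wS) andbF add1n -Sk (cardsD1 v S) vS.
Qed.

Lemma clique_D1 j A v : clique e j.+1 A -> v \in A -> clique e j (A :\ v)%SET.
Proof.
move=> /cliqueP[Aj eA] vA; apply/cliqueP; split.
  by move: Aj; rewrite (cardsD1 v) vA => -[].
by move=> x y /setD1P[_ xA] /setD1P[_ yA]; exact: eA.
Qed.

Lemma clique_add j A v : clique e j A -> v \notin A -> (forall x, x \in A -> e v x) ->
  clique e j.+1 (v |: A)%SET.
Proof.
move=> /cliqueP[Aj eA] vA ev; apply/cliqueP; split; first by rewrite cardsU1 vA Aj.
move=> x y /setU1P[->|xA] /setU1P[->|yA]; rewrite ?eqxx // => xy.
- exact: ev.
- by rewrite esm; exact: ev.
- exact: eA.
Qed.

(** If [v] differs from the last vertex [w], it is not adjacent to [w], as otherwise its degree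
    before adding [w] would contradict [min_deg]. So [v] can be deleted first and [w] added
    afterwards to the same clique. The exception is a graph on [k.+1] vertices, which is
    complete. *)
Lemma prune S : ktree_on e k S -> k < #|S| -> forall v, v \in S -> #|nb S v| = k ->
  clique e k (nb S v) /\ ktree_on e k (S :\ v)%SET.
Proof.
elim=> {S} [S /cliqueP[-> _]|S w A St IH wS AS Ak eA]; first by rewrite ltnn.
move=> _ v vwS; have [->|vw] := eqVneq v w; first by rewrite (nb_new wS AS eA) setU1K.
have vS : v \in S by case/setU1P: vwS vw => // ->; rewrite eqxx.
have DE : ((w |: S) :\ v = w |: (S :\ v))%SET.
  by apply/setP => x; rewrite !inE; have [->|] := eqVneq x w; rewrite //= eq_sym vw.
have [kS|Sk] := ltnP k #|S|.
  have kv := min_deg St kS vS; rewrite nbU1; case: ifP => [evw|nvw].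
    by rewrite cardsU1 inE (negbTE wS) add1n => ck; move: kv; rewrite -ck ltnn.
  move=> /(IH kS v vS)[cl kt]; split=> //; rewrite DE.
  have vA : v \notin A by rewrite -eA // esm nvw.
  apply: (KtreeStep (A := A)) => //.
  - by rewrite inE (negbTE wS) andbF.
  - by apply/fintype.subsetP => x xA; rewrite !inE (fintype.subsetP AS) // andbT;
      apply: contraTneq xA => ->.
  - by move=> x /setD1P[_]; exact: eA.
have {}Sk : #|S| = k by apply/eqP; rewrite eqn_leq Sk (ktree_card St).
have AE : A = S by apply/eqP; rewrite eqEcard AS Sk /=; case/cliqueP: Ak => -> _; exact: leqnn.
have cl1 : clique e k.+1 (w |: S)%SET.
  by apply: clique_add (ktree_small St Sk) wS _ => x xS; rewrite eA // AE.
have cl := clique_D1 cl1 vwS.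
by rewrite (nb_clique cl1 vwS) => _; split=> //; exact: KtreeBase.
Qed.

Lemma deg_full S v : ktree_on e k S -> #|S| = k.+1 -> v \in S -> #|nb S v| = k.
Proof.
move=> St Sk vS; apply/eqP; rewrite eqn_leq min_deg ?Sk // andbT.
apply: leq_trans (subset_leq_card (nb_sub1 vS)) _.
by move: Sk; rewrite (cardsD1 v) vS add1n => -[->].
Qed.

(** Let [w] be the last vertex, attached to the clique [A]. Of two non-adjacent vertices of degree
    [k] in the smaller k-tree, one lies outside [A]; it keeps its degree and is not adjacent to [w].
    On [k.+1] vertices any vertex outside [A] will do. *)
Lemma two_simplicial S : ktree_on e k S -> k.+1 < #|S| -> exists u v,
  [/\ u \in S, v \in S, u != v, e u v = false & #|nb S u| = k /\ #|nb S v| = k].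
Proof.
elim=> {S} [S /cliqueP[-> _]|S w A St IH wS AS Ak eA]; first by rewrite ltnNge leqnSn.
rewrite cardsU1 wS add1n ltnS => kS; case/cliqueP: (Ak) => cA eAA.
have key u : u \in S -> u \notin A -> #|nb S u| = k -> exists u v,
    [/\ u \in (w |: S)%SET, v \in (w |: S)%SET, u != v, e u v = false &
      #|nb (w |: S)%SET u| = k /\ #|nb (w |: S)%SET v| = k].
  move=> uS uA du; have euw : e w u = false by rewrite eA // (negbTE uA).
  exists w, u; rewrite setU11 in_setU1 uS orbT; split=> //.
    by apply: contraNneq wS => ->.
  by rewrite (nb_new wS AS eA) nbU1 esm euw.
have [Sk|Sk] := ltnP k.+1 #|S|.
  have [u [v [uS vS uv nuv [du dv]]]] := IH Sk.
  have [uA|uA] := boolP (u \in A); last exact: (key u).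
  have [vA|vA] := boolP (v \in A); last exact: (key v).
  by rewrite eAA in nuv.
have {}Sk : #|S| = k.+1 by apply/eqP; rewrite eqn_leq Sk kS.
have [u uS uA] : exists2 u, u \in S & u \notin A.
  apply/subsetPn; apply/negP => SA; have := subset_leq_card SA.
  by rewrite Sk cA ltnn.
by apply: (key u) => //; exact: deg_full.
Qed.

(** A clique cannot contain both vertices given by [two_simplicial]. A k-tree can therefore be
    pruned down to any prescribed root. *)
Lemma simplicial_outside S (R : {set T}) : ktree_on e k S -> k < #|S| -> R \proper S ->
  {in R &, forall x y, x != y -> e x y} -> exists v, [/\ v \in S, v \notin R & #|nb S v| = k].
Proof.
move=> St kS /properP[RS [v vS vR]] eR.
have [Sk|Sk] := ltnP k.+1 #|S|.
  have [u [w [uS wS uw nuw [du dw]]]] := two_simplicial St Sk.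
  have [uR|uR] := boolP (u \in R); last by exists u.
  have [wR|wR] := boolP (w \in R); last by exists w.
  by rewrite eR in nuw.
by exists v; split=> //; apply: deg_full => //; apply/eqP; rewrite eqn_leq Sk kS.
Qed.

Lemma prune_set (L : {set T}) S : ktree_on e k S -> L \subset S ->
  {in L, forall v, #|nb S v| = k} -> {in L &, forall u v, e u v = false} ->
  ktree_on e k (S :\: L)%SET.
Proof.
have [n] := ubnP #|L|; elim: n L S => // n IH L S Ln St LS dL iL.
have [->|/set0Pn[v vL]] := eqVneq L finset.set0; first by rewrite setD0.
have vS := fintype.subsetP LS _ vL.
have kS : k < #|S|.
  by rewrite -(dL v vL) (cardsD1 v S) vS ltnS; exact: subset_leq_card (nb_sub1 vS).
have [_ Sv] := prune St kS vS (dL v vL).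
have -> : (S :\: L = (S :\ v) :\: (L :\ v))%SET.
  by apply/setP => x; rewrite !inE; have [->|] := eqVneq x v; rewrite ?vL ?andbF.
have nbE u : u \in L -> nb (S :\ v)%SET u = nb S u.
  move=> uL; apply/setP => x; rewrite !inE; have [->|//] := eqVneq x v.
  by rewrite iL ?andbF.
apply: IH => //.
- by move: Ln; rewrite (cardsD1 v L) vL.
- by apply: setSD.
- by move=> u /setD1P[_ uL]; rewrite nbE // dL.
- by move=> u w /setD1P[_ uL] /setD1P[_ wL]; exact: iL.
Qed.

(** While more than [k.+1] vertices remain, the vertices of degree [k] form a nonempty independent
    set stable under [phi], and removing all of them leaves a smaller stable k-tree. With at most
    [k.+1] vertices the whole k-tree is a clique. *)
Lemma fixed_clique (phi : T -> T) S : injective phi ->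
  (forall x y, e (phi x) (phi y) = e x y) -> ktree_on e k S -> (phi @: S = S)%SET ->
  exists A : {set T}, (phi @: A = A)%SET /\ (clique e k A \/ clique e k.+1 A).
Proof.
move=> pI pe; have [n] := ubnP #|S|; elim: n S => // n IH S Sn St pS.
have pSP x : (phi x \in S) = (x \in S) by rewrite -{1}pS mem_imset.
have [Sk|Sk] := ltnP k.+1 #|S|; last first.
  have [kS|kS] := ltnP k #|S|; exists S; split=> //; last first.
    by left; apply: ktree_small => //; apply/eqP; rewrite eqn_leq kS ktree_card.
  have {}Sk : #|S| = k.+1 by apply/eqP; rewrite eqn_leq Sk kS.
  right; apply/cliqueP; split=> // x y xS yS xy.
  have : nb S x = (S :\ x)%SET.
    apply/eqP; rewrite eqEcard nb_sub1 // deg_full //=.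
    by move: Sk; rewrite (cardsD1 x) xS add1n => -[->].
  by move/setP/(_ y); rewrite !inE yS eq_sym xy.
pose L := [set v in S | #|nb S v| == k]%SET.
have LS : L \subset S by apply/fintype.subsetP => v; rewrite inE => /andP[].
have dL : {in L, forall v, #|nb S v| = k} by move=> v; rewrite inE => /andP[_ /eqP].
(* If two vertices of degree [k] were adjacent, deleting [v] would leave [u] with degree below [k]
   in a k-tree with more than [k] vertices. *)
have iL : {in L &, forall u v, e u v = false}.
  move=> u v uL vL; apply/negP => euv.
  have uv : u != v by apply: contraTneq euv => ->; rewrite eirr.
  have uS := fintype.subsetP LS _ uL; have vS := fintype.subsetP LS _ vL.
  have [_ Sv] := prune St (ltnW Sk) vS (dL v vL).
  have kSv : k < #|(S :\ v)%SET| by move: Sk; rewrite (cardsD1 v S) vS.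
  have uSv : u \in (S :\ v)%SET by rewrite !inE uv.
  have := min_deg Sv kSv uSv; rewrite -{1}(dL u uL) leqNgt => /negP; apply.
  apply: proper_card; apply/properP; split.
    by apply/fintype.subsetP => x; rewrite !inE => /andP[/andP[_ ->] ->].
  by exists v; rewrite !inE ?vS ?euv ?eqxx.
have nbp v : nb S (phi v) = (phi @: nb S v)%SET.
  apply/eqP; rewrite eq_sym eqEcard; apply/andP; split.
    apply/fintype.subsetP => _ /imsetP[x xn ->]; move: xn; rewrite inE => /andP[xS vx].
    by rewrite inE pSP xS pe.
  rewrite card_imset //.
  have sub : nb S (phi v) \subset (phi @: nb S v)%SET.
    apply/fintype.subsetP => x; rewrite inE => /andP[xS].
    have /imsetP[y yS ->] : x \in (phi @: S)%SET by rewrite pS.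
    by rewrite pe => vy; apply: imset_f; rewrite inE yS.
  by apply: leq_trans (subset_leq_card sub) _; rewrite card_imset.
have pL : (phi @: L = L)%SET.
  apply/eqP; rewrite eqEcard card_imset // leqnn andbT.
  apply/fintype.subsetP => _ /imsetP[v vL ->]; move: vL; rewrite inE => /andP[vS vk].
  by rewrite inE pSP vS nbp card_imset.
apply: (IH (S :\: L)%SET).
- apply: leq_trans (_ : #|S| <= n) => //; apply: proper_card; apply/properP.
  split; first exact: subsetDl.
  have [u [v [uS _ _ _ [du _]]]] := two_simplicial St Sk.
  by exists u; rewrite // !inE uS du eqxx.
- exact: prune_set.
apply/eqP; rewrite eqEcard card_imset // leqnn andbT.
apply/fintype.subsetP => _ /imsetP[v /setDP[vS vL] ->].
rewrite in_setD pSP vS andbT; apply: contra vL.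
by rewrite -{1}pL mem_imset.
Qed.

End KtreeFacts.

End Ktrees.

(** * Rooted k-trees and coloured forests *)

Section RootedKtrees.
Local Open Scope nat_scope.

Lemma card_gt0_ex (T : finType) (A : {set T}) : 0 < #|A| -> exists x, x \in A.
Proof. by rewrite card_gt0 => /set0Pn. Qed.

Section Rooted.
Variables (k : nat) (K Rt S : finType) (kap : Rt -> K) (I : {set K}).

(* The two kinds of roots: a hedron ([Rt] and [I] are all of [K]), or the front
   missing the colour [i] ([I] is the singleton of [i], [kap] is onto its complement). *)
Hypotheses (cardK : #|K| = k.+1) (kapI : injective kap).
Hypothesis (hI1 : forall i j, i \in I -> j != i -> exists r, kap r = j).
Hypothesis (hI2 : forall B : {set Rt}, #|B| = k ->
  exists2 i, i \in I & B = [set r | kap r != i]%SET).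
Hypothesis (hR : #|Rt| = k \/ #|Rt| = k.+1).

Local Notation T := (Rt + S)%type.
Implicit Types (par : S -> option S) (col : S -> K) (H : option S -> {set Rt + S}).

Definition root_set : {set T} := [set inl r | r in [set: Rt]]%SET.

Definition gdom (A : {set S}) : {set T} :=
  [set x : T | if x is inr v then v \in A else true]%SET.

Definition kcol col (x : T) : K := match x with inl r => kap r | inr v => col v end.

Definition fr H col u i : {set T} := [set x in H u | kcol col x != i]%SET.

(* [H u] is the vertex set of the hedron [u], of the root when [u = None]; [fr H col u i]
   is its front opposite to the vertex of colour [i]; [par] and [col] tell to which front
   of which hedron a vertex is attached; [rk] is an order in which vertices can be added. *)
Record rspec (A : {set S}) par col H (rk : S -> nat) : Prop := RSpec {
  rs_root : H None = root_set;
  rs_par : forall v w, v \in A -> par v = Some w -> [/\ w \in A, col v != col w & rk w < rk v];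
  rs_col : forall v, v \in A -> par v = None -> col v \in I;
  rs_hed : forall v, v \in A -> H (Some v) = (inr v |: fr H col (par v) (col v))%SET
}.

Definition valid (A : {set S}) (u : option S) : bool := if u is Some v then v \in A else true.

(** The names [(u, i)] that list the fronts without repetition: in the hedron of [v], the front
    opposite to [col v] is the one to which [v] is attached, already named through the parent. *)
Definition goodf (A : {set S}) col (u : option S) (i : K) : bool :=
  if u is Some v then (v \in A) && (i != col v) else i \in I.

Section Spec.
Variables (A : {set S}) (par : S -> option S) (col : S -> K) (H : option S -> {set T}) (rk : S -> nat).
Hypothesis sp : rspec A par col H rk.

Definition att v : {set T} := fr H col (par v) (col v).

Lemma rspec_ind (P : S -> Prop) :
  (forall v, v \in A -> (forall w, par v = Some w -> P w) -> P v) -> forall v, v \in A -> P v.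
Proof.
move=> IH v; have [n vn] := ubnP (rk v).
elim: n v vn => // n IHn v vn vA; apply: IH => // w pw.
by have [wA _ wv] := rs_par sp vA pw; apply: IHn => //; rewrite -ltnS (leq_trans _ vn).
Qed.

Lemma par_valid v : v \in A -> valid A (par v).
Proof. by move=> vA; case E: (par v) => [w|] //=; case: (rs_par sp vA E). Qed.

Lemma par_goodf v : v \in A -> goodf A col (par v) (col v).
Proof.
move=> vA; case E: (par v) => [w|] /=; last exact: (rs_col sp).
by case: (rs_par sp vA E) => -> ->.
Qed.

Lemma goodf_valid u i : goodf A col u i -> valid A u.
Proof. by case: u => [v|] //= /andP[]. Qed.

Lemma inl_hed r : inl r \in H None.
Proof. by rewrite (rs_root sp) imset_f. Qed.

Lemma inr_root v : inr v \in H None = false.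
Proof. by rewrite (rs_root sp); apply/imsetP => -[]. Qed.

Lemma hed_sub v : v \in A ->
  forall w, inr w \in H (Some v) -> w \in A /\ (rk w < rk v \/ w = v).
Proof.
move: v; apply: rspec_ind => v vA IH w.
rewrite (rs_hed sp vA) in_setU1 => /orP[/eqP [->]|]; first by split; [|right].
rewrite inE => /andP[]; case E: (par v) => [p|]; last by rewrite inr_root.
have [pA _ pv] := rs_par sp vA E.
case/(IH p E) => wA wp _; split=> //; left.
by case: wp => [wp|->] //; exact: ltn_trans pv.
Qed.

Lemma att_sub v w : v \in A -> inr w \in att v -> w \in A /\ rk w < rk v.
Proof.
move=> vA; rewrite inE => /andP[]; case E: (par v) => [p|]; last by rewrite inr_root.
have [pA _ pv] := rs_par sp vA E.
case/(hed_sub pA) => wA wp _; split=> //.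
by case: wp => [wp|->] //; exact: ltn_trans pv.
Qed.

Lemma att_irr v : v \in A -> inr v \notin att v.
Proof. by move=> vA; apply/negP => /(att_sub vA)[_]; rewrite ltnn. Qed.

Lemma hed_dom u : valid A u -> H u \subset gdom A.
Proof.
case: u => [v|] /= vA; apply/fintype.subsetP => -[r|w]; rewrite !inE //.
  by move=> /(hed_sub vA)[].
by rewrite inr_root.
Qed.

Lemma hed_mem v : v \in A -> inr v \in H (Some v).
Proof. by move=> vA; rewrite (rs_hed sp vA) setU11. Qed.

Lemma hed_col_inj u : valid A u -> {in H u &, injective (kcol col)}.
Proof.
have HN : {in H None &, injective (kcol col)}.
  by rewrite (rs_root sp) => _ _ /imsetP[r _ ->] /imsetP[r' _ ->] /= /kapI ->.
case: u => [v|_] //=; move: v; apply: rspec_ind => v vA IH x y.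
have PI : {in H (par v) &, injective (kcol col)}.
  by case E: (par v) => [p|] //; exact: IH.
rewrite (rs_hed sp vA) => /setU1P[->|xf] /setU1P[->|yf] //=.
- by move: yf; rewrite inE => /andP[_ yc] e; rewrite -e eqxx in yc.
- by move: xf; rewrite inE => /andP[_ xc] e; rewrite e eqxx in xc.
by move: xf yf; rewrite !inE => /andP[xf _] /andP[yf _]; exact: PI.
Qed.

Lemma hed_col_onto u i j : goodf A col u i -> j != i -> exists2 x, x \in H u & kcol col x = j.
Proof.
have HN i' j' : i' \in I -> j' != i' -> exists2 x, x \in H None & kcol col x = j'.
  by move=> iI ji; have [r rj] := hI1 iI ji; exists (inl r) => //; exact: inl_hed.
have HS v : v \in A -> forall l, exists2 x, x \in H (Some v) & kcol col x = l.
  move: v; apply: rspec_ind => v vA IH l.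
  have [->|lv] := eqVneq l (col v); first by exists (inr v) => //; exact: hed_mem.
  have [x xH xl] : exists2 x, x \in H (par v) & kcol col x = l.
    case E: (par v) => [p|]; first exact: IH.
    by apply: (HN (col v)) => //; exact: (rs_col sp).
  by exists x => //; rewrite (rs_hed sp vA) in_setU1 inE xH xl lv orbT.
case: u => [v|] /=; last exact: HN.
by move=> /andP[vA _] _; exact: HS.
Qed.

Lemma fr_col u i : goodf A col u i -> (kcol col @: fr H col u i = ~: [set i])%SET.
Proof.
move=> ui; apply/setP => j; rewrite !inE; apply/imsetP/idP.
  by move=> [x xf ->]; move: xf; rewrite inE => /andP[].
move=> ji; have [x xH xj] := hed_col_onto ui ji.
by exists x; rewrite ?inE ?xH ?xj.
Qed.

Lemma fr_sub u i : fr H col u i \subset H u.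
Proof. by apply/fintype.subsetP => x; rewrite inE => /andP[]. Qed.

Lemma card_fr u i : goodf A col u i -> #|fr H col u i| = k.
Proof.
move=> ui; have : #|(kcol col @: fr H col u i)%SET| = k.
  by rewrite fr_col // cardsC1 cardK.
rewrite card_in_imset // => x y /(fintype.subsetP (fr_sub _ _)) xH.
by move=> /(fintype.subsetP (fr_sub _ _)) yH; apply: (hed_col_inj (goodf_valid ui)).
Qed.

Lemma card_hed v : v \in A -> #|H (Some v)| = k.+1.
Proof.
move=> vA; rewrite (rs_hed sp vA) cardsU1 [_ \in _](negbTE (att_irr vA)) add1n.
by rewrite (card_fr (par_goodf vA)).
Qed.

(** The vertex [v] has the largest rank in the hedron that it creates, so two vertices creating the
    same hedron would each precede the other unless equal. The same argument serves for [fr_inj]. *)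
Lemma hed_inj u u' : valid A u -> valid A u' -> H u = H u' -> u = u'.
Proof.
case: u u' => [v|] [w|] //= vA wA E.
- have := hed_mem vA; rewrite E => /(hed_sub wA)[_ vw].
  have := hed_mem wA; rewrite -E => /(hed_sub vA)[_ wv].
  case: vw => [vw|->] //; case: wv => [wv|->] //.
  by move: (ltn_trans vw wv); rewrite ltnn.
- by have := hed_mem vA; rewrite E inr_root.
- by have := hed_mem wA; rewrite -E inr_root.
Qed.

Lemma fr_mem v i : v \in A -> i != col v -> inr v \in fr H col (Some v) i.
Proof. by move=> vA iv; rewrite inE hed_mem //= eq_sym. Qed.

Lemma fr_inj u u' i i' : goodf A col u i -> goodf A col u' i' ->
  fr H col u i = fr H col u' i' -> u = u' /\ i = i'.
Proof.
move=> ui ui' E; split; last first.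
  have := fr_col ui; rewrite E (fr_col ui') => /setP/(_ i').
  by rewrite !inE eqxx; case: eqP.
case: u u' ui ui' E => [v|] [w|] //=.
- move=> /andP[vA iv] /andP[wA iw] E.
  have := fr_mem vA iv; rewrite E => /(fintype.subsetP (fr_sub _ _))/(hed_sub wA)[_ vw].
  have := fr_mem wA iw; rewrite -E => /(fintype.subsetP (fr_sub _ _))/(hed_sub vA)[_ wv].
  case: vw => [vw|->] //; case: wv => [wv|->] //.
  by move: (ltn_trans vw wv); rewrite ltnn.
- by move=> /andP[vA iv] _ E; have := fr_mem vA iv; rewrite E inE inr_root.
- by move=> _ /andP[wA iw] E; have := fr_mem wA iw; rewrite -E inE inr_root.
Qed.

Section Graph.
Variable e : rel T.
Hypothesis esm : symmetric e.

Record gspec : Prop := GSpec {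
  gs_root : forall a b, e (inl a) (inl b) = (a != b);
  gs_l : forall v a, v \in A -> e (inr v) (inl a) = (inl a \in att v);
  gs_r : forall v w, v \in A -> w \in A ->
    e (inr v) (inr w) = (inr w \in att v) || (inr v \in att w)
}.

Hypothesis gs : gspec.

Lemma att_adj v x : v \in A -> x \in att v -> e (inr v) x.
Proof.
move=> vA xv; case: x xv => [a|w] xv; first by rewrite gs_l.
by have [wA _] := att_sub vA xv; rewrite gs_r // xv.
Qed.

Lemma root_clique : {in H None &, forall x y, x != y -> e x y}.
Proof.
by rewrite (rs_root sp) => _ _ /imsetP[a _ ->] /imsetP[b _ ->]; rewrite gs_root.
Qed.

Lemma hed_adj u : valid A u -> {in H u &, forall x y, x != y -> e x y}.
Proof.
case: u => [v|_] /=; last exact: root_clique.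
move: v; apply: rspec_ind => v vA IH x y.
have PI : {in H (par v) &, forall x y, x != y -> e x y}.
  by case E: (par v) => [p|]; [exact: IH|exact: root_clique].
rewrite (rs_hed sp vA) => /setU1P[->|xf] /setU1P[->|yf]; rewrite ?eqxx // => xy.
- exact: att_adj.
- by rewrite esm; exact: att_adj.
by apply: PI xy; [move: xf|move: yf]; exact: fintype.subsetP (fr_sub _ _) _.
Qed.

Lemma clique_hed v : v \in A -> clique e k.+1 (H (Some v)).
Proof. by move=> vA; apply/cliqueP; split; [exact: card_hed|exact: hed_adj]. Qed.

Lemma clique_fr u i : goodf A col u i -> clique e k (fr H col u i).
Proof.
move=> ui; apply/cliqueP; split; first exact: card_fr.
move=> x y xf yf; apply: (hed_adj (goodf_valid ui)); [move: xf|move: yf];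
  exact: fintype.subsetP (fr_sub _ _) _.
Qed.

(** Take the vertex [v] of largest rank in [B]: the others are neighbours of [v] that do not come
    later, hence they lie in [att v]. *)
Lemma clique_top (B : {set T}) j : clique e j B -> B \subset gdom A ->
  B \subset H None \/ exists2 v, v \in A & inr v \in B /\ B \subset H (Some v).
Proof.
move=> /cliqueP[_ eB] BA.
have [v0 v0B|nB] := pickP [pred v | inr v \in B]; last first.
  left; apply/fintype.subsetP => -[a|v] xB; first exact: inl_hed.
  by have := nB v; rewrite /= xB.
right; case: (arg_maxnP rk v0B) => v /= vB vmax.
have vA : v \in A by have := fintype.subsetP BA _ vB; rewrite inE.
exists v => //; split=> //; apply/fintype.subsetP => x xB.
have [->|xv] := eqVneq x (inr v); first exact: hed_mem.
rewrite (rs_hed sp vA); apply/setU1P; right.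
have := eB _ _ vB xB; rewrite eq_sym => /(_ xv).
case: x xB xv => [a|w] xB xv; first by rewrite gs_l.
have wA : w \in A by have := fintype.subsetP BA _ xB; rewrite inE.
rewrite gs_r // => /orP[//|/(att_sub wA)[_ vw]].
by have := vmax w xB; rewrite leqNgt vw.
Qed.

Lemma clique_hedE B : clique e k.+1 B -> B \subset gdom A ->
  (B = H None /\ #|Rt| = k.+1) \/ exists2 v, v \in A & B = H (Some v).
Proof.
move=> Bcl BA; case/cliqueP: (Bcl) => Bk _.
have cN : #|H None| = #|Rt|.
  by rewrite (rs_root sp) card_imset ?cardsT // => a b [].
case: (clique_top Bcl BA) => [BN|[v vA [_ Bv]]].
  left; have := subset_leq_card BN; rewrite Bk cN => kR.
  have Rk : #|Rt| = k.+1 by case: hR => // E; move: kR; rewrite E ltnn.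
  by split=> //; apply/eqP; rewrite eqEcard BN Bk cN Rk leqnn.
right; exists v => //; apply/eqP; rewrite eqEcard Bv Bk card_hed //; exact: leqnn.
Qed.

Lemma clique_frE B : clique e k B -> B \subset gdom A ->
  exists u i, goodf A col u i /\ B = fr H col u i.
Proof.
move=> Bcl BA; case/cliqueP: (Bcl) => Bk _.
case: (clique_top Bcl BA) => [BN|[v vA [vB Bv]]].
  pose B' : {set Rt} := [set r | inl r \in B]%SET.
  have BE : B = [set inl r | r in B']%SET.
    apply/setP => -[r|v]; last first.
      apply/idP/imsetP => [/(fintype.subsetP BN)|[] //]; by rewrite inr_root.
    apply/idP/imsetP => [rB|[r' r'B [->]]]; first by exists r; rewrite ?inE.
    by move: r'B; rewrite inE.
  have [i iI B'E] : exists2 i, i \in I & B' = [set r | kap r != i]%SET.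
    by apply: hI2; move: Bk; rewrite BE card_imset // => a b [].
  exists None, i; split=> //; apply/setP => x; rewrite BE B'E inE (rs_root sp).
  apply/imsetP/andP => [[r ri ->]|[/imsetP[r _ ->] /= ri]].
    by rewrite imset_f //; move: ri; rewrite inE.
  by exists r; rewrite ?inE.
(* A [k]-clique inside a hedron misses one of its vertices, and the colour of that vertex names the
   front. It differs from [col v] because [B] contains [inr v]. *)
have [x xH xB] : exists2 x, x \in H (Some v) & x \notin B.
  apply/subsetPn; apply/negP => /subset_leq_card; by rewrite Bk card_hed // ltnn.
have vi : kcol col x != col v.
  apply: contraNneq xB => e1; rewrite (_ : x = inr v) //.
  by apply: (@hed_col_inj (Some v)) => //; exact: hed_mem.
have g : goodf A col (Some v) (kcol col x) by apply/andP.
exists (Some v), (kcol col x); split=> //.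
apply/eqP; rewrite eqEcard Bk (card_fr g) leqnn andbT.
apply/fintype.subsetP => y yB; rewrite inE (fintype.subsetP Bv) //=.
apply: contraNneq xB => e1; rewrite -(_ : y = x) //.
by apply: (@hed_col_inj (Some v)) => //; exact: (fintype.subsetP Bv).
Qed.

End Graph.
End Spec.

Lemma rspec_closed (A : {set S}) par col H rk :
  rspec A par col H rk -> forall (B : {set S}), B \subset A ->
  (forall v w, v \in B -> par v = Some w -> w \in B) -> rspec B par col H rk.
Proof.
move=> sp B BA cl; have BP := fintype.subsetP BA; split.
- exact: rs_root sp.
- by move=> v w vB pv; have [_ ? ?] := rs_par sp (BP v vB) pv; split=> //; exact: cl pv.
- by move=> v /BP; exact: (rs_col sp).
- by move=> v /BP; exact: (rs_hed sp).
Qed.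

Lemma domU1 (A : {set S}) v : gdom (v |: A)%SET = (inr v |: gdom A)%SET.
Proof. by apply/setP => -[a|w]; rewrite !inE. Qed.

Lemma dom0 : gdom finset.set0 = root_set.
Proof.
apply/setP => -[a|w]; rewrite !inE; first by rewrite imset_f.
by apply/esym/imsetP => -[].
Qed.

Lemma rooted_ktree (A : {set S}) par col H rk (e : rel T) :
  symmetric e -> rspec A par col H rk -> gspec A par col H e -> ktree_on e k (gdom A).
Proof.
move=> esm; have [n] := ubnP #|A|; elim: n A => // n IH A An sp gs.
have [A0|/set0Pn[v0 v0A]] := eqVneq A finset.set0.
  rewrite A0 dom0; have cl := root_clique sp gs; rewrite (rs_root sp) in cl.
  have cR : #|root_set| = #|Rt| by rewrite card_imset ?cardsT // => a b [].
  case: hR => Rk; first by apply: KtreeBase; apply/cliqueP; rewrite cR.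
  have [x xR] : exists x, x \in root_set by apply/card_gt0_ex; rewrite cR Rk.
  have cl1 : clique e k.+1 root_set by apply/cliqueP; rewrite cR.
  rewrite -(setD1K xR); have cl2 := clique_D1 cl1 xR.
  (* A root with [k.+1] vertices is a k-tree by itself: one of its vertices is attached to the
     clique of the others. *)
  apply: (KtreeStep (A := (root_set :\ x)%SET)) => //; first exact: KtreeBase.
    by rewrite !inE eqxx.
  by move=> y yR; rewrite yR; case/setD1P: yR => yx yR; apply: cl; rewrite // eq_sym.
case: (arg_maxnP rk v0A) => v vA vmax; have {}vA : v \in A := vA.
have cl w w' : w \in (A :\ v)%SET -> par w = Some w' -> w' \in (A :\ v)%SET.
  move=> /setD1P[wv wA] pw; have [w'A _ lt] := rs_par sp wA pw.
  rewrite !inE w'A andbT; apply: contraTneq lt => ->.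
  by rewrite -leqNgt; exact: vmax.
have sp' := rspec_closed sp (subsetDl A [set v]%SET) cl.
have gs' : gspec (A :\ v)%SET par col H e.
  case: gs => g1 g2 g3; split=> //.
    by move=> w a /setD1P[_]; exact: g2.
  by move=> w w' /setD1P[_ wA] /setD1P[_ w'A]; exact: g3.
rewrite -(setD1K vA) domU1.
have attA : att par col H v \subset gdom (A :\ v)%SET.
  apply/fintype.subsetP => -[a|w]; rewrite !inE //.
  move=> wv; have [wA lt] : w \in A /\ rk w < rk v by apply: (att_sub sp) => //; rewrite inE.
  by rewrite wA andbT; apply: contraTneq lt => ->; rewrite ltnn.
apply: (KtreeStep (A := att par col H v)) => //.
- by apply: IH => //; move: An; rewrite (cardsD1 v) vA.
- by rewrite !inE eqxx.
- exact: (clique_fr sp esm gs (par_goodf sp vA)).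
move=> x xA; case: x xA => [a|w]; rewrite 1?inE ?(gs_l gs) // => /setD1P[wv wA].
rewrite (gs_r gs) //; apply/orb_idr => /(att_sub sp wA)[_ lt].
by have : rk w <= rk v := vmax w wA; rewrite leqNgt lt.
Qed.

(** Peel off a vertex of degree [k] outside the root, found by [simplicial_outside]. Its
    neighbourhood is a [k]-clique of the remaining graph, so by [clique_frE] a front [(u, i)]: these
    are its parent and its colour, and its rank is put above all others. *)
Lemma rooted_ktree_code (e : rel T) (A : {set S}) : symmetric e -> irreflexive e ->
  {in root_set &, forall x y, x != y -> e x y} -> ktree_on e k (gdom A) ->
  exists par col H rk, rspec A par col H rk /\ gspec A par col H e.
Proof.
move=> esm eir eR; have [n] := ubnP #|A|; elim: n A => // n IH A An kt.
have cR : #|root_set| = #|Rt| by rewrite card_imset ?cardsT // => a b [].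
have [i0 _] : exists i : K, i \in [set: K]%SET by apply: card_gt0_ex; rewrite cardsT cardK.
have [A0|An0] := eqVneq A finset.set0.
  exists (fun=> None), (fun=> i0), (fun=> root_set), (fun=> 0).
  rewrite A0; split; split; try by move=> v; rewrite inE.
  - by [].
  - move=> a b; have [->|ab] := eqVneq a b; first by rewrite eir.
    by apply: eR; rewrite ?imset_f //; apply: contra ab => /eqP[->].
have RA : root_set \proper gdom A.
  apply/properP; split; first by apply/fintype.subsetP => _ /imsetP[a _ ->]; rewrite inE.
  by case/set0Pn: An0 => v vA; exists (inr v); rewrite ?inE //; apply/imsetP => -[].
have kA : k < #|gdom A|.
  by apply: leq_ltn_trans (proper_card RA); rewrite cR; case: hR => ->.
have [x [xA xR dx]] := simplicial_outside esm eir kt kA RA eR.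
have [cl kt'] := prune esm eir kt kA xA dx.
case: x xA xR dx cl kt' => [a|v] xA xR dx cl kt'; first by rewrite imset_f in xR.
have vA : v \in A by rewrite inE in xA.
have DE : (gdom A :\ inr v = gdom (A :\ v))%SET.
  by apply/setP => -[a|w]; rewrite !inE.
rewrite DE in kt'.
have [] := IH (A :\ v)%SET _ kt'; first by move: An; rewrite (cardsD1 v) vA.
move=> par [col [H [rk [sp gs]]]].
set N := nb e (gdom A) (inr v) in cl.
have ND : N \subset gdom (A :\ v)%SET by rewrite -DE; exact: nb_sub1.
have [u [i [ui NE]]] := clique_frE sp gs cl ND.
pose par' w := if w == v then u else par w.
pose col' w := if w == v then i else col w.
pose H' o := if o == Some v then (inr v |: N)%SET else H o.
pose rk' w := if w == v then (\max_w rk w).+1 else rk w.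
have wv w : w \in (A :\ v)%SET -> (w == v) = false by move=> /setD1P[/negbTE].
have uv : u != Some v.
  by case: (u) ui => [w|] //= /andP[/wv wv' _]; apply/eqP => -[]; apply/eqP; rewrite wv'.
have HE o : o != Some v -> H' o = H o by rewrite /H' => /negbTE ->.
have frE o j : valid (A :\ v)%SET o -> fr H' col' o j = fr H col o j.
  move=> oA; have ov : o != Some v.
    by case: (o) oA => [w|] //= /wv wv'; apply/eqP => -[]; apply/eqP; rewrite wv'.
  apply/setP => -[a|w]; rewrite !inE HE //=.
  case wH: (inr w \in H o) => //=.
  have := fintype.subsetP (hed_dom sp oA) _ wH; rewrite inE => /wv wv'.
  by rewrite /col' wv'.
have AE w : w \in A -> w = v \/ w \in (A :\ v)%SET.
  by move=> wA; have [->|wv'] := eqVneq w v; [left|right; rewrite !inE wv'].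
have rkm w : rk w < (\max_w rk w).+1 by rewrite ltnS (leq_bigmax w).
have attv : att par' col' H' v = N.
  by rewrite /att /par' /col' eqxx frE ?NE //; exact: goodf_valid ui.
have attw w : w \in (A :\ v)%SET -> att par' col' H' w = att par col H w.
  move=> wA; rewrite /att /par' (wv w wA) (_ : col' w = col w); last by rewrite /col' (wv w wA).
  by rewrite frE // (par_valid sp wA).
exists par', col', H', rk'; split; split.
- by rewrite HE //; exact: rs_root sp.
- move=> w t /AE[->|wA].
    rewrite /par' /col' /rk' eqxx => uE; move: ui; rewrite uE /= => /andP[tA it].
    by rewrite (wv t tA) it rkm; split=> //; case/setD1P: tA.
  rewrite /par' /col' /rk' (wv w wA) => pw; have [tA ct lt] := rs_par sp wA pw.
  by rewrite (wv t tA); split=> //; case/setD1P: tA.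
- move=> w /AE[->|wA]; first by rewrite /par' /col' eqxx => uE; move: ui; rewrite uE.
  by rewrite /par' /col' (wv w wA); exact: (rs_col sp).
- move=> w /AE[->|wA]; first by rewrite -/(att par' col' H' v) attv /H' eqxx.
  rewrite -/(att par' col' H' w) attw // HE ?(rs_hed sp wA) //.
  by apply/eqP => -[]; apply/eqP; rewrite wv.
- exact: gs_root gs.
- move=> w a /AE[->|wA]; last by rewrite attw // (gs_l gs).
  by rewrite attv /N !inE.
have vN : inr v \notin N by rewrite /N !inE eir andbF.
have vw w : w \in (A :\ v)%SET -> e (inr v) (inr w) = (inr w \in att par' col' H' v) || (inr v \in att par' col' H' w).
  move=> wA; rewrite attv attw //; case/setD1P: (wA) => _ wA'.
  rewrite [X in _ || X](_ : _ = false) ?orbF; first by rewrite /N !inE wA'.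
  by apply/negP => /(att_sub sp wA)[]; rewrite !inE eqxx.
move=> w w' /AE[->|wA] /AE[->|w'A].
- by rewrite eir attv (negbTE vN).
- exact: vw.
- by rewrite esm orbC; exact: vw.
by rewrite !attw // (gs_r gs).
Qed.

(** By induction on [rk v]. The set [att v] of the first code consists of neighbours of [v] already
    treated, so it is contained in the one of the second code; both have [k] elements, hence they
    are equal, and [fr_inj] recovers the parent and the colour from this front. *)
Lemma rspec_uniq (e : rel T) par col H rk par' col' H' rk' : symmetric e ->
  rspec [set: S]%SET par col H rk -> gspec [set: S]%SET par col H e ->
  rspec [set: S]%SET par' col' H' rk' -> gspec [set: S]%SET par' col' H' e ->
  forall v, [/\ par v = par' v, col v = col' v & H (Some v) = H' (Some v)].
Proof.
move=> esm sp gs sp' gs' v; have [n] := ubnP (rk v).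
have vT (w : S) : w \in [set: S]%SET by rewrite in_setT.
elim: n v => // n IH v vn; pose A := [set w | rk w < rk v]%SET.
have eqA w : w \in A -> [/\ par w = par' w, col w = col' w & H (Some w) = H' (Some w)].
  by rewrite inE => wv; apply: IH; rewrite -ltnS (leq_trans _ vn).
have HN : H None = H' None by rewrite (rs_root sp) (rs_root sp').
have Hu u : valid A u -> H u = H' u by case: u => [w /eqA[]|].
have clA w w' : w \in A -> par w = Some w' -> w' \in A.
  rewrite !inE => wv pw; have [_ _ lt] := rs_par sp (vT w) pw.
  exact: ltn_trans wv.
have spA := rspec_closed sp (subsetT A) clA.
have spA' : rspec A par' col' H' rk'.
  apply: (rspec_closed sp' (subsetT A)) => w w' wA; have [<- _ _] := eqA w wA.
  exact: clA.
have frE u i : valid A u -> fr H col u i = fr H' col' u i.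
  move=> uA; apply/setP => x; rewrite !inE -Hu //; case xH: (x \in H u) => //=.
  have := fintype.subsetP (hed_dom spA uA) _ xH; rewrite inE.
  by case: x {xH} => [a|w] //= /eqA[_ -> _].
have pvA : valid A (par v).
  by case E: (par v) => [w|] //=; rewrite inE; case: (rs_par sp (vT v) E).
have attA : att par col H v \subset gdom A.
  apply/fintype.subsetP => -[a|w]; rewrite !inE // => wv.
  by case: (att_sub sp (vT v) (w := w)) => //; rewrite inE.
have attS : att par col H v \subset att par' col' H' v.
  apply/fintype.subsetP => x xv; have := att_adj sp gs (vT v) xv.
  case: x xv => [a|w] xv; first by rewrite (gs_l gs').
  rewrite (gs_r gs') // => /orP[//|].
  have wA : w \in A by have := fintype.subsetP attA _ xv; rewrite inE.
  by move=> /(att_sub spA' wA)[]; rewrite inE ltnn.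
have attE : att par col H v = att par' col' H' v.
  apply/eqP; rewrite eqEcard attS /att (card_fr sp (par_goodf sp (vT v))).
  by rewrite (card_fr sp' (par_goodf sp' (vT v))) leqnn.
have pvA' : valid A (par' v).
  case E: (par' v) => [w|] //=; have [_ cw _] := rs_par sp' (vT v) E.
  have : inr w \in gdom A; last by rewrite inE.
  apply: (fintype.subsetP attA); rewrite attE /att E.
  by have := fr_mem sp' (vT w) cw.
have gf u i : goodf [set: S]%SET col' u i -> valid A u -> goodf A col' u i.
  by case: u => [w|] //= /andP[_ ->] ->.
have gf' : goodf A col' (par v) (col v).
  have := par_goodf sp (vT v); case: (par v) pvA => [w|] //= wA.
  by rewrite wA; have [_ -> _] := eqA w wA; rewrite in_setT.
have E2 : fr H' col' (par v) (col v) = fr H' col' (par' v) (col' v).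
  by rewrite -frE.
have [pE cE] := fr_inj spA' gf' (gf _ _ (par_goodf sp' (vT v)) pvA') E2.
by split=> //; rewrite (rs_hed sp (vT v)) (rs_hed sp' (vT v)) frE // E2.
Qed.

End Rooted.

End RootedKtrees.

(** A finite type, unlike [rel T], so that sums can range over the pairs of a graph and an
    automorphism. *)
Definition graph (T : finType) : finType := {ffun T * T -> bool}.
Definition gadj (T : finType) (g : graph T) : rel T := fun x y => g (x, y).

Record graph_ok (k : nat) (T : finType) (p : graph T * {ffun T -> T}) : Prop := GraphOk {
  gok_ktree : ktree (gadj p.1) k;
  gok_inj : injective p.2;
  gok_aut : forall x y, gadj p.1 (p.2 x) (p.2 y) = gadj p.1 x y
}.

Definition cliques (k : nat) (T : finType) (g : graph T) : {set {set T}} :=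
  [set A | clique (gadj g) k A]%SET.

Definition graph_wt (k : nat) (T : finType) (p : graph T * {ffun T -> T}) : series :=
  cyc px (fun A : {set T} => p.2 @: A)%SET (cliques k.+1 p.1) *
  cyc py (fun A : {set T} => p.2 @: A)%SET (cliques k p.1).

Record rooted_ok (k : nat) (Rt S : finType) (sr : Rt -> Rt)
    (q : graph (Rt + S)%type * {ffun (Rt + S)%type -> (Rt + S)%type}) : Prop := RootedOk {
  rok_graph : graph_ok k q;
  rok_root : {in root_set Rt S &, forall x y, x != y -> gadj q.1 x y};
  rok_perm : forall r, q.2 (inl r) = inl (sr r)
}.

Lemma sum_setU (U : finType) (X Y : {set U}) (F : U -> rat) : [disjoint X & Y] ->
  \sum_(A in (X :|: Y)%SET) F A = \sum_(A in X) F A + \sum_(A in Y) F A.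
Proof. by move=> XY; rewrite -bigU //=; apply: eq_bigl => A; rewrite !inE. Qed.

(** * Correspondence between codes and rooted k-trees with an automorphism *)

Section CodeGraph.
Variables (k : nat) (K Rt S : finType) (kap : Rt -> K) (I : {set K}).
Hypotheses (cardK : #|K| = k.+1) (kapI : injective kap).
Hypothesis (hI1 : forall i j, i \in I -> j != i -> exists r, kap r = j).
Hypothesis (hI2 : forall B : {set Rt}, #|B| = k ->
  exists2 i, i \in I & B = [set r | kap r != i]%SET).
Hypothesis (hR : #|Rt| = k \/ #|Rt| = k.+1).

Local Notation T := (Rt + S)%type.
Local Notation root := (root_set Rt S).

Lemma hed_exists par col : @acyclic S par -> exists H : option S -> {set T},
  H None = root /\ forall v, H (Some v) = (inr v |: fr kap H col (par v) (col v))%SET.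
Proof.
move=> [rk rkP].
(* Recursion on a bound for the rank; any bound above the rank of [v] gives the same hedron, which
   is what [st] states. *)
pose fix hedn n : option S -> {set T} := match n with
  | 0 => fun _ => root
  | n'.+1 => fun u => if u is Some v then
       (inr v |: [set y in hedn n' (par v) | kcol kap col y != col v])%SET else root
  end.
have hN n : hedn n None = root by case: n.
have st n m v : (rk v < n)%N -> (rk v < m)%N -> hedn n (Some v) = hedn m (Some v).
  elim: n m v => // n IH [//|m] v vn vm /=; congr (_ |: _)%SET.
  suff -> : hedn n (par v) = hedn m (par v) by [].
  case E: (par v) => [w|]; last by rewrite !hN.
  by apply: IH; exact: leq_trans (rkP _ _ E) _.
pose N := (\max_v rk v).+1.
exists (hedn N); split=> [|v]; first exact: hN.
rewrite (@st N N.+1) ?ltnS ?(leqW (leq_bigmax v)) ?(leq_bigmax v) //.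
Qed.

Definition code_graph (par : S -> option S) (col : S -> K) (g : graph T) : Prop :=
  [/\ symmetric (gadj g), irreflexive (gadj g) & exists H rk,
    rspec kap I [set: S]%SET par col H rk /\ gspec kap [set: S]%SET par col H (gadj g)].

Let vT (v : S) : v \in [set: S]%SET. Proof. by rewrite in_setT. Qed.

Lemma code_graph_ex par col : acyclic par -> (forall v, par v = None -> col v \in I) ->
  (forall v w, par v = Some w -> col v != col w) -> exists g, code_graph par col g.
Proof.
move=> ac cr cp; have [H [HN HS]] := hed_exists col ac; have [rk rkP] := ac.
have sp : rspec kap I [set: S]%SET par col H rk.
  by split=> // [v w _ pv|v _]; [split; rewrite ?in_setT //; [exact: cp pv|exact: rkP]|exact: cr].
pose g : graph T := [ffun p => match p with
  | (inl a, inl b) => a != b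
  | (inr v, inl a) => inl a \in att kap par col H v
  | (inl a, inr v) => inl a \in att kap par col H v
  | (inr v, inr w) => (inr w \in att kap par col H v) || (inr v \in att kap par col H w) end].
exists g; split.
- move=> [a|v] [b|w]; rewrite /gadj 2!ffunE.
  + by rewrite /= eq_sym.
  + by [].
  + by [].
  + exact: orbC.
- by move=> [a|v]; rewrite /gadj !ffunE ?eqxx // orbb (negbTE (att_irr sp (vT v))).
by exists H, rk; split=> //; split=> *; rewrite /gadj ffunE.
Qed.

Lemma hed_uniq A par col (H H' : option S -> {set T}) rk rk' : rspec kap I A par col H rk ->
  rspec kap I A par col H' rk' -> forall v, v \in A -> H (Some v) = H' (Some v).
Proof.
move=> sp sp'; apply: (rspec_ind sp) => v vA IH.
rewrite (rs_hed sp vA) (rs_hed sp' vA); congr (_ |: _)%SET; apply/setP => x; rewrite !inE.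
by case E: (par v) => [p|]; [rewrite IH|rewrite (rs_root sp) (rs_root sp')].
Qed.

Lemma code_graph_uniq par col g g' : code_graph par col g -> code_graph par col g' -> g = g'.
Proof.
move=> [s i [H [rk [sp gs]]]] [s' i' [H' [rk' [sp' gs']]]].
have attE v : att kap par col H v = att kap par col H' v.
  rewrite /att; apply/setP => x; rewrite !inE.
  by case: (par v) => [p|]; [rewrite (hed_uniq sp sp')|rewrite (rs_root sp) (rs_root sp')].
apply/ffunP => -[[a|v] [b|w]].
- by rewrite -[LHS]/(gadj g _ _) -[RHS]/(gadj g' _ _) (gs_root gs) (gs_root gs').
- by rewrite -[LHS]/(gadj g _ _) -[RHS]/(gadj g' _ _) s s' (gs_l gs) // (gs_l gs') // attE.
- by rewrite -[LHS]/(gadj g _ _) -[RHS]/(gadj g' _ _) (gs_l gs) // (gs_l gs') // attE.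
- by rewrite -[LHS]/(gadj g _ _) -[RHS]/(gadj g' _ _) (gs_r gs) // (gs_r gs') // !attE.
Qed.

Lemma code_graph_inj par col par' col' g :
  code_graph par col g -> code_graph par' col' g -> par =1 par' /\ col =1 col'.
Proof.
move=> [s i [H [rk [sp gs]]]] [s' i' [H' [rk' [sp' gs']]]].
by split=> v; have [] := rspec_uniq cardK kapI hI1 s sp gs sp' gs' v.
Qed.

Lemma domT : gdom Rt [set: S]%SET = [set: T]%SET.
Proof. by apply/setP => -[a|v]; rewrite !inE. Qed.

Lemma code_graph_ktree par col g : code_graph par col g -> ktree (gadj g) k.
Proof.
move=> [s i [H [rk [sp gs]]]]; split=> //; rewrite -domT.
exact: (rooted_ktree cardK kapI hI1 hR s sp gs).
Qed.

Lemma code_graph_root par col g : code_graph par col g ->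
  {in root &, forall x y, x != y -> gadj g x y}.
Proof.
by move=> [s i [H [rk [sp gs]]]]; rewrite -(rs_root sp); exact: (root_clique sp gs).
Qed.

Lemma ktree_code_graph g : ktree (gadj g) k -> {in root &, forall x y, x != y -> gadj g x y} ->
  exists par col, code_graph par col g.
Proof.
move=> [s i kt] eR; rewrite -domT in kt.
have [par [col [H [rk spgs]]]] := rooted_ktree_code cardK kapI hI1 hI2 hR s i eR kt.
by exists par, col; split=> //; exists H, rk.
Qed.

Section Automorphism.
Variables (sg : K -> K) (sr : Rt -> Rt).
Hypotheses (sgI : injective sg) (srI : injective sr).
Hypothesis srg : forall r, kap (sr r) = sg (kap r).
Hypothesis Ist : {in I, forall l, sg l \in I}.

Definition extend (f : S -> S) : {ffun T -> T} :=
  [ffun t : T => match t with inl r => inl (sr r) | inr v => inr (f v) end].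

Lemma extend_inj f : injective f -> injective (extend f).
Proof. by move=> fI [a|v] [b|w]; rewrite !ffunE //= => -[]; [move/srI ->|move/fI ->]. Qed.

Lemma extend_root f : (extend f @: root = root)%SET.
Proof.
apply/setP => -[a|v]; last first.
  by apply/imsetP/imsetP => [[_ /imsetP[r _ ->]]|[]] //; rewrite ffunE.
have [sr' srK srK'] := injF_bij srI.
have -> : inl a \in root by exact: imset_f.
by apply/imsetP; exists (inl (sr' a)); rewrite ?ffunE ?srK' ?imset_f.
Qed.

Lemma extend_fr f (H H' : option S -> {set T}) col col' u u' i :
  (forall v, col' (f v) = sg (col v)) -> (extend f @: H u = H' u')%SET ->
  (extend f @: fr kap H col u i = fr kap H' col' u' (sg i))%SET.
Proof.
move=> colE HE.
have kE x : kcol kap col' (extend f x) = sg (kcol kap col x).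
  by case: x => [r|v]; rewrite ffunE /= ?srg ?colE.
apply/setP => y; rewrite inE -HE; apply/imsetP/andP.
  move=> [x]; rewrite inE => /andP[xH xi] ->; rewrite imset_f // kE.
  by rewrite (inj_eq sgI).
move=> [/imsetP[x xH ->]]; rewrite kE (inj_eq sgI) => xi; exists x => //.
by rewrite inE xH.
Qed.

Lemma code_graph_tr f par col par' col' g g' : injective f ->
  (forall v, par' (f v) = omap f (par v)) -> (forall v, col' (f v) = sg (col v)) ->
  (forall x y, gadj g' (extend f x) (extend f y) = gadj g x y) ->
  code_graph par col g -> code_graph par' col' g'.
Proof.
move=> fI pE cE gE [s i [H [rk [sp gs]]]].
have [f' fK fK'] := injF_bij fI; have [sr' srK srK'] := injF_bij srI.
have eI := extend_inj fI; have [e' eK eK'] := injF_bij eI.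
have pE' v : par' v = omap f (par (f' v)) by rewrite -{1}[v]fK' pE.
pose H' u := (extend f @: H (omap f' u))%SET.
have HE u : (extend f @: H u = H' (omap f u))%SET.
  by rewrite /H'; case: u => [v|] //=; rewrite fK.
have frE u j : (extend f @: fr kap H col u j = fr kap H' col' (omap f u) (sg j))%SET.
  exact: extend_fr.
have exr v : extend f (inr v) = inr (f v) by rewrite ffunE.
have exl r : extend f (inl r) = inl (sr r) by rewrite ffunE.
have attE v : att kap par' col' H' (f v) = (extend f @: att kap par col H v)%SET.
  by rewrite /att frE pE cE.
split.
- by move=> x y; rewrite -[x]eK' -[y]eK' !gE.
- by move=> x; rewrite -[x]eK' gE i.
exists H', (rk \o f'); split; split.
- by rewrite /H' /= (rs_root sp) extend_root.
- move=> v w _; rewrite pE'; case E: (par (f' v)) => [p|] //= [<-].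
  have [_ cp lt] := rs_par sp (vT _) E; split; first by rewrite in_setT.
    by rewrite -(fK' v) !cE (inj_eq sgI).
  by rewrite /= fK.
- move=> v _; rewrite pE'; case E: (par (f' v)) => [p|] //= _.
  by rewrite -(fK' v) cE; apply: Ist; apply: (rs_col sp); rewrite ?in_setT.
- move=> v _; rewrite -{1}[v]fK' -(HE (Some (f' v))) (rs_hed sp) // imsetU1 exr fK'.
  by rewrite frE pE' (_ : col' v = sg (col (f' v))) // -cE fK'.
- by move=> a b; rewrite -[a]srK' -[b]srK' -!exl gE (gs_root gs) (inj_eq srI).
- by move=> v a _; rewrite -[v]fK' -[a]srK' -exr -exl gE (gs_l gs) // attE mem_imset.
- by move=> v w _ _; rewrite -[v]fK' -[w]fK' -!exr gE (gs_r gs) // !attE !mem_imset.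
Qed.

(** Transporting along [extend f] moves the graph and the code together. Since each of them
    determines the other, one is preserved exactly when the other is. *)
Lemma code_graph_aut f par col g : injective f -> code_graph par col g ->
  ((forall v, par (f v) = omap f (par v)) /\ (forall v, col (f v) = sg (col v))) <->
  (forall x y, gadj g (extend f x) (extend f y) = gadj g x y).
Proof.
move=> fI cg; have eI := extend_inj fI; have [e' eK eK'] := injF_bij eI.
have [f' fK fK'] := injF_bij fI.
split=> [[pE cE]|gE].
  pose g' : graph T := [ffun p => gadj g (e' p.1) (e' p.2)].
  have gg' x y : gadj g' (extend f x) (extend f y) = gadj g x y.
    by rewrite /gadj ffunE /= !eK.
  have cg' := code_graph_tr fI pE cE gg' cg.
  by rewrite (code_graph_uniq cg cg') => x y; rewrite gg' (code_graph_uniq cg cg').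
have cg' : code_graph (fun v => omap f (par (f' v))) (fun v => sg (col (f' v))) g.
  by apply: (code_graph_tr fI _ _ gE cg) => v; rewrite fK.
have [pp cc] := code_graph_inj cg cg'.
by split=> v; [rewrite (pp (f v)) fK|rewrite (cc (f v)) fK].
Qed.

Section Weight.
Variables (x : code K S) (g : graph T) (H : option S -> {set T}) (rk : S -> nat).
Hypotheses (xok : code_ok sg I x) (s : symmetric (gadj g)).
Hypothesis sp : rspec kap I [set: S]%SET (cpar x) (ccol x) H rk.
Hypothesis gs : gspec kap [set: S]%SET (cpar x) (ccol x) H (gadj g).

Local Notation phi := (cphi x).
Local Notation col := (ccol x).
Local Notation E := (extend phi).
Local Notation frx := (fr kap H col).

Lemma hed_equiv u : (E @: H u = H (omap phi u))%SET.
Proof.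
have HN : (E @: H None = H None)%SET by rewrite (rs_root sp) extend_root.
case: u => [v|] //=; move: v (vT v); apply: (rspec_ind sp) => v _ IH.
rewrite !(rs_hed sp (vT _)) imsetU1 ffunE; congr (_ |: _)%SET.
rewrite (ok_par xok) (ok_col xok); apply: extend_fr; first exact: (ok_col xok).
by case E1: (cpar x v) => [w|] //; exact: IH.
Qed.

Lemma fr_equiv u j : (E @: frx u j = frx (omap phi u) (sg j))%SET.
Proof. by apply: extend_fr; [exact: (ok_col xok)|exact: hed_equiv]. Qed.

Lemma goodf_T u j : goodf I [set: S]%SET col u j = if u is Some v then j != col v else j \in I.
Proof. by case: u => [v|] //=; rewrite in_setT. Qed.

Lemma valid_T u : valid [set: S]%SET u.
Proof. by case: u => [v|] //=; rewrite in_setT. Qed.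

Definition root_hed : {set {set T}} :=
  if #|Rt| == k.+1 then [set root]%SET else finset.set0.

Lemma cliques_hed : cliques k.+1 g =
  ([set H (Some v) | v in [set: S]] :|: root_hed)%SET.
Proof.
apply/setP => A; rewrite !inE /root_hed; apply/idP/orP => [Acl|[/imsetP[v _ ->]|]].
- have AT : A \subset gdom Rt [set: S]%SET by rewrite domT; exact: finset.subsetT.
  case: (clique_hedE cardK kapI hI1 hR sp gs Acl AT) => [[-> /eqP ->]|[v _ ->]].
    by right; rewrite (rs_root sp) inE.
  by left; exact: imset_f.
- exact: (clique_hed cardK kapI hI1 sp s gs (vT v)).
case: ifP => [/eqP Rk|_]; rewrite inE // => /eqP ->; apply/cliqueP; split.
  by rewrite card_imset ?cardsT // => a b [].
by rewrite -(rs_root sp); exact: (root_clique sp gs).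
Qed.

Lemma cliques_fr : cliques k g =
  ([set frx None j | j in I] :|: [set frx (Some p.1) p.2 | p in code_fronts x])%SET.
Proof.
apply/setP => A; rewrite !inE; apply/idP/orP => [Acl|].
  have AT : A \subset gdom Rt [set: S]%SET by rewrite domT; exact: finset.subsetT.
  have [u [j [ujg ->]]] := clique_frE cardK kapI hI1 hI2 sp gs Acl AT.
  move: ujg; rewrite goodf_T; case: u => [v|] uj; last by left; exact: imset_f.
  by right; apply/imsetP; exists (v, j); rewrite // inE.
have frc u j : goodf I [set: S]%SET col u j -> clique (gadj g) k (frx u j).
  exact: (clique_fr cardK kapI hI1 sp s gs).
case=> [/imsetP[j jI ->]|/imsetP[[v j] vj ->]]; apply: frc; rewrite goodf_T //.
by move: vj; rewrite inE.
Qed.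

Lemma hedS_inj : injective (fun v => H (Some v)).
Proof. by move=> v w /(hed_inj sp (valid_T (Some v)) (valid_T (Some w))) [->]. Qed.

Lemma frN_inj : {in I &, injective (frx None)}.
Proof. by move=> j l jI lI /(fr_inj hI1 sp (u := None) (u' := None) jI lI)[]. Qed.

Lemma frS_inj : {in code_fronts x &, injective (fun p : S * K => frx (Some p.1) p.2)}.
Proof.
move=> [v j] [w l]; rewrite !inE /= => vj wl e.
have gv : goodf I [set: S]%SET col (Some v) j by rewrite goodf_T.
have gw : goodf I [set: S]%SET col (Some w) l by rewrite goodf_T.
by have [[->] ->] := fr_inj hI1 sp gv gw e.
Qed.

Lemma disj_hed : [disjoint [set H (Some v) | v in [set: S]]%SET & root_hed].
Proof.
rewrite disjoint_subset; apply/fintype.subsetP => _ /imsetP[v _ ->]; rewrite inE.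
rewrite /root_hed; case: ifP => _; rewrite inE // -(rs_root sp); apply/negP => /eqP.
by move/(hed_inj sp (valid_T (Some v)) (valid_T None)).
Qed.

Lemma disj_fr : [disjoint [set frx None j | j in I]%SET &
  [set frx (Some p.1) p.2 | p in code_fronts x]%SET].
Proof.
rewrite disjoint_subset; apply/fintype.subsetP => _ /imsetP[j jI ->]; rewrite inE.
apply/negP => /imsetP[[w l]]; rewrite inE /= => wl e.
have gw : goodf I [set: S]%SET col (Some w) l by rewrite goodf_T.
have gj : goodf I [set: S]%SET col None j by [].
by have [] := fr_inj hI1 sp gj gw e.
Qed.

Definition root_wt : series := if #|Rt| == k.+1 then px 1 else 1.

(** The hedra are the root, if it has [k.+1] vertices, and one for each vertex of the forest; the
    fronts are those of the root, named by [I], and those named by [code_fronts]. These names are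
    injective and equivariant, so the cycle monomials multiply. *)
Lemma code_graph_wt : graph_wt k (g, E) = root_wt * cyc py sg I * code_wt sg x.
Proof.
have st := code_fronts_stable xok sgI.
have eS v : (E @: H (Some v) = H (Some (phi v)))%SET by exact: hed_equiv.
have eN j : (E @: frx None j = frx None (sg j))%SET by exact: fr_equiv.
have eF p : (E @: frx (Some p.1) p.2 = frx (Some (colmap phi sg p).1) (colmap phi sg p).2)%SET.
  exact: fr_equiv.
have e1 : cyc px (fun A : {set T} => E @: A)%SET (cliques k.+1 g) =
    cyc px phi [set: S]%SET * root_wt.
  rewrite cliques_hed; apply: etrans (cycU _ disj_hed _ _) _.
  - by move=> _ /imsetP[v _ ->]; rewrite eS imset_f.
  - move=> A; rewrite /root_hed; case: ifP => _; rewrite inE // => /eqP ->.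
    by rewrite extend_root set11.
  congr (_ * _).
    apply/esym/cyc_bij => [v w _ _ /hedS_inj //|v _|v _]; first by rewrite in_setT.
    by rewrite eS.
  rewrite /root_hed /root_wt; case: ifP => _; last exact: cyc0.
  by apply: cyc1; exact: extend_root.
have e2 : cyc py (fun A : {set T} => E @: A)%SET (cliques k g) =
    cyc py sg I * cyc py (colmap phi sg) (code_fronts x).
  rewrite cliques_fr; apply: etrans (cycU _ disj_fr _ _) _.
  - by move=> _ /imsetP[j jI ->]; rewrite eN imset_f //; exact: Ist.
  - move=> _ /imsetP[p px ->]; rewrite eF.
    by apply/imsetP; exists (colmap phi sg p) => //; exact: st.
  congr (_ * _); apply/esym/cyc_bij.
  - exact: frN_inj.
  - exact: Ist.
  - by move=> j _; rewrite eN.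
  - exact: frS_inj.
  - exact: st.
  - by move=> p _; rewrite eF.
apply: etrans (congr2 *%R e1 e2) _.
by rewrite /code_wt [cyc px _ _ * root_wt]mulrC mulrACA.
Qed.

Definition nfix (U : finType) (f : U -> U) : nat := #|[set l | f l == l]%SET|.

(** The colouring identifies the vertices of a hedron with [K], and turns the automorphism into
    [sg], whichever fixed hedron is taken. *)
Lemma fix_in_hed u : #|H u| = k.+1 -> omap phi u = u ->
  #|[set y in H u | E y == y]%SET| = nfix sg.
Proof.
move=> Hk uf; have HI := hed_col_inj kapI sp (valid_T u).
have kE y : kcol kap col (E y) = sg (kcol kap col y).
  by case: y => [r|v]; rewrite ffunE /= ?srg ?(ok_col xok).
have HE y : y \in H u -> E y \in H u by have e := hed_equiv u; rewrite uf in e; move=> yH; rewrite -e imset_f.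
have onto l : exists2 y, y \in H u & kcol kap col y = l.
  have : (kcol kap col @: H u == [set: K])%SET.
    by rewrite eqEcard finset.subsetT cardsT cardK card_in_imset // Hk leqnn.
  by move/eqP/setP/(_ l); rewrite in_setT => /imsetP[y yH ->]; exists y.
rewrite /nfix -(card_in_imset (f := kcol kap col)); last first.
  by move=> y z; rewrite !inE => /andP[yH _] /andP[zH _]; exact: HI.
apply: eq_card => l; rewrite !inE; apply/imsetP/eqP.
  by move=> [y]; rewrite inE => /andP[_ /eqP ye] ->; rewrite -kE ye.
move=> ll; have [y yH yl] := onto l; exists y; rewrite // inE yH /=.
by apply/eqP; apply: HI => //; [exact: HE|rewrite kE yl].
Qed.

Lemma card_front_fix v : phi v = v ->
  (#|[set j | (j != col v) && (sg j == j)]%SET|.+1 = nfix sg)%N.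
Proof.
move=> pv; rewrite /nfix [RHS](cardsD1 (col v)) inE -(ok_col xok) pv eqxx add1n.
by congr _.+1; apply: eq_card => j; rewrite !inE.
Qed.

(** A fixed vertex of the forest contributes [1 - nfix sg] through its hedron and [nfix sg - 1]
    through the fixed fronts that it creates, its own colour being fixed and excluded. These cancel,
    and only the root remains. *)
Lemma code_dissymmetry :
  \sum_(A in cliques k.+1 g | (E @: A == A)%SET) (1 - #|[set y in A | E y == y]%SET|%:R) +
  #|[set A in cliques k g | (E @: A == A)%SET]%SET|%:R =
  (if #|Rt| == k.+1 then 1 - (nfix sg)%:R else 0) + #|[set j in I | sg j == j]%SET|%:R :> rat.
Proof.
have eS v : (E @: H (Some v) == H (Some v))%SET = (phi v == v).
  by rewrite hed_equiv (inj_eq hedS_inj).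
have e1 : \sum_(A in cliques k.+1 g | (E @: A == A)%SET) (1 - #|[set y in A | E y == y]%SET|%:R) =
    \sum_(v | phi v == v) (1 - (nfix sg)%:R) + (if #|Rt| == k.+1 then 1 - (nfix sg)%:R else 0) :> rat.
  rewrite cliques_hed big_mkcondr /= (sum_setU _ disj_hed); congr (_ + _).
    rewrite big_imset /=; last by move=> v w _ _; exact: hedS_inj.
    rewrite [RHS]big_mkcond; apply: eq_big => [v|v _]; first by rewrite in_setT.
    rewrite eS; case: eqP => // pv; rewrite fix_in_hed //= ?pv //.
    exact: (card_hed cardK kapI hI1 sp (vT v)).
  rewrite /root_hed; case: ifP => [/eqP Rk|_]; last by rewrite big_set0.
  rewrite big_set1 extend_root eqxx -(rs_root sp) fix_in_hed //.
  by rewrite (rs_root sp) card_imset ?cardsT // => a b [].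
have e2 : (#|[set A in cliques k g | (E @: A == A)%SET]%SET| =
    #|[set j in I | sg j == j]%SET| + \sum_(v | phi v == v) (nfix sg).-1)%N.
  have frN j : j \in I -> (E @: frx None j == frx None j)%SET = (sg j == j).
    by move=> jI; rewrite fr_equiv /= (inj_in_eq frN_inj) //; exact: Ist.
  have frS p : p \in code_fronts x -> (E @: frx (Some p.1) p.2 == frx (Some p.1) p.2)%SET =
      (colmap phi sg p == p).
    move=> px; rewrite fr_equiv -[frx _ _]/(frx (Some (colmap phi sg p).1) (colmap phi sg p).2).
    by rewrite (inj_in_eq frS_inj) //; exact: (code_fronts_stable xok sgI).
  have -> : [set A in cliques k g | (E @: A == A)%SET]%SET =
      ([set frx None j | j in [set j in I | sg j == j]] :|:
       [set frx (Some p.1) p.2 | p in [set p in code_fronts x | colmap phi sg p == p]])%SET.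
    apply/setP => A; rewrite cliques_fr inE in_setU andb_orl [RHS]in_setU; congr (_ || _).
      apply/andP/imsetP => [[/imsetP[j jI ->]]|[j]].
        by rewrite frN // => ij; exists j; rewrite // inE jI.
      by rewrite inE => /andP[jI jj] ->; rewrite frN // imset_f.
    apply/andP/imsetP => [[/imsetP[p px ->]]|[p]].
      by rewrite frS // => pp; exists p; rewrite // inE px.
    by rewrite inE => /andP[px pp] ->; rewrite frS //; split=> //; apply/imsetP; exists p.
  rewrite cardsU (_ : _ :&: _ = finset.set0)%SET ?cards0 ?subn0; last first.
    apply/eqP; rewrite setI_eq0; apply: disjointWl (disjointWr _ disj_fr).
      by apply/fintype.subsetP => _ /imsetP[j jj ->]; move: jj; rewrite inE => /andP[jI _]; exact: imset_f.
    by apply/fintype.subsetP => _ /imsetP[p pp ->]; move: pp; rewrite inE => /andP[px _];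
      apply/imsetP; exists p.
  rewrite !card_in_imset; first last.
  - by move=> j l; rewrite !inE => /andP[jI _] /andP[lI _]; exact: frN_inj.
  - move=> p q pp qq; move: pp qq; rewrite !inE => /andP[pp _] /andP[qq _].
    by apply: frS_inj; rewrite inE.
  congr (_ + _)%N.
  transitivity (\sum_(v | phi v == v) #|[set j | (j != col v) && (sg j == j)]%SET|)%N.
    rewrite -sum1_card.
    under [RHS]eq_bigr => v _ do rewrite -sum1_card.
    rewrite (pair_big_dep (fun v => phi v == v)
      (fun v j => j \in [set j | (j != col v) && (sg j == j)]%SET) (fun _ _ => 1%N)) /=.
    apply: eq_bigl => -[v j]; rewrite !inE /= /colmap /= xpair_eqE /=.
    by rewrite andbCA.
  by apply: eq_bigr => v /eqP pv; rewrite -(card_front_fix pv).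
have z : \sum_(v | phi v == v) (1 - (nfix sg)%:R) + (\sum_(v | phi v == v) (nfix sg).-1)%:R = 0 :> rat.
  rewrite natr_sum -big_split big1 //= => v /eqP pv.
  by rewrite -(card_front_fix pv) /= -add1n natrD opprD addrA subrr add0r addNr.
rewrite e1 e2 natrD; set c := (if _ then _ else _).
move: z; set p := \sum_(v | _) _; set q := _%:R; set a := _%:R => z.
by rewrite [a + q]addrC addrACA z add0r.
Qed.

End Weight.

Lemma rooted_code (q : graph T * {ffun T -> T}) : rooted_ok k sr q -> exists x : code K S,
  [/\ code_ok sg I x, code_graph (cpar x) (ccol x) q.1 & q.2 = extend (cphi x)].
Proof.
case: q => g psi [[/= kt psiI aut] rt psir].
have [par [col cg]] := ktree_code_graph kt rt.
have psiS v : exists w, psi (inr v) = inr w.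
  case E1: (psi (inr v)) => [r|w]; last by exists w.
  have [sr' srK srK'] := injF_bij srI.
  by move: E1; rewrite -[r]srK' -psir => /psiI.
have [f fP] := choice psiS.
have psiE : psi = extend f by apply/ffunP => -[r|v]; rewrite ffunE ?psir ?fP.
have fI : injective f.
  by move=> v w e; have /psiI[] : psi (inr v) = psi (inr w) by rewrite !fP e.
rewrite psiE in aut; have [pE cE] := (code_graph_aut fI cg).2 aut.
have parE : ([ffun v => par v] : S -> option S) = par by apply/funext => v; rewrite ffunE.
have colE : ([ffun v => col v] : S -> K) = col by apply/funext => v; rewrite ffunE.
exists (finfun f, ([ffun v => par v], [ffun v => col v])).
rewrite /cphi /cpar /ccol /= parE colE; split=> //; last first.
  by rewrite psiE; apply/ffunP => -[r|v]; rewrite !ffunE // ffunE.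
have [_ _ [H [rk [sp gs]]]] := cg.
split; rewrite /cphi /cpar /ccol /= ?parE ?colE.
- by move=> v w; rewrite !ffunE => /fI.
- by exists rk => v w pv; have [_ _] := rs_par sp (vT v) pv.
- by move=> v; exact: (rs_col sp (vT v)).
- by move=> v w pv; have [_ ? _] := rs_par sp (vT v) pv.
- by move=> v; rewrite ffunE pE; case: (par v) => //= w; rewrite ffunE.
- by move=> v; rewrite ffunE cE.
Qed.

Lemma code_rooted (x : code K S) g : code_ok sg I x -> code_graph (cpar x) (ccol x) g ->
  rooted_ok k sr (g, extend (cphi x)).
Proof.
move=> xok cg; have fI := ok_inj xok; split=> /=.
- split=> /=; first exact: code_graph_ktree cg.
    exact: extend_inj.
  by apply: (code_graph_aut fI cg).1; split; [exact: ok_par xok|exact: ok_col xok].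
- exact: code_graph_root cg.
- by move=> r; rewrite ffunE.
Qed.

Lemma sum_rooted :
  \sum_(q : graph T * {ffun T -> T} | `[< rooted_ok k sr q >]) graph_wt k q =
  root_wt * cyc py sg I * \sum_(x : code K S | `[< code_ok sg I x >]) code_wt sg x.
Proof.
have Gex (x : code K S) : exists g : graph T, code_ok sg I x -> code_graph (cpar x) (ccol x) g.
  have [xok|nx] := pselect (code_ok sg I x); last by exists [ffun=> false].
  have [g cg] := code_graph_ex (ok_acyclic xok) (ok_root xok) (ok_proper xok).
  by exists g.
have [G GP] := choice Gex.
pose Ps x : graph T * {ffun T -> T} := (G x, extend (cphi x)).
have PsI : {in [set x | `[< code_ok sg I x >]]%SET &, injective Ps}.
  move=> x y; rewrite !inE => /asboolP xok /asboolP yok [eG /ffunP eE].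
  have cy := GP y yok; rewrite -eG in cy.
  have [pp cc] := code_graph_inj (GP x xok) cy.
  case: x y pp cc eE {xok yok eG cy} => [f [p c]] [f' [p' c']]; rewrite /cpar /ccol /cphi /=.
  move=> pp cc ff; congr (_, (_, _)); apply/ffunP => v; rewrite ?pp ?cc //.
  by have := ff (inr v); rewrite !ffunE => -[].
rewrite mulr_sumr [RHS](eq_bigr (fun x => graph_wt k (Ps x))); last first.
  move=> x /asboolP xok; have [s i [H [rk [sp gs]]]] := GP x xok.
  by rewrite (code_graph_wt xok s sp gs).
rewrite [RHS](eq_bigl (fun x => x \in [set x | `[< code_ok sg I x >]]%SET)); last first.
  by move=> x; rewrite [RHS]inE.
have bi := @big_imset series 0 +%R _ _ Ps _ (@graph_wt k T) PsI.
apply: etrans bi; apply: eq_bigl => q.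
apply/asboolP/imsetP => [qok|[x]]; last first.
  by rewrite inE => /asboolP xok ->; apply: code_rooted => //; exact: GP.
have [x [xok cg e]] := rooted_code qok; exists x; first by rewrite inE; apply/asboolP.
by rewrite /Ps -e (code_graph_uniq (GP x xok) cg); case: (q).
Qed.

Lemma rooted_dissymmetry (q : graph T * {ffun T -> T}) : rooted_ok k sr q ->
  \sum_(A in cliques k.+1 q.1 | (q.2 @: A == A)%SET) (1 - #|[set y in A | q.2 y == y]%SET|%:R) +
  #|[set A in cliques k q.1 | (q.2 @: A == A)%SET]%SET|%:R =
  (if #|Rt| == k.+1 then 1 - (nfix sg)%:R else 0) + #|[set j in I | sg j == j]%SET|%:R :> rat.
Proof.
move=> /rooted_code[x [xok [s i [H [rk [sp gs]]]] ->]].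
exact: (code_dissymmetry xok s sp gs).
Qed.

End Automorphism.
End CodeGraph.

(** * Double counting of rooted k-trees *)

Lemma clique_imset (T V : finType) (h : T -> V) (e : rel T) (e' : rel V) j (A : {set T}) :
  injective h -> (forall x y, e' (h x) (h y) = e x y) -> clique e' j (h @: A)%SET = clique e j A.
Proof.
move=> hI ee; rewrite /clique card_imset //; congr (_ && _); apply/forall_inP/forall_inP => H x xA.
  apply/forall_inP => y yA; apply/implyP => xy; rewrite -ee.
  have /forall_inP/(_ (h y) (imset_f _ yA))/implyP := H _ (imset_f h xA); apply.
  by rewrite (inj_eq hI).
case/imsetP: xA => a aA ->; apply/forall_inP => _ /imsetP[b bA ->].
have /forall_inP/(_ b bA) := H a aA.
by rewrite (inj_eq hI) ee.
Qed.

Section Transport.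
Variables (T V : finType) (h : T -> V) (h' : V -> T).
Hypotheses (hK : cancel h h') (hK' : cancel h' h).

Let hI : injective h := can_inj hK.

Lemma ktree_on_imset (e : rel T) (e' : rel V) k S :
  (forall x y, e' (h x) (h y) = e x y) -> ktree_on e k S -> ktree_on e' k (h @: S)%SET.
Proof.
move=> ee; elim=> {S} [S Sk|S v A _ IH vS AS Ak eA].
  by apply: KtreeBase; rewrite (clique_imset _ _ hI ee).
rewrite imsetU1; apply: (@KtreeStep _ _ _ _ _ (h @: A)%SET) => //.
- by rewrite mem_imset.
- exact: imsetS.
- by rewrite (clique_imset _ _ hI ee).
- by move=> x /imsetP[y yS ->]; rewrite ee mem_imset ?eA.
Qed.

Lemma ktree_imset (e : rel T) (e' : rel V) k :
  (forall x y, e' (h x) (h y) = e x y) -> ktree e k -> ktree e' k.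
Proof.
move=> ee [es ei kt]; split.
- by move=> x y; rewrite -(hK' x) -(hK' y) !ee es.
- by move=> x; rewrite -(hK' x) ee ei.
- have -> : [set: V] = (h @: [set: T])%SET.
    by apply/setP => y; rewrite in_setT -(hK' y) imset_f ?in_setT.
  exact: ktree_on_imset kt.
Qed.

Definition giso (q : graph T * {ffun T -> T}) (p : graph V * {ffun V -> V}) : Prop :=
  (forall x y, gadj p.1 (h x) (h y) = gadj q.1 x y) /\ forall x, p.2 (h x) = h (q.2 x).

Definition transport (q : graph T * {ffun T -> T}) : graph V * {ffun V -> V} :=
  ([ffun z => q.1 (h' z.1, h' z.2)], [ffun y => h (q.2 (h' y))]).

Lemma giso_transport q : giso q (transport q).
Proof.
by split=> [x y|x]; rewrite /gadj ffunE /= ?hK // hK.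
Qed.

Section Iso.
Variables (q : graph T * {ffun T -> T}) (p : graph V * {ffun V -> V}).
Hypothesis qp : giso q p.

Lemma graph_ok_iso k : graph_ok k q -> graph_ok k p.
Proof.
move=> [kt qI aut]; split.
- exact: ktree_imset qp.1 kt.
- by move=> x y; rewrite -(hK' x) -(hK' y) !qp.2 => /hI/qI ->.
- by move=> x y; rewrite -(hK' x) -(hK' y) !qp.2 !qp.1 aut.
Qed.

Lemma imset_iso (A : {set T}) : (p.2 @: (h @: A) = h @: (q.2 @: A))%SET.
Proof. by rewrite -!imset_comp; apply: eq_imset => x /=; exact: qp.2. Qed.

Lemma fixed_iso (A : {set T}) : (p.2 @: (h @: A) == h @: A)%SET = (q.2 @: A == A)%SET.
Proof. by rewrite imset_iso (inj_eq (imset_inj hI)). Qed.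

Lemma cliques_iso j : cliques j p.1 = ((fun A : {set T} => h @: A) @: cliques j q.1)%SET.
Proof.
apply/setP => B; have -> : B = (h @: (h' @: B))%SET.
  by rewrite -imset_comp -[LHS]imset_id; apply: eq_imset => x /=; rewrite hK'.
by rewrite (mem_imset _ _ (imset_inj hI)) inE [RHS]inE (clique_imset _ _ hI qp.1).
Qed.

Lemma card_fix_iso (A : {set T}) :
  (#|[set y in h @: A | p.2 y == y]| = #|[set y in A | q.2 y == y]|)%SET.
Proof.
rewrite -(card_imset _ hI); apply: eq_card => y; rewrite inE.
apply/andP/imsetP => [[/imsetP[x xA ->]]|[x]].
  by rewrite qp.2 (inj_eq hI) => xx; exists x; rewrite // inE xA.
by rewrite inE => /andP[xA xx] ->; rewrite imset_f // qp.2 (eqP xx).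
Qed.

Lemma graph_wt_iso k : graph_ok k q -> graph_wt k p = graph_wt k q.
Proof.
move=> [_ qI aut]; have e j (F : nat -> series) : cyc F (fun A : {set V} => p.2 @: A)%SET (cliques j p.1) =
    cyc F (fun A : {set T} => q.2 @: A)%SET (cliques j q.1).
  rewrite cliques_iso; apply/esym/cyc_bij => [A B _ _ /(imset_inj hI)//|A|A _].
    by rewrite !inE => Aj; rewrite (clique_imset _ _ qI aut).
  by rewrite imset_iso.
exact: (congr2 *%R (e k.+1 px) (e k py)).
Qed.

Lemma sum_fixed_iso j (F : bool -> nat -> rat) :
  \sum_(A in cliques j p.1) F (p.2 @: A == A)%SET #|[set y in A | p.2 y == y]%SET| =
  \sum_(A in cliques j q.1) F (q.2 @: A == A)%SET #|[set y in A | q.2 y == y]%SET|.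
Proof.
rewrite cliques_iso big_imset /=; last by move=> A B _ _ /(imset_inj hI).
by apply: eq_bigr => A _; rewrite fixed_iso card_fix_iso.
Qed.

End Iso.
End Transport.

Lemma transportK (T V : finType) (h : T -> V) (h' : V -> T) :
  cancel h h' -> cancel (transport h h') (transport h' h).
Proof.
move=> hK [g f]; congr pair; apply/ffunP; last by move=> x; rewrite !ffunE /= !hK.
by case=> x y; rewrite !ffunE /= !hK.
Qed.

Section RootCount.
Variables (Rt S V : finType).
Hypothesis cardV : #|V| = (#|Rt| + #|S|)%N.

Local Notation T := (Rt + S)%type.
Local Notation root := (root_set Rt S).

Lemma card_root : #|root| = #|Rt|.
Proof. by rewrite card_imset ?cardsT // => a b []. Qed.

Lemma card_embeddings : #|[set e : {ffun T -> V} | injectiveb e]%SET| = (#|V|)`!.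
Proof. by rewrite card_inj_ffuns card_sum -cardV ffactnn. Qed.

Lemma card_embeddings_root (A : {set V}) : #|A| = #|Rt| ->
  #|[set e : {ffun T -> V} | injectiveb e & (e @: root == A)%SET]%SET| =
  ((#|Rt|)`! * (#|S|)`!)%N.
Proof.
move=> cA.
pose f (e : {ffun T -> V}) : {ffun Rt -> V} * {ffun S -> V} :=
  ([ffun r => e (inl r)], [ffun s => e (inr s)]).
pose X := [set f in ffun_on A | injectiveb f]%SET : {set {ffun Rt -> V}}.
pose Y := [set f in ffun_on (~: A)%SET | injectiveb f]%SET : {set {ffun S -> V}}.
have fI : injective f.
  move=> a b [/ffunP e1 /ffunP e2]; apply/ffunP => -[r|s].
    by have := e1 r; rewrite !ffunE.
  by have := e2 s; rewrite !ffunE.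
rewrite -(card_imset _ fI) (_ : (f @: _)%SET = (setX X Y)).
  rewrite cardsX !card_inj_ffuns_on cA ffactnn cardsCs setCK cardV cA.
  by rewrite addnC addnK ffactnn.
apply/setP => -[a b]; rewrite in_setX; apply/imsetP/andP.
  move=> [e]; rewrite inE => /andP[/injectiveP eI /eqP eA] [-> ->]; rewrite !inE; split.
    apply/andP; split; last by apply/injectiveP => r r'; rewrite !ffunE => /eI[].
    by apply/ffun_onP => r; rewrite ffunE -eA imset_f // imset_f.
  apply/andP; split; last by apply/injectiveP => r r'; rewrite !ffunE => /eI[].
  apply/ffun_onP => s; rewrite ffunE inE -eA mem_imset //.
  by apply/imsetP => -[].
rewrite !inE => -[/andP[/ffun_onP aA /injectiveP aI] /andP[/ffun_onP bA /injectiveP bI]].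
exists [ffun z : T => match z with inl r => a r | inr s => b s end]; last first.
  by congr pair; apply/ffunP => r; rewrite !ffunE.
have dis r s : a r <> b s by move=> e; have := bA s; rewrite inE -e aA.
rewrite inE; apply/andP; split.
  apply/injectiveP => -[r|s] [r'|s']; rewrite !ffunE => // e.
  - by rewrite (aI _ _ e).
  - by case: (dis _ _ e).
  - by case: (dis _ _ (esym e)).
  - by rewrite (bI _ _ e).
rewrite eqEcard cA; apply/andP; split.
  by apply/fintype.subsetP => _ /imsetP[_ /imsetP[r _ ->] ->]; rewrite ffunE.
rewrite -imset_comp card_imset ?cardsT // => r r' /=; rewrite !ffunE; exact: aI.
Qed.

Variables (k : nat) (zeta : nat -> rat).

(** [zeta] weighs a root by the number of its fixed vertices; it will be the constant [1] for fronts
    and [1 - n] for hedra. *)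
Definition root_val (q : graph T * {ffun T -> T}) : rat :=
  if (root \in cliques #|Rt| q.1) && (q.2 @: root == root)%SET
  then zeta #|[set y in root | q.2 y == y]%SET| else 0.

Lemma root_fixP (q : graph T * {ffun T -> T}) : injective q.2 ->
  (q.2 @: root = root)%SET -> exists sr : {perm Rt}, forall r, q.2 (inl r) = inl (sr r).
Proof.
move=> qI qr.
have ex r : exists r', q.2 (inl r) = inl r'.
  have : q.2 (inl r) \in root by rewrite -qr imset_f // imset_f.
  by case/imsetP => r' _ ->; exists r'.
have [f fP] := choice ex.
have fI : injective f.
  by move=> a b e; have /qI[] : q.2 (inl a) = q.2 (inl b) by rewrite !fP e.
by exists (perm fI) => r; rewrite permE.
Qed.

Lemma root_val_sum (q : graph T * {ffun T -> T}) : graph_ok k q ->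
  root_val q = \sum_(sr : {perm Rt} | `[< rooted_ok k sr q >]) zeta (nfix sr).
Proof.
move=> qok; rewrite /root_val; case: ifP => [/andP[]|nq]; last first.
  rewrite big1 // => sr /asboolP[_ rr qs]; case/negP: nq; apply/andP; split.
    rewrite inE /clique card_root eqxx; apply/forall_inP => x xr; apply/forall_inP => y yr.
    by apply/implyP => /rr; apply.
  have -> : (q.2 @: root == root)%SET = (q.2 @: root \subset root)%SET.
    by rewrite eqEcard (card_imset _ (gok_inj qok)) leqnn andbT.
  by apply/fintype.subsetP => _ /imsetP[_ /imsetP[r _ ->] ->]; rewrite qs imset_f.
rewrite inE => /andP[_ /forall_inP rr] /eqP qr.
have [sr qs] := root_fixP (gok_inj qok) qr.
rewrite (big_pred1 sr) => [|t].
  congr zeta; rewrite /nfix -(card_imset _ (f := @inl Rt S)) => [|a b []//].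
  apply: eq_card => y; rewrite inE; apply/andP/imsetP => [[/imsetP[r _ ->]]|[r]].
    by rewrite qs => /eqP[rE]; exists r; rewrite // inE rE.
  by rewrite inE => /eqP rE ->; rewrite imset_f // qs rE.
apply/asboolP/eqP => [[_ _ qt]|->].
  by apply/permP => r; have := qs r; rewrite qt => -[].
split=> // x y xr yr xy; have /forall_inP/(_ y yr)/implyP := rr x xr; exact.
Qed.

Lemma sum_root_val :
  \sum_(q : graph T * {ffun T -> T} | `[< graph_ok k q >]) root_val q *: graph_wt k q =
  \sum_(sr : {perm Rt}) zeta (nfix sr) *:
     \sum_(q : graph T * {ffun T -> T} | `[< rooted_ok k sr q >]) graph_wt k q.
Proof.
under [RHS]eq_bigr => sr _ do rewrite scaler_sumr.
rewrite [RHS](exchange_big_dep (fun q => `[< graph_ok k q >])) /=; last first.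
  by move=> sr q _ /asboolP[qok _ _]; exact/asboolP.
by apply: eq_bigr => q /asboolP qok; rewrite root_val_sum // scaler_suml.
Qed.

Lemma clique_sum_embeddings (p : graph V * {ffun V -> V}) (z : {set V} -> rat) :
  (\sum_(A in cliques #|Rt| p.1 | (p.2 @: A == A)%SET) z A) *+ ((#|Rt|)`! * (#|S|)`!) =
  \sum_(e : {ffun T -> V} | injectiveb e)
    if ((e @: root)%SET \in cliques #|Rt| p.1) && (p.2 @: (e @: root) == e @: root)%SET
    then z (e @: root)%SET else 0.
Proof.
rewrite -sumrMnl -big_mkcondr /=.
rewrite [RHS](partition_big (fun e : {ffun T -> V} => e @: root)%SET
  (fun A => (A \in cliques #|Rt| p.1) && (p.2 @: A == A)%SET)) /=; last by move=> e /andP[].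
apply: eq_bigr => A /andP[Ac pA].
have cA : #|A| = #|Rt| by move: Ac; rewrite inE => /andP[/eqP].
rewrite -(card_embeddings_root cA) -sumr_const; apply: eq_big => [e|e].
  rewrite inE [in RHS]andbC; case: eqP => [->|_]; rewrite ?andbF //=.
  by rewrite Ac pA !andbT.
by rewrite inE => /andP[_ /eqP ->].
Qed.

(** Count the pairs of [p] and a bijection [e] from [Rt + S] to [V] that sends the root to a fixed
    clique [A]. Each [(p, A)] arises from |Rt|! |S|! bijections, while transport along [e] gives the
    same sum for each of the |V|! bijections. *)
Lemma root_count :
  (\sum_(p : graph V * {ffun V -> V} | `[< graph_ok k p >])
     (\sum_(A in cliques #|Rt| p.1 | (p.2 @: A == A)%SET)
        zeta #|[set y in A | p.2 y == y]%SET|) *: graph_wt k p)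
    *+ ((#|Rt|)`! * (#|S|)`!) =
  (\sum_(sr : {perm Rt}) zeta (nfix sr) *:
     \sum_(q : graph T * {ffun T -> T} | `[< rooted_ok k sr q >]) graph_wt k q) *+ (#|V|)`!.
Proof.
rewrite -sum_root_val -sumrMnl.
under eq_bigr => p _ do rewrite scalerMnl clique_sum_embeddings scaler_suml.
rewrite exchange_big /= -card_embeddings -sumr_const.
apply: eq_big => [e|e /injectiveP eI]; first by rewrite inE.
have [e' eK eK'] : bijective e by apply: inj_card_bij eI _; rewrite card_sum -cardV.
rewrite [LHS](reindex_onto (transport e e') (transport e' e)) /=; last first.
  by move=> [g f] _; exact: transportK.
have okE q : `[< graph_ok k (transport e e' q) >] = `[< graph_ok k q >].
  have qp := giso_transport eK q.
  apply: asbool_equiv_eq; split=> [pok|]; last exact: (graph_ok_iso eK eK' qp).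
  apply: (graph_ok_iso eK' eK _ pok); split=> [x y|x].
    by rewrite -(eK' x) -(eK' y) qp.1 !eK.
  by rewrite -(eK' x) qp.2 !eK.
apply: eq_big => [q|q]; first by rewrite (transportK eK) eqxx andbT okE.
rewrite okE => /andP[/asboolP qok _]; have qp := giso_transport eK q.
rewrite (fixed_iso eK qp) (cliques_iso eK eK' qp) (mem_imset _ _ (imset_inj eI)).
rewrite (graph_wt_iso eK eK' qp qok); apply: (congr1 (fun z => z *: _)).
by rewrite /root_val (card_fix_iso eK qp).
Qed.

End RootCount.

(** * Dissymmetry *)

Lemma dissymmetry_iso (T V : finType) (h : T -> V) (h' : V -> T)
    (q : graph T * {ffun T -> T}) (p : graph V * {ffun V -> V}) k :
  cancel h h' -> cancel h' h -> giso h q p ->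
  \sum_(A in cliques k.+1 p.1 | (p.2 @: A == A)%SET) (1 - #|[set y in A | p.2 y == y]%SET|%:R) +
  #|[set A in cliques k p.1 | (p.2 @: A == A)%SET]%SET|%:R =
  \sum_(A in cliques k.+1 q.1 | (q.2 @: A == A)%SET) (1 - #|[set y in A | q.2 y == y]%SET|%:R) +
  #|[set A in cliques k q.1 | (q.2 @: A == A)%SET]%SET|%:R :> rat.
Proof.
move=> hK hK' qp; rewrite !big_mkcondr /=; congr (_ + _%:R).
  exact: (sum_fixed_iso hK hK' qp _ (fun b n => if b then 1 - n%:R else 0)).
rewrite (cliques_iso hK hK' qp) -(card_imset _ (imset_inj (can_inj hK))).
apply: eq_card => A; rewrite inE; apply/andP/imsetP => [[/imsetP[B Bc ->]]|[B]].
  by rewrite (fixed_iso hK qp) => BB; exists B; rewrite // inE Bc.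
by rewrite inE => /andP[Bc BB] ->; rewrite imset_f // (fixed_iso hK qp).
Qed.

Section Roots.
Variable k : nat.

(** Together with the next three lemmas, this provides the two roots to which the rooted theory
    applies: a hedron coloured by [id] with all colours, and a front coloured by [lift ord0], which
    misses only [ord0]. *)
Lemma hed_I1 (i j : 'I_k.+1) : i \in [set: 'I_k.+1]%SET -> j != i -> exists r, id r = j.
Proof. by exists j. Qed.

Lemma hed_I2 (B : {set 'I_k.+1}) : #|B| = k ->
  exists2 i, i \in [set: 'I_k.+1]%SET & B = [set r | id r != i]%SET.
Proof.
move=> Bk; have : #|~: B|%SET = 1 by rewrite cardsCs setCK card_ord Bk subSnn.
move/eqP/cards1P => [i iE]; exists i; first by rewrite in_setT.
by apply/setP => r; rewrite [RHS]inE -in_set1 -iE inE negbK.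
Qed.

Lemma fr_I1 (i j : 'I_k.+1) : i \in [set ord0]%SET -> j != i -> exists r, lift ord0 r = j.
Proof.
by move=> /set1P -> j0; case: (unliftP ord0 j) j0 => [r ->|->]; [exists r|rewrite eqxx].
Qed.

Lemma fr_I2 (B : {set 'I_k}) : #|B| = k ->
  exists2 i, i \in [set ord0]%SET & B = [set r | lift ord0 r != i :> 'I_k.+1]%SET.
Proof.
move=> Bk; exists ord0; first by rewrite set11.
apply/eqP; rewrite eqEcard Bk -[X in (_ <= X)%N](card_ord k) max_card andbT.
by apply/fintype.subsetP => r _; rewrite inE eq_sym neq_lift.
Qed.

(** Take as root the fixed clique given by [fixed_clique]; [rooted_dissymmetry] leaves the root
    terms. For a front this is the single colour [ord0]; for a hedron it is [1 - nfix sr] plus the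
    [nfix sr] fixed fronts of the root. *)
Lemma dissymmetry (V : finType) (p : graph V * {ffun V -> V}) : graph_ok k p ->
  \sum_(A in cliques k.+1 p.1 | (p.2 @: A == A)%SET) (1 - #|[set y in A | p.2 y == y]%SET|%:R) +
  #|[set A in cliques k p.1 | (p.2 @: A == A)%SET]%SET|%:R = 1 :> rat.
Proof.
move=> pok; have [[es ei kt] pI aut] := pok.
have pT : (p.2 @: [set: V] = [set: V])%SET.
  by apply/eqP; rewrite eqEcard finset.subsetT (card_imset _ pI) leqnn.
have [A [pA Acl]] := fixed_clique es ei pI aut kt pT.
(* The vertices are renamed so that the fixed clique becomes the root [Rt] of a sum type. *)
have pull (Rt : finType) : #|A| = #|Rt| -> clique (gadj p.1) #|Rt| A ->
    exists (S : finType) (h : Rt + S -> V) h' (q : graph (Rt + S)%type * {ffun _ -> _}),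
    [/\ cancel h h', cancel h' h, giso h q p & exists sr : {perm Rt}, rooted_ok k sr q].
  move=> cA clA; pose S := 'I_(#|V| - #|Rt|).
  have cV : #|V| = (#|Rt| + #|S|)%N by rewrite card_ord subnKC // -cA max_card.
  have /card_gt0_ex[h] : (0 < #|[set e : {ffun Rt + S -> V} |
      injectiveb e & (e @: root_set Rt S == A)%SET]%SET|)%N.
    by rewrite (card_embeddings_root cV cA) muln_gt0 !fact_gt0.
  rewrite inE => /andP[/injectiveP hI /eqP hA].
  have [h' hK hK'] : bijective h by apply: inj_card_bij hI _; rewrite card_sum -cV.
  exists S, h, h', (transport h' h p); have qp : giso h (transport h' h p) p.
    by have := giso_transport hK (transport h' h p); rewrite transportK.
  have pq : giso h' p (transport h' h p) := giso_transport hK' p.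
  split=> //; have qok : graph_ok k (transport h' h p) := graph_ok_iso hK' hK pq pok.
  have qr : ((transport h' h p).2 @: root_set Rt S = root_set Rt S)%SET.
    by apply/eqP; rewrite -(fixed_iso hK qp) hA pA.
  have [sr qs] := root_fixP (gok_inj qok) qr; exists sr; split=> // x y xr yr xy.
  case/andP: clA => _ /forall_inP/(_ (h x)); rewrite -hA imset_f // => /(_ isT)/forall_inP.
  by move=> /(_ (h y)); rewrite imset_f // => /(_ isT); rewrite (inj_eq hI) xy qp.1.
have cA j : clique (gadj p.1) j A -> #|A| = j by case/andP => /eqP.
case: Acl => Acl.
  have := pull 'I_k; rewrite card_ord (cA _ Acl) => /(_ erefl Acl).
  move=> [S [h [h' [q [hK hK' qp [sr rok]]]]]]; rewrite (dissymmetry_iso k hK hK' qp).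
  rewrite (rooted_dissymmetry (sg := Delta sr) (card_ord _) (@lift_inj _ ord0) fr_I1 fr_I2
    (or_introl (card_ord k)) perm_inj perm_inj _ _ rok).
  - rewrite card_ord ltn_eqF // add0r; apply/eqP; rewrite pnatr_eq1; apply/cards1P; exists ord0.
    by apply/setP => j; rewrite !inE; case: eqP => // ->; rewrite Delta0 eqxx.
  - by move=> r; exact: (esym (Delta_lift sr r)).
  - by move=> j /set1P ->; rewrite Delta0 set11.
have := pull 'I_k.+1; rewrite card_ord (cA _ Acl) => /(_ erefl Acl).
move=> [S [h [h' [q [hK hK' qp [sr rok]]]]]]; rewrite (dissymmetry_iso k hK hK' qp).
rewrite (rooted_dissymmetry (sg := sr) (card_ord _) (@inj_id _) hed_I1 hed_I2
  (or_intror (card_ord _)) perm_inj perm_inj _ _ rok) //.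
rewrite card_ord eqxx /nfix; set a := #|_|; set b := #|_|.
by rewrite (_ : b = a) ?subrK //; apply: eq_card => j; rewrite !inE.
Qed.

End Roots.

(** * Burnside's lemma *)

(** If [r x] lies in the orbit of [x], the [a] with [to x a = r x] form a coset of the stabilizer of
    [x]; otherwise there are none. The sum thus becomes the usual orbit count on the set [Y] of the
    first kind of points. *)
Lemma twisted_Frobenius_Cauchy (gT : finGroupType) (D : finType)
    (to : {action gT &-> D}) (X : {set D}) (r : D -> D) :
  {in X, forall x a, to x a \in X} -> (forall x a, r (to x a) = to (r x) a) ->
  (\sum_(x in X) #|[set a | to x a == r x]%SET| =
   #|[set orbit to [set: gT] x | x in [set x in X | r x \in orbit to [set: gT] x]]%SET|
     * #|gT|)%N.
Proof.
move=> toX rto; pose Y := [set x in X | r x \in orbit to [set: gT] x]%SET.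
have toY : [acts [set: gT], on Y | to].
  apply/actsP => a _ x.
  have im y b : y \in Y -> to y b \in Y.
    rewrite !inE => /andP[yX /orbitP[c _ yc]]; rewrite toX //=; apply/orbitP.
    by exists (b^-1 * c * b)%g; rewrite ?in_setT // !actM actK yc rto.
  by apply/idP/idP => [/(im _ a^-1%g)|/im //]; rewrite actK.
rewrite -[#|gT|]cardsT -(Frobenius_Cauchy toY).
rewrite (eq_bigl (fun x => x \in X)) // [LHS](bigID (fun x => r x \in orbit to [set: gT] x)) /=.
rewrite [X in (_ + X)%N]big1 ?addn0 => [|x /andP[_ nx]]; last first.
  apply/eqP; rewrite cards_eq0; apply: contraNT nx => /finset.set0Pn[a].
  by rewrite inE => /eqP xa; apply/orbitP; exists a.
transitivity (\sum_(x in Y) #|[set a | to x a == x]%SET|)%N.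
  apply: eq_big => [x|x /andP[_ /orbitP[b _ xb]]]; first by rewrite !inE.
  rewrite -(card_imset _ (mulIg b)); apply: eq_card => a; rewrite inE.
  apply/eqP/imsetP => [xa|[c]]; last by rewrite inE => /eqP cx ->; rewrite actM cx.
  exists (a * b^-1)%g; last by rewrite mulgKV.
  by rewrite inE actM xa -xb actK.
under eq_bigr => x _ do rewrite -sum1_card.
under [RHS]eq_bigr => a _ do rewrite -sum1_card.
rewrite (exchange_big_dep (fun a => a \in [set: gT]%SET)) /=; last by move=> x a _ _; rewrite in_setT.
apply: eq_bigr => a _; apply: eq_bigl => x; rewrite in_setI; congr (_ && _).
by apply/idP/afix1P => [|xa]; rewrite inE ?xa // => /eqP.
Qed.

Section Labelled.
Import classical_sets functions cardinality fsbigop.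
Variables (k : nat) (U W : finType).

Lemma lgraph_iso_sym (t t' : lgraph U W) : lgraph_iso t t' -> lgraph_iso t' t.
Proof.
move=> [f [[g fK gK] fe fh ff]]; exists g; split.
- by exists f.
- by move=> x y; rewrite -fe !gK.
- by move=> u; rewrite fh -imset_comp -[LHS]imset_id; apply: eq_imset => x /=; rewrite fK.
- by move=> u; rewrite ff -imset_comp -[LHS]imset_id; apply: eq_imset => x /=; rewrite fK.
Qed.

Lemma lgraph_iso_trans (t t' t'' : lgraph U W) :
  lgraph_iso t t' -> lgraph_iso t' t'' -> lgraph_iso t t''.
Proof.
move=> [f [fb fe fh ff]] [g [gb ge gh gf]]; exists (g \o f); split.
- exact: bij_comp.
- by move=> x y /=; rewrite ge fe.
- by move=> u; rewrite gh fh -imset_comp.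
- by move=> u; rewrite gf ff -imset_comp.
Qed.

Lemma lgraph_iso_relabel (pi : {perm U}) (tau : {perm W}) (t t' : lgraph U W) :
  lgraph_iso (relabel pi tau t) (relabel pi tau t') <-> lgraph_iso t t'.
Proof.
split=> -[f [fb fe fh ff]]; exists f; split => // u /=; rewrite -?fh -?ff //.
  by rewrite -(permKV pi u); exact: fh.
by rewrite -(permKV tau u); exact: ff.
Qed.

Lemma labeled_ktree_iso (t t' : lgraph U W) :
  lgraph_iso t t' -> labeled_ktree k t -> labeled_ktree k t'.
Proof.
move=> [f [[g fK gK] fe fh ff]] [kt hb fb]; have fI := can_inj fK.
have key (X : finType) j (h : X -> {set 'I_(gorder t)}) (h' : X -> {set 'I_(gorder t')}) :
    (forall x, h' x = (f @: h x)%SET) -> set_bij [set: X] [set A | clique (@gedge _ _ t) j A] h ->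
    set_bij [set: X] [set A | clique (@gedge _ _ t') j A] h'.
  move=> hh [h1 h2 h3]; split.
  - by move=> x _ /=; rewrite hh (clique_imset _ _ fI fe); exact: h1.
  - by move=> x y _ _; rewrite !hh => /(imset_inj fI) e; apply: h2; rewrite ?in_setT.
  - move=> A /= Acl; have AE : A = (f @: (g @: A))%SET.
      by rewrite -imset_comp -[LHS]imset_id; apply: eq_imset => x /=; rewrite gK.
    have [|x _ xE] := h3 (g @: A)%SET.
      by move: Acl; rewrite {1}AE (clique_imset _ _ fI fe).
    by exists x; rewrite // hh xE -AE.
split; [exact (ktree_imset fK gK fe kt)|exact: key hb|exact: key fb].
Qed.

Local Notation N := (#|U| + k)%N.
(** By [labeled_ktree_order] a k-tree with hedra labelled by [U] has [#|U| + k] vertices, so finite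
    data on these vertices represent all labelled k-trees, and isomorphism is the action of
    ['S_N]. *)
Definition ldata : finType :=
  (graph 'I_N * ({ffun U -> {set 'I_N}} * {ffun W -> {set 'I_N}}))%type.

Definition lgraph_of (d : ldata) : lgraph U W := LGraph (gadj d.1) d.2.1 d.2.2.

Definition ldata_act (d : ldata) (f : 'S_N) : ldata :=
  ([ffun z => d.1 (f^-1 z.1, f^-1 z.2)%g],
   ([ffun u => (f @: d.2.1 u)%SET], [ffun v => (f @: d.2.2 v)%SET])).

Lemma ldata_act1 : ldata_act^~ 1%g =1 id.
Proof.
move=> [g [h f]]; rewrite /ldata_act /=; congr (_, (_, _)); apply/ffunP => x; rewrite ffunE.
- by case: x => x y; rewrite !invg1 !perm1.
- by rewrite -[RHS]imset_id; apply: eq_imset => y; rewrite perm1.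
- by rewrite -[RHS]imset_id; apply: eq_imset => y; rewrite perm1.
Qed.

Lemma ldata_actM d : act_morph ldata_act d.
Proof.
move=> a b; case: d => g [h f]; rewrite /ldata_act /=.
congr (_, (_, _)); apply/ffunP => x; rewrite !ffunE /=.
- by rewrite !invMg !permM.
- by rewrite -imset_comp; apply: eq_imset => y; rewrite permM.
- by rewrite -imset_comp; apply: eq_imset => y; rewrite permM.
Qed.

Definition ldata_action : {action 'S_N &-> ldata} := TotalAction ldata_act1 ldata_actM.

Lemma lgraph_of_iso (d d' : ldata) :
  lgraph_iso (lgraph_of d) (lgraph_of d') <-> exists f : 'S_N, d' = ldata_act d f.
Proof.
split=> [[f [fb fe fh ff]]|[f ->]].
  have [p pE] : exists p : 'S_N, p =1 f by exists (perm (bij_inj fb)) => x; rewrite permE.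
  have {}fe x y : gadj d'.1 (p x) (p y) = gadj d.1 x y by rewrite !pE; exact: fe.
  have {}fh u : d'.2.1 u = (p @: d.2.1 u)%SET by rewrite (eq_imset _ pE); exact: fh.
  have {}ff v : d'.2.2 v = (p @: d.2.2 v)%SET by rewrite (eq_imset _ pE); exact: ff.
  exists p; case: d' fe fh ff {f fb pE} => g' [h' l'] /= fe fh ff.
  rewrite /ldata_act /=; congr (_, (_, _)); apply/ffunP => x; rewrite ffunE //.
  by case: x => x y /=; rewrite -[d.1 (_, _)]fe !permKV.
exists f; split=> [|x y|u|v] /=; rewrite ?ffunE //; last by rewrite /gadj ffunE /= !permK.
by exists (f^-1)%g; [exact: permK|exact: permKV].
Qed.

Definition lrelabel (pi : {perm U}) (tau : {perm W}) (d : ldata) : ldata :=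
  (d.1, ([ffun u => d.2.1 (pi u)], [ffun v => d.2.2 (tau v)])).

Lemma lrelabel_act pi tau d f : lrelabel pi tau (ldata_act d f) = ldata_act (lrelabel pi tau d) f.
Proof. by rewrite /lrelabel /ldata_act /=; congr (_, (_, _)); apply/ffunP => x; rewrite !ffunE. Qed.

Lemma lgraph_of_relabel (pi : {perm U}) (tau : {perm W}) d :
  relabel pi tau (lgraph_of d) = lgraph_of (lrelabel pi tau d).
Proof.
rewrite /relabel /lgraph_of /=; congr LGraph; apply/boolp.funext => x; rewrite /= ffunE //.
Qed.

Lemma lgraph_ofP (t : lgraph U W) : labeled_ktree k t -> exists d, lgraph_iso (lgraph_of d) t.
Proof.
move=> /labeled_ktree_order; case: t => [n e h l] /= nE; subst n.
exists ([ffun z => e z.1 z.2], ([ffun u => h u], [ffun v => l v])).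
exists id; split=> [|x y|u|v] /=; rewrite /gadj ?ffunE ?imset_id //.
by exists id.
Qed.

Definition labelled : {set ldata} := [set d | `[< labeled_ktree k (lgraph_of d) >]]%SET.

(** Structures are orbits of labelled data and relabelling commutes with the action, so the fixed
    structures are the orbits that relabelling preserves. *)
Lemma sp_fix_ktree (pi : {perm U}) (tau : {perm W}) :
  (sp_fix (ktree_species k) pi tau * N`! =
   \sum_(d in labelled) #|[set f | ldata_act d f == lrelabel pi tau d]%SET|)%N.
Proof.
rewrite [RHS](@twisted_Frobenius_Cauchy _ _ ldata_action labelled (lrelabel pi tau)); first last.
- by move=> d f; exact: lrelabel_act.
- move=> d; rewrite finset.in_set => /asboolP dk f; rewrite finset.in_set; apply/asboolP.
  by apply: (labeled_ktree_iso _ dk); apply/lgraph_of_iso; exists f.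
rewrite card_Sn; congr (_ * _)%N; set O := (_ @: _)%SET.
pose cls (o : {set ldata}) : set (lgraph U W) :=
  [set t | exists2 d, d \in o & lgraph_iso (lgraph_of d) t]%classic.
have clsE d : cls (orbit ldata_action [set: 'S_N] d) = iso_class (lgraph_of d).
  apply/seteqP; split=> t /=.
    move=> [_ /orbitP[f _ <-]]; apply: lgraph_iso_trans; apply/lgraph_of_iso.
    by exists f.
  by move=> dt; exists d => //; exact: orbit_refl.
have clsI : {in O &, injective cls}.
  move=> _ _ /imsetP[d _ ->] /imsetP[d' _ ->]; rewrite !clsE => e.
  have : iso_class (lgraph_of d') (lgraph_of d').
    by apply/lgraph_of_iso; exists 1%g; rewrite ldata_act1.
  rewrite -e => /lgraph_of_iso[f dE]; apply/esym/orbit_eqP/orbitP.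
  by exists f; rewrite ?finset.in_setT.
rewrite /sp_fix cardE -(size_map cls); apply: perm_size; apply: uniq_perm => [||C].
- exact: fset_uniq.
- by rewrite map_inj_in_uniq ?enum_uniq // => a b; rewrite !mem_enum; exact: clsI.
have fin : finite_set [set s : sp_univ (ktree_species k) U W |
    sp_str s /\ sp_tr pi tau s = s]%classic.
  by apply: sub_finite_set (ktree_str_finite k U W) => s [].
have fixP d : ktree_tr pi tau (iso_class (lgraph_of d)) = iso_class (lgraph_of d) <->
    lrelabel pi tau d \in orbit ldata_action [set: 'S_N] d.
  split=> [e|/orbitP[f _ fd]].
    have : iso_class (lgraph_of d) (lgraph_of d).
      by apply/lgraph_of_iso; exists 1%g; rewrite ldata_act1.
    rewrite -{1}e /ktree_tr /= lgraph_of_relabel => /lgraph_of_iso[f ->].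
    by apply/orbitP; exists f; rewrite ?finset.in_setT.
  have ds : lgraph_iso (lgraph_of d) (relabel pi tau (lgraph_of d)).
    by rewrite lgraph_of_relabel; apply/lgraph_of_iso; exists f.
  apply/seteqP; split=> t /=; rewrite /ktree_tr /iso_class /=.
    by move=> dt; apply/(lgraph_iso_relabel pi tau); apply: lgraph_iso_trans dt; exact: lgraph_iso_sym.
  by move=> dt; apply: lgraph_iso_trans ds _; apply/lgraph_iso_relabel.
apply/idP/mapP => [|[o]].
  rewrite in_fset_set // inE => -[[t tk ->] e].
  have [d dt] := lgraph_ofP tk.
  have tE : iso_class t = iso_class (lgraph_of d).
    apply/seteqP; split=> t'; first exact: lgraph_iso_trans.
    by apply: lgraph_iso_trans; exact: lgraph_iso_sym.
  exists (orbit ldata_action [set: 'S_N] d); last by rewrite clsE tE.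
  rewrite mem_enum; apply: imset_f; rewrite finset.in_set; apply/andP; split; last first.
    by apply/fixP; rewrite -tE.
  by rewrite finset.in_set; apply/asboolP; apply: (labeled_ktree_iso _ tk); exact: lgraph_iso_sym.
rewrite mem_enum => /imsetP[d]; rewrite finset.in_set => /andP[]; rewrite finset.in_set => /asboolP dk dr -> ->.
rewrite clsE in_fset_set // inE; split; last exact/fixP.
by exists (lgraph_of d).
Qed.

Definition labeling (j : nat) (V X : finType) (g : graph V) (h : {ffun X -> {set V}}) : bool :=
  injectiveb h && ((h @: [set: X])%SET == cliques j g).

Lemma labelingP j (V X : finType) (g : graph V) (h : {ffun X -> {set V}}) :
  set_bij [set: X] [set A | clique (gadj g) j A] h <-> labeling j g h.
Proof.
split=> [[h1 h2 h3]|/andP[/injectiveP hI /eqP hC]].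
  apply/andP; split; first by apply/injectiveP => x y e; apply: h2; rewrite ?in_setT.
  apply/eqP/setP => A; rewrite [RHS]finset.in_set; apply/imsetP/idP => [[x _ ->]|/h3[x _ <-]].
    exact: h1.
  by exists x.
have mem A : (A \in h @: [set: X])%SET = clique (gadj g) j A by rewrite hC finset.in_set.
split=> [x _|x y _ _ /hI//|A /=]; first by rewrite /= -mem imset_f.
by rewrite -mem => /imsetP[x _ ->]; exists x.
Qed.

Lemma labelledP (d : ldata) :
  (d \in labelled) = [&& `[< ktree (gadj d.1) k >], labeling k.+1 d.1 d.2.1 & labeling k d.1 d.2.2].
Proof.
rewrite finset.in_set; apply/asboolP/and3P => [[kt hb fb]|[/asboolP kt hb fb]].
  by split; [exact/asboolP|exact/labelingP|exact/labelingP].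
by split; [exact: kt|exact/labelingP|exact/labelingP].
Qed.

Lemma card_labelings j (V X : finType) (g : graph V) :
  #|[set h : {ffun X -> {set V}} | labeling j g h]%SET| =
  (if #|cliques j g| == #|X| then (#|X|)`! else 0)%N.
Proof.
case: eqP => [cX|nX].
  rewrite -(ffactnn #|X|) -{1}cX -(card_inj_ffuns_on X (mem (cliques j g))).
  apply: eq_card => h; rewrite finset.in_set [RHS]finset.in_set andbC /labeling.
  case: injectiveP => [hI|]; rewrite ?andbF ?andbT //=.
  apply/eqP/ffun_onP => [<- x|hC]; first exact: imset_f.
  apply/eqP; rewrite eqEcard cX card_imset // cardsT leqnn andbT.
  by apply/fintype.subsetP => _ /imsetP[x _ ->]; exact: hC.
apply/eqP; rewrite cards_eq0 -finset.subset0; apply/fintype.subsetP => h.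
rewrite finset.in_set => /andP[/injectiveP hI /eqP hC].
by case: nX; rewrite -hC card_imset // cardsT.
Qed.

Lemma card_labelled (g : graph 'I_N) :
  #|[set d in labelled | d.1 == g]%SET| =
  (if [&& `[< ktree (gadj g) k >], #|cliques k.+1 g| == #|U| & #|cliques k g| == #|W|]
   then (#|U|)`! * (#|W|)`! else 0)%N.
Proof.
have eX : [set d in labelled | d.1 == g]%SET =
    [set (g, z) | z in if `[< ktree (gadj g) k >] then
      finset.setX [set h | labeling k.+1 g h]%SET [set h | labeling k g h]%SET else finset.set0]%SET.
  apply/setP => -[g' [h f]]; rewrite finset.in_set; apply/andP/imsetP => [[]|[[h' f']]].
    rewrite labelledP => /and3P[kt hb fb] /= /eqP dg; exists (h, f); last by rewrite -dg.
    by rewrite -dg kt finset.in_setX !finset.in_set hb fb.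
  case: ifP => [kt|_]; last by rewrite finset.in_set0.
  move=> hf ->; rewrite labelledP /= kt; move: hf.
  by rewrite finset.in_setX !finset.in_set => /andP[-> ->].
rewrite eX card_imset => [|z z' []//]; case: ifP => _; rewrite ?cards0 //=.
by rewrite cardsX !card_labelings; do 2!case: ifP => _; rewrite ?muln0 ?mul0n.
Qed.

Definition aut (V : finType) (g : graph V) (f : {perm V}) : bool :=
  [forall x, forall y, g (f x, f y) == g (x, y)].

Definition of_perm (V : finType) (z : graph V * {perm V}) : graph V * {ffun V -> V} :=
  (z.1, [ffun x => z.2 x]).

Lemma labeling_perm j (V X : finType) (g : graph V) (h : {ffun X -> {set V}}) (f : {perm V}) :
  labeling j g h -> aut g f ->
  exists2 s : {perm X}, forall x, h (s x) = (f @: h x)%SET &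
   forall p, cyc p s [set: X] = cyc p (fun A : {set V} => [ffun x => f x] @: A)%SET (cliques j g).
Proof.
move=> /andP[/injectiveP hI /eqP hC] /forallP af.
have fa x y : gadj g (f x) (f y) = gadj g x y by apply/eqP; have /forallP := af x; exact.
have ex x : exists y, h y = (f @: h x)%SET.
  have : (f @: h x)%SET \in (h @: [set: X])%SET.
    rewrite hC finset.in_set (clique_imset _ _ perm_inj fa).
    have : h x \in cliques j g by rewrite -hC imset_f.
    by rewrite finset.in_set.
  by case/imsetP => y _ ->; exists y.
have [s sP] := choice ex.
have sI : injective s.
  by move=> x y e; apply: hI; apply: (imset_inj (@perm_inj _ f)); rewrite -!sP e.
exists (perm sI) => [x|p]; first by rewrite permE.
rewrite -hC; apply: cyc_bij => [x y _ _ /hI//|x _|x _]; first by rewrite finset.in_setT.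
by rewrite permE sP; apply: eq_imset => y; rewrite ffunE.
Qed.

(** An automorphism permutes the labelled hedra and fronts, so it realizes exactly one pair of label
    permutations, with the cycle types recorded by [graph_wt]. Any other permutation of the vertices
    realizes none. *)
Lemma sum_label_perms (d : ldata) (f : 'S_N) : d \in labelled ->
  \sum_(pt : {perm U} * {perm W} | ldata_act d f == lrelabel pt.1 pt.2 d)
    cyc px pt.1 [set: U] * cyc py pt.2 [set: W] =
  if aut d.1 f then graph_wt k (of_perm (d.1, f)) else 0.
Proof.
rewrite labelledP => /and3P[_ hb fb]; have /andP[/injectiveP hI _] := hb.
have /andP[/injectiveP lI _] := fb.
case: ifP => [af|naf]; last first.
  apply: big1 => pt /eqP[/ffunP e _ _]; case/negP: naf; apply/forallP => x; apply/forallP => y.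
  by have := e (f x, f y); rewrite !ffunE /= !permK => ->.
have [s sh sw] := labeling_perm hb af; have [t tl tw] := labeling_perm fb af.
rewrite (big_pred1 (s, t)) => [|[pi tau]]; first exact: (congr2 *%R (sw px) (tw py)).
rewrite [RHS]xpair_eqE; apply/eqP/andP => [[_ /ffunP eh /ffunP el]|[/eqP -> /eqP ->]].
  split; apply/eqP/permP => x.
    by apply: hI; have := eh x; rewrite !ffunE sh.
  by apply: lI; have := el x; rewrite !ffunE tl.
rewrite /ldata_act /lrelabel /=; congr (_, (_, _)); apply/ffunP => x; rewrite !ffunE ?sh ?tl //.
case: x => x y /=; have /forallP/(_ (f^-1 x)%g)/forallP/(_ (f^-1 y)%g)/eqP := af.
by rewrite !permKV.
Qed.

(** Exchanging the sums eliminates the label permutations. A k-tree with the right numbers of hedra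
    and fronts then has |U|! |W|! labellings, which will cancel the factorials in the definition of
    the cycle index. *)
Lemma sum_sp_fix :
  (\sum_(pt : {perm U} * {perm W}) (sp_fix (ktree_species k) pt.1 pt.2)%:R *:
     (cyc px pt.1 [set: U] * cyc py pt.2 [set: W])) *+ N`! =
  (\sum_(p : graph 'I_N * {ffun 'I_N -> 'I_N} |
       [&& `[< graph_ok k p >], #|cliques k.+1 p.1| == #|U| & #|cliques k p.1| == #|W|])
     graph_wt k p) *+ ((#|U|)`! * (#|W|)`!) :> series.
Proof.
pose Psi g : series := \sum_(f : 'S_N | aut g f) graph_wt k (of_perm (g, f)).
transitivity (\sum_(d in labelled) Psi d.1).
  rewrite -sumrMnl.
  under eq_bigr => pt _.
    rewrite scalerMnl -mulrnA sp_fix_ktree scaler_nat -sumrMnr.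
    under eq_bigr => d _ do rewrite -sumr_const.
    over.
  rewrite exchange_big /=; apply: eq_bigr => d dl.
  rewrite (exchange_big_dep (fun=> true)) //= /Psi [RHS]big_mkcond; apply: eq_bigr => f _.
  by rewrite -(sum_label_perms f dl); apply: eq_bigl => pt; rewrite finset.in_set.
rewrite (partition_big (fun d : ldata => d.1) predT) //=.
transitivity (\sum_(g : graph 'I_N) Psi g *+ #|[set d in labelled | d.1 == g]%SET|).
  apply: eq_bigr => g _; rewrite -sumr_const; apply: eq_big => [d|d /andP[_ /eqP -> //]].
  by rewrite finset.in_set.
pose C (g : graph 'I_N) := [&& `[< ktree (gadj g) k >], #|cliques k.+1 g| == #|U| & #|cliques k g| == #|W|].
transitivity ((\sum_(g | C g) Psi g) *+ ((#|U|)`! * (#|W|)`!)).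
  rewrite -sumrMnl [RHS]big_mkcond; apply: eq_bigr => g _.
  by rewrite (card_labelled g) -/(C g); case: (C g); rewrite ?mulr0n.
apply: (congr1 (fun z => z *+ _)).
rewrite (pair_big_dep C (fun g f => aut g f) (fun g f => graph_wt k (of_perm (g, f)))) /=.
pose X := [set z : graph 'I_N * 'S_N | C z.1 && aut z.1 z.2]%SET.
have oI : {in X &, injective (@of_perm 'I_N)}.
  move=> [g f] [g' f'] _ _ [-> /ffunP e]; congr pair; apply/permP => x.
  by have := e x; rewrite !ffunE.
have bi := @big_imset series 0 +%R _ _ _ _ (@graph_wt k 'I_N) oI.
transitivity (\sum_(z in X) graph_wt k (of_perm z)).
  by apply: eq_big => [z|[g f] _ //]; rewrite [RHS]finset.in_set.
apply: etrans (esym bi) _; apply: eq_bigl => p; apply/imsetP/idP => [[z]|].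
  rewrite finset.in_set => /andP[/and3P[/asboolP kt c1 c2] /forallP af] ->.
  rewrite c1 c2 !andbT; apply/asboolP; split=> //= [x y|x y]; rewrite !ffunE.
    exact: perm_inj.
  by apply/eqP; have /forallP := af x; exact.
move=> /and3P[/asboolP[kt pI pa] c1 c2].
exists (p.1, perm pI).
  rewrite finset.in_set /C /= c1 c2 !andbT; apply/andP; split; first exact/asboolP.
  by apply/forallP => x; apply/forallP => y; rewrite !permE; apply/eqP; exact: pa.
by case: p pI {kt pa c1 c2} => g f pI; congr pair; apply/ffunP => x; rewrite ffunE permE.
Qed.

End Labelled.

(** * The cycle index *)

Section ConjugationSum.
Variable k : nat.

Definition hed_series (s : 'S_k.+1) : series :=
  px 1 * (cyc py s [set: 'I_k.+1]%SET * forestF s [set: 'I_k.+1]%SET).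

Lemma hed_series_conj (s p : 'S_k.+1) : hed_series (s ^ p)%g = hed_series s.
Proof.
have pT : [set: 'I_k.+1]%SET = (p @: [set: 'I_k.+1])%SET.
  by apply/setP => i; rewrite in_setT -(permKV p i) imset_f ?in_setT.
have sp a : p (s a) = (s ^ p)%g (p a) by rewrite permJ.
have pB : bijective p by exists (p^-1)%g; [exact: permK|exact: permKV].
have ec : cyc py (s ^ p)%g [set: 'I_k.+1]%SET = cyc py s [set: 'I_k.+1]%SET.
  rewrite [in LHS]pT; apply/esym/cyc_bij => [i j _ _ /perm_inj//|i _|i _]; last exact: sp.
  by rewrite in_setT.
have ef : forestF (s ^ p)%g [set: 'I_k.+1]%SET = forestF s [set: 'I_k.+1]%SET.
  by rewrite [in LHS]pT; exact: (forestF_conj pB sp (@perm_inj _ s)).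
by rewrite /hed_series ec ef.
Qed.

Lemma Delta_invK (s : 'S_k.+1) : s ord0 = ord0 -> Delta (Delta_inv s) = s.
Proof.
move=> s0; have := Delta_inv_rhoK s [:: ord0]; rewrite big_seq1 (_ : rho s ord0 = s) //.
by apply/permP => a; rewrite permE /rho_fun s0 [ord0 + a]add0r [s a - ord0]subr0.
Qed.

Lemma sum_nfix_hed_series :
  \sum_(s : 'S_k.+1) (nfix s)%:R *: hed_series s =
  (k.+1%:R : rat) *: \sum_(s : 'S_k) hed_series (Delta s).
Proof.
transitivity (\sum_(s : 'S_k.+1) \sum_(i | s i == i) hed_series s).
  apply: eq_bigr => s _; rewrite scaler_nat -sumr_const; apply: eq_bigl => i.
  by rewrite inE.
rewrite (exchange_big_dep (fun=> true)) //= scaler_nat -[in X in _ *+ X](card_ord k.+1) -sumr_const.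
(* Conjugation by the transposition of [i] and [ord0] carries the permutations fixing [i] to those
   fixing [ord0], that is, to the image of [Delta]. *)
apply: eq_bigr => i _; pose p := tperm i ord0.
rewrite (reindex_inj (conjg_inj p)) /=; under eq_bigr => s _ do rewrite hed_series_conj.
rewrite (reindex_onto (@Delta k) (@Delta_inv k)) => [|s]; last first.
  move=> /eqP; rewrite -{1}(tpermR i ord0) -/p permJ => e; apply: Delta_invK.
  by apply: (@perm_inj _ p); rewrite e tpermR.
apply: eq_bigl => s; rewrite DeltaK eqxx andbT.
by rewrite -{1}(tpermR i ord0) -/p permJ Delta0 tpermR eqxx.
Qed.

End ConjugationSum.

Section SingleTerm.
Import classical_sets functions cardinality fsbigop.

Lemma ssum_single (I : choiceType) (F : I -> series) i u :
  (forall j, j <> i -> F j u = 0) -> ssum setT F u = F i u.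
Proof.
move=> F0; rewrite /ssum -(fsbig_widen [set i]%classic); first by rewrite fsbig_set1.
  by [].
by move=> j /= [_ ji]; exact: F0.
Qed.

End SingleTerm.

Lemma homog_graph_wt k (V : finType) (p : graph V * {ffun V -> V}) : graph_ok k p ->
  homog xvar #|cliques k.+1 p.1| (graph_wt k p) /\ homog yvar #|cliques k p.1| (graph_wt k p).
Proof.
move=> [_ pI aut]; have fA j : {in cliques j p.1, forall A : {set V}, (p.2 @: A)%SET \in cliques j p.1}.
  by move=> A; rewrite !inE (clique_imset _ _ pI aut).
split.
  rewrite -[X in homog _ X]addn0; apply: homog_mul (homog_cycy _ _).
  exact: homog_cycx (imset_inj pI) (@fA _).
rewrite -[X in homog _ X]add0n; apply: homog_mul (homogy_cycx _ _) _.
exact: homogy_cycy (imset_inj pI) (@fA _).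
Qed.

(** The [x]- and [y]-degrees of a weight are the numbers of hedra and fronts, so at [u] the
    conditions on these numbers discard only zero terms. *)
Lemma sum_graph_wt_cards k (V : finType) u a b : a = xw u -> b = yw u ->
  (\sum_(p : graph V * {ffun V -> V} | `[< graph_ok k p >]) graph_wt k p) u =
  (\sum_(p : graph V * {ffun V -> V} |
    [&& `[< graph_ok k p >], #|cliques k.+1 p.1| == a & #|cliques k p.1| == b]) graph_wt k p) u :> rat.
Proof.
move=> -> ->; pose c (p : graph V * {ffun V -> V}) :=
  (#|cliques k.+1 p.1| == xw u) && (#|cliques k p.1| == yw u).
have Z0 : (\sum_(p : graph V * {ffun V -> V} | `[< graph_ok k p >] && ~~ c p) graph_wt k p) u = 0 :> rat.
  rewrite sumE big1 // => p /andP[/asboolP/homog_graph_wt[hx hy]].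
  by rewrite negb_and => /orP[]; rewrite eq_sym; [exact: hx|exact: hy].
by rewrite (bigID c) /= addE Z0 addr0.
Qed.

(** At [u], homogeneity leaves only the term with [m = xw u] and [n = yw u]. The number of vertices
    is written with [#|'I_(xw u)|] to agree with [sum_sp_fix]. *)
Lemma cycle_index_ktree k u : let V := 'I_(#|'I_(xw u)| + k) in
  cycle_index (ktree_species k) u = ((xw u + k)`!%:R : rat)^-1 *
    (\sum_(p : graph V * {ffun V -> V} | `[< graph_ok k p >]) graph_wt k p) u.
Proof.
move=> V.
have prodE m n (pt : 'S_m * 'S_n) :
    \prod_(1 <= j < (m + n).+1) (px j ^+ ncycles pt.1 j * py j ^+ ncycles pt.2 j) =
    cyc px pt.1 [set: 'I_m]%SET * cyc py pt.2 [set: 'I_n]%SET.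
  have hm : (#|'I_m| <= m + n)%N by rewrite card_ord leq_addr.
  have hn : (#|'I_n| <= m + n)%N by rewrite card_ord leq_addl.
  apply: etrans (big_split _ _ _ _ _) _.
  exact: (congr2 *%R (cyc_ncycles px pt.1 hm) (cyc_ncycles py pt.2 hn)).
have prod0 m n (pt : 'S_m * 'S_n) : (m, n) <> (xw u, yw u) ->
    (cyc px pt.1 [set: 'I_m]%SET * cyc py pt.2 [set: 'I_n]%SET) u = 0.
  move=> mn; have [xm|xm] := eqVneq (xw u) m; last first.
    have h := homog_mul (homog_cycx (@perm_inj _ pt.1) (fun x _ => in_setT (pt.1 x)))
      (homog_cycy pt.2 [set: 'I_n]%SET).
    by apply: h; rewrite cardsT card_ord addn0.
  have h := homog_mul (homogy_cycx pt.1 [set: 'I_m]%SET)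
    (homogy_cycy (@perm_inj _ pt.2) (fun x _ => in_setT (pt.2 x))).
  by apply: h; rewrite cardsT card_ord add0n; apply/eqP => yn; apply: mn; rewrite xm yn.
rewrite /cycle_index (ssum_single (i := (xw u, yw u))) => [|[m n] mn]; last first.
  rewrite scaleE sumE big1 ?mulr0 // => pt _.
  by rewrite scaleE prodE (prod0 _ _ pt mn) mulr0.
rewrite scaleE /=; under eq_bigr => pt _ do rewrite prodE.
set A := \sum_(pt : _ * _) _; set B := (\sum_(p | _) _).
have := congr1 (fun f : series => f u) (sum_sp_fix k 'I_(xw u) 'I_(yw u)).
rewrite -/A; set B' : series := (\sum_(p | _) graph_wt k p).
rewrite -!scaler_nat !scaleE !card_ord => E.
have BB := @sum_graph_wt_cards k V u _ _ (card_ord (xw u)) (card_ord (yw u)); rewrite -/B -/B' in BB.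
have fn0 n : (n`!%:R : rat) != 0 by rewrite pnatr_eq0 -lt0n fact_gt0.
apply: (mulfI (fn0 (xw u + k)%N)); rewrite mulVKf //; apply: etrans (esym BB).
rewrite mulrCA E natrM; exact: (mulKf (mulf_neq0 (fn0 _) (fn0 _))).
Qed.

Lemma rooted_fronts k s (sr : 'S_k) :
  \sum_(q : graph ('I_k + 'I_s)%type * {ffun _ -> _} | `[< rooted_ok k sr q >]) graph_wt k q =
  (s`!%:R : rat) *: (py 1 * forest_sum s (Delta sr) [set ord0]%SET).
Proof.
have srg r : lift ord0 (sr r) = Delta sr (lift ord0 r) := esym (Delta_lift sr r).
have Ist : {in [set ord0]%SET, forall l : 'I_k.+1, Delta sr l \in [set ord0]%SET}.
  by move=> l /set1P ->; rewrite Delta0 set11.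
have E := @sum_rooted k 'I_k.+1 'I_k 'I_s (lift ord0) [set ord0]%SET (card_ord k.+1) (@lift_inj _ ord0) (@fr_I1 k) (@fr_I2 k)
  (or_introl (card_ord k)) (Delta sr) sr (@perm_inj _ (Delta sr)) (@perm_inj _ sr) srg Ist.
apply: etrans E _.
have e0 : root_wt k 'I_k = 1 by rewrite /root_wt card_ord ltn_eqF.
have e1 : cyc py (Delta sr) [set ord0]%SET = py 1 := cyc1 py (Delta0 sr).
have e2 : \sum_(x : code 'I_k.+1 'I_s | `[< code_ok (Delta sr) [set ord0]%SET x >]) code_wt (Delta sr) x =
    (s`!%:R : rat) *: forest_sum s (Delta sr) [set ord0]%SET.
  by rewrite /forest_sum scalerA divff ?scale1r // pnatr_eq0 -lt0n fact_gt0.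
have e01 := etrans (congr2 *%R e0 e1) (mul1r (py 1)).
exact: etrans (congr2 *%R e01 e2) (scale_mulr _ _ _).
Qed.

Lemma rooted_hedra k s (sr : 'S_k.+1) :
  \sum_(q : graph ('I_k.+1 + 'I_s)%type * {ffun _ -> _} | `[< rooted_ok k sr q >]) graph_wt k q =
  (s`!%:R : rat) *: (px 1 * cyc py sr [set: 'I_k.+1]%SET * forest_sum s sr [set: 'I_k.+1]%SET).
Proof.
have srg r : id (sr r) = sr (id r) := erefl _.
have Ist : {in [set: 'I_k.+1]%SET, forall l : 'I_k.+1, sr l \in [set: 'I_k.+1]%SET}.
  by move=> l _; rewrite in_setT.
have E := @sum_rooted k 'I_k.+1 'I_k.+1 'I_s id [set: 'I_k.+1]%SET (card_ord k.+1) (@inj_id _) (@hed_I1 k) (@hed_I2 k)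
  (or_intror (card_ord k.+1)) sr sr (@perm_inj _ sr) (@perm_inj _ sr) srg Ist.
apply: etrans E _.
have e0 : root_wt k 'I_k.+1 = px 1 by rewrite /root_wt card_ord eqxx.
have e2 : \sum_(x : code 'I_k.+1 'I_s | `[< code_ok sr [set: 'I_k.+1]%SET x >]) code_wt sr x =
    (s`!%:R : rat) *: forest_sum s sr [set: 'I_k.+1]%SET.
  by rewrite /forest_sum scalerA divff ?scale1r // pnatr_eq0 -lt0n fact_gt0.
have e01 := congr1 (fun z : series => z * cyc py sr [set: 'I_k.+1]%SET) e0.
exact: etrans (congr2 *%R e01 e2) (scale_mulr _ _ _).
Qed.

Lemma ZYc_coef k (s : 'S_k) u : ZYc s u = (py 1 * forest_sum (xw u) (Delta s) [set ord0]%SET) u.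
Proof.
have hW n : homog xvar n (forest_sum n (Delta s) [set ord0]%SET) := @homog_forest_sum _ _ _ _.
by have := gsum_homogM u (@homog_py 1) hW; rewrite subn0.
Qed.

Lemma hed_series_coef k (s : 'S_k.+1) u : hed_series s u =
  if (0 < xw u)%N then
    (px 1 * cyc py s [set: 'I_k.+1]%SET * forest_sum (xw u).-1 s [set: 'I_k.+1]%SET) u else 0.
Proof.
have hW n : homog xvar n (forest_sum n s [set: 'I_k.+1]%SET) := @homog_forest_sum _ _ _ _.
have h : homog xvar 1 (px 1 * cyc py s [set: 'I_k.+1]%SET) :=
  homog_mul (homog_px (ltn0Sn 0)) (homog_cycy s _).
have := gsum_homogM u h hW; rewrite subn1 => <-.
by rewrite /hed_series mulrA.
Qed.

Section Parts.
Variables (k : nat) (V : finType) (u : monomial).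
Hypothesis cV : #|V| = (xw u + k)%N.

Let fn0 n : (n`!%:R : rat) != 0.
Proof. by rewrite pnatr_eq0 -lt0n fact_gt0. Qed.

Lemma fronts_part :
  (\sum_(p : graph V * {ffun V -> V} | `[< graph_ok k p >])
     (#|[set A in cliques k p.1 | (p.2 @: A == A)%SET]%SET|%:R : rat) *: graph_wt k p) u =
  ((xw u + k)`!%:R : rat) * ((k`!%:R : rat)^-1 * (\sum_(s : 'S_k) ZYc s) u).
Proof.
have cV' : #|V| = (#|'I_k| + #|'I_(xw u)|)%N by rewrite !card_ord addnC.
have := congr1 (fun f : series => f u) (root_count cV' k (fun=> 1)).
rewrite !card_ord cV -!scaler_nat !scaleE.
set L := (\sum_(p | _) _); set R := (\sum_sr _) => E.
set L' := (\sum_(p | _) _ : series).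
have LL : L = L'.
  apply: eq_bigr => p _; apply: (congr1 (fun z => z *: _)).
  by rewrite -sum1_card natr_sum; apply: eq_bigl => A; rewrite [RHS]inE.
have RE : R u = (xw u)`!%:R * (\sum_(s : 'S_k) ZYc s) u :> rat.
  rewrite /R !sumE mulr_sumr; apply: eq_bigr => s _.
  by rewrite scale1r rooted_fronts scaleE ZYc_coef.
rewrite -LL; apply: (mulfI (fn0 k)); apply: (mulfI (fn0 (xw u))).
rewrite mulrA -natrM [((xw u)`! * k`!)%N]mulnC E RE.
by rewrite [k`!%:R * _]mulrCA mulVKf // mulrCA.
Qed.

Lemma hedra_part :
  (\sum_(p : graph V * {ffun V -> V} | `[< graph_ok k p >])
     (\sum_(A in cliques k.+1 p.1 | (p.2 @: A == A)%SET)
        (1 - #|[set y in A | p.2 y == y]%SET|%:R) : rat) *: graph_wt k p) u =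
  ((xw u + k)`!%:R : rat) * (((k.+1)`!%:R : rat)^-1 *
     (\sum_(s : 'S_k.+1) (1 - (nfix s)%:R) *: hed_series s) u).
Proof.
(* A root hedron takes [k.+1] of the [xw u + k] vertices, so [(xw u).-1] are left for the forest.
   When [xw u] is [0] there is no hedron and both sides vanish. *)
case xu : (xw u) => [|m].
  rewrite !sumE big1 => [|p /asboolP pok].
    rewrite big1 ?mulr0 // => s _.
    by rewrite scaleE hed_series_coef xu mulr0.
  rewrite scaleE; case: (posnP #|cliques k.+1 p.1|) => [c0|cp].
    rewrite big_pred0 ?mul0r // => A; move/eqP: c0; rewrite cards_eq0 => /eqP ->.
    by rewrite in_set0.
  have [hx _] := homog_graph_wt pok; rewrite hx ?mulr0 //.
  by rewrite xu eq_sym -lt0n.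
have cV' : #|V| = (#|'I_k.+1| + #|'I_m|)%N by rewrite !card_ord cV xu !addSn addnC.
have := congr1 (fun f : series => f u) (root_count cV' k (fun n => 1 - n%:R)).
rewrite !card_ord cV xu -!scaler_nat !scaleE.
set L := (\sum_(p | _) _); set R := (\sum_sr _) => E.
have RE : R u = m`!%:R * (\sum_(s : 'S_k.+1) (1 - (nfix s)%:R) *: hed_series s) u :> rat.
  rewrite /R !sumE mulr_sumr; apply: eq_bigr => s _.
  by rewrite !scaleE rooted_hedra scaleE hed_series_coef xu mulrCA.
apply: (mulfI (fn0 k.+1)); apply: (mulfI (fn0 m)).
rewrite mulrA -natrM [(m`! * (k.+1)`!)%N]mulnC E RE.
by rewrite [(k.+1)`!%:R * _]mulrCA mulVKf // mulrCA.
Qed.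

End Parts.

Theorem mainTheorem2 (k : nat) (hk : (1 <= k)%N)
    (start : 'S_k -> {set 'I_k} -> 'I_k)
    (start1 : 'S_k.+1 -> {set 'I_k.+1} -> 'I_k.+1)
    (hstart : cycle_start start) (hstart1 : cycle_start start1)
    (ZY : 'S_k -> series) (hZY : ZY_system start ZY) :
  cycle_index (ktree_species k) =
    ((k.+1)`!%:R : rat)^-1 *: (\sum_(s : 'S_k.+1) ZXY start1 ZY s)
    + (k`!%:R : rat)^-1 *: (\sum_(s : 'S_k) ZY s)
    - (k`!%:R : rat)^-1 *: (\sum_(s : 'S_k) ZXY start1 ZY (Delta s)).
Proof.
rewrite (ZYc_unique hstart hZY).
rewrite (eq_bigr (@hed_series k)) => [|s _]; last exact: ZXY_ZYc.
rewrite [X in _ - _ *: X](eq_bigr (fun s => hed_series (Delta s))) => [|s _]; last exact: ZXY_ZYc.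
apply/funext => u; rewrite cycle_index_ktree; set V := 'I_(_ + k).
have cV : #|V| = (xw u + k)%N by rewrite /V !card_ord.
have fn0 n : (n`!%:R : rat) != 0 by rewrite pnatr_eq0 -lt0n fact_gt0.
(* This turns the factor [k.+1] of [sum_nfix_hed_series] into the coefficient 1/k! of the last
   sum. *)
have c : (k.+1)`!%:R^-1 * k.+1%:R = k`!%:R^-1 :> rat.
  by rewrite factS natrM invfM mulrAC mulVf ?mul1r // pnatr_eq0.
(* Every pair is multiplied by the left side of [dissymmetry], which equals [1]; this separates the
   roots that are hedra from those that are fronts. *)
have -> : \sum_(p : graph V * {ffun V -> V} | `[< graph_ok k p >]) graph_wt k p =
    \sum_(p : graph V * {ffun V -> V} | `[< graph_ok k p >])
     (\sum_(A in cliques k.+1 p.1 | (p.2 @: A == A)%SET)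
        (1 - #|[set y in A | p.2 y == y]%SET|%:R) : rat) *: graph_wt k p +
    \sum_(p : graph V * {ffun V -> V} | `[< graph_ok k p >])
     (#|[set A in cliques k p.1 | (p.2 @: A == A)%SET]%SET|%:R : rat) *: graph_wt k p.
  rewrite -big_split /=; apply: eq_bigr => p /asboolP pok.
  by rewrite -scalerDl dissymmetry // scale1r.
rewrite [in LHS]addE hedra_part // fronts_part // -mulrDr mulKf //.
have -> : \sum_(s : 'S_k.+1) (1 - (nfix s)%:R) *: hed_series s =
    \sum_(s : 'S_k.+1) hed_series s - (k.+1%:R : rat) *: \sum_(s : 'S_k) hed_series (Delta s).
  rewrite -sum_nfix_hed_series -sumrB; apply: eq_bigr => s _.
  by rewrite scalerBl scale1r.
rewrite !addE !oppE !scaleE mulrBr -!addrA; congr (_ + _).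
rewrite addrC; congr (_ + - _).
by rewrite mulrA c.
Qed.
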